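(* Let $g\in\mathcal{S}(\mathbb{R}^d)\setminus\{0\}$, $m\in\mathbb{R}$ and $\sigma\in S^m(\mathbb{R}^{2d})$. Then for every $s\ge0$ and $0<q\le\infty$ there exist functions $H_\tau\in L^q_{\langle\cdot\rangle^s}(\mathbb{R}^{2d})$, $\tau\in[0,1]$, and a constant $C>0$ with $\|H_\tau\|_{L^q_{\langle\cdot\rangle^s}}\le C$ for all $\tau\in[0,1]$, such that $$|\langle\mathrm{Op}_{BJ}(\sigma)\pi(z)g,\pi(u)g\rangle|\le\langle z\rangle^m\int_0^1H_\tau(u-z)\,d\tau,\qquad\forall u,z\in\mathbb{R}^{2d}.$$
   Context: $\langle z\rangle=(1+|z|^2)^{1/2}$. $S^m(\mathbb{R}^{2d})$ is the set of $\sigma\in C^\infty(\mathbb{R}^{2d})$ such that for every $\alpha\in\mathbb{N}^{2d}$ there is $C_\alpha$ with $|\partial^\alpha\sigma(z)|\le C_\alpha\langle z\rangle^m$ for all $z$. For $\tau\in[0,1]$ and $f,g\in\mathcal{S}(\mathbb{R}^d)$, $W_\tau(f,g)(x,\omega)=\int_{\mathbb{R}^d}e^{-2\pi iy\cdot\omega}f(x+\tau y)\overline{g(x-(1-\tau)y)}\,dy$, and the Born–Jordan distribution is $W_{BJ}(f,g)=\int_0^1W_\tau(f,g)\,d\tau$, which belongs to $\mathcal{S}(\mathbb{R}^{2d})$. For $\sigma\in\mathcal{S}'(\mathbb{R}^{2d})$, the Born–Jordan operator $\mathrm{Op}_{BJ}(\sigma):\mathcal{S}(\mathbb{R}^d)\to\mathcal{S}'(\mathbb{R}^d)$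 is defined by $\langle\mathrm{Op}_{BJ}(\sigma)f,g\rangle=\langle\sigma,W_{BJ}(g,f)\rangle$, $f,g\in\mathcal{S}(\mathbb{R}^d)$; $\langle\cdot,\cdot\rangle$ is the duality extending the $L^2$ inner product (antilinear in the second entry). For $z=(x,\omega)$, $\pi(z)f(t)=e^{2\pi i\omega\cdot t}f(t-x)$. $\|H\|_{L^q_{\langle\cdot\rangle^s}}=\big(\int_{\mathbb{R}^{2d}}|H(z)|^q\langle z\rangle^{sq}dz\big)^{1/q}$ (essential supremum if $q=\infty$). *)

(* Defs.v *)
From HB Require Import structures.
From mathcomp Require Export all_boot all_order all_algebra.
From mathcomp Require Export complex.
From mathcomp Require Export all_classical all_reals all_analysis.
Set Implicit Arguments.
Unset Strict Implicit.
Unset Printing Implicit Defensive.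
Import Order.TTheory GRing.Theory Num.Theory.
Import numFieldNormedType.Exports.
Local Open Scope classical_set_scope.
Local Open Scope ring_scope.

(* R^n is 'rV[R]_n, with the sigma-algebra generated by the coordinates. *)
Definition rV_display : measure_display. Proof. exact: default_measure_display. Qed.

Section measurable_rV.
Context {R : realType} (n : nat).

Let coord (i : 'I_n) (v : 'rV[R]_n) : measurableTypeR R := v ord0 i.

Let rV_set0 : g_sigma_preimage coord set0.
Proof. exact: sigma_algebra0. Qed.

Let rV_setC A : g_sigma_preimage coord A -> g_sigma_preimage coord (~` A).
Proof. exact: sigma_algebraC. Qed.

Let rV_bigcup (F : (set 'rV[R]_n)^nat) :
  (forall i, g_sigma_preimage coord (F i)) ->
  g_sigma_preimage coord (\bigcup_i (F i)).
Proof. exact: sigma_algebra_bigcup. Qed.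

HB.instance Definition _ := @isMeasurable.Build rV_display
  'rV[R]_n (g_sigma_preimage coord) rV_set0 rV_setC rV_bigcup.

Lemma measurable_rV_coord (i : 'I_n) :
  measurable_fun [set: 'rV[R]_n] (coord i).
Proof.
move=> _ Y mY; rewrite setTI; apply: sub_sigma_algebra => /=.
rewrite -bigcup_seq/=; exists i => /=; first by rewrite mem_index_enum.
by exists Y => //; rewrite setTI.
Qed.

Lemma measurable_fun_rVP d (T : measurableType d) (f : T -> 'rV[R]_n) :
  (forall i, measurable_fun [set: T] (fun x => coord i (f x))) ->
  measurable_fun [set: T] f.
Proof.
move=> mf _ A mA; rewrite setTI.
suff: (g_sigma_preimage coord `<=` [set B | measurable (f @^-1` B)]) by exact.
apply: smallest_sub.
- split => [|B mB|F mF] /=.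
  + by rewrite preimage_set0; exact: measurable0.
  + by rewrite setTD preimage_setC; apply: measurableC; exact: mB.
  + by rewrite preimage_bigcup; apply: bigcup_measurable => k _; exact: mF.
- rewrite -bigcup_seq => _ [i _] [Y mY <-] /=.
  rewrite setTI -[X in measurable X]setTI; exact: (mf i _ Y mY).
Qed.

End measurable_rV.

(* The sigma-finite instance of a product measure is only inferred when the
   factors are subprobabilities. *)
Lemma sigma_finite_product d1 d2 (T1 : measurableType d1)
    (T2 : measurableType d2) (R : realType)
    (m1 : {sigma_finite_measure set T1 -> \bar R})
    (m2 : {sigma_finite_measure set T2 -> \bar R}) :
  sigma_finite setT (m1 \x m2)%E.
Proof.
have /sigma_finiteP[F [TF ndF Foo]] := sigma_finiteT m1.
have /sigma_finiteP[G [TG ndG Goo]] := sigma_finiteT m2.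
exists (fun n => F n `*` G n).
  rewrite -setXTT TF TG predeqE => -[x y]; split; last first.
    by move=> [n _ []/= ? ?]; split; exists n.
  move=> [/= [n _ Fnx] [k _ Gky]]; exists (maxn n k) => //; split.
  - by move: x Fnx; exact/subsetPset/ndF/leq_maxl.
  - by move: y Gky; exact/subsetPset/ndG/leq_maxr.
move=> k; have [? ?] := Foo k; have [? ?] := Goo k.
split; first exact: measurableX.
by rewrite product_measure1E// lte_mul_pinfty// ge0_fin_numE.
Qed.

Section lebesgue_measure_rV.
Context {R : realType}.

Definition rV_cons n (p : measurableTypeR R * 'rV[R]_n) : 'rV[R]_n.+1 :=
  row_mx (p.1 : R)%:M p.2 : 'rV[R]_(1 + n).

Lemma measurable_rV_cons n : measurable_fun setT (@rV_cons n).
Proof.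
apply: measurable_fun_rVP => i; rewrite /rV_cons.
case: (split_ordP (i : 'I_(1 + n))) => j ->.
- rewrite [X in measurable_fun _ X](_ : _ = fst); first exact: measurable_fst.
  by apply/funext => p; rewrite (ord1 j) [LHS](@row_mxEl _ 1 1 n) mxE eqxx mulr1n.
- rewrite [X in measurable_fun _ X](_ : _ = (fun v : 'rV[R]_n => v ord0 j) \o snd).
    by apply: (measurableT_comp (measurable_rV_coord j)); exact: measurable_snd.
  by apply/funext => p; rewrite [LHS](@row_mxEr _ 1 1 n).
Qed.


Definition rV_uncons n (v : 'rV[R]_n.+1) : measurableTypeR R * 'rV[R]_n :=
  ((v : 'rV[R]_(1 + n)) ord0 (lshift n ord0), rsubmx (v : 'rV[R]_(1 + n))).

Lemma measurable_rV_uncons n : measurable_fun setT (@rV_uncons n).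
Proof.
apply: measurable_fun_pair; first exact: measurable_rV_coord.
apply: measurable_fun_rVP => i.
rewrite [X in measurable_fun _ X](_ : _ =
    (fun v : 'rV[R]_n.+1 => v ord0 (rshift 1 i : 'I_n.+1))).
  exact: measurable_rV_coord.
by apply/funext => v; rewrite mxE.
Qed.

Lemma rV_consK n : cancel (@rV_cons n) (@rV_uncons n).
Proof.
case=> a v; rewrite /rV_cons /rV_uncons/= row_mxKr; congr pair.
by rewrite row_mxEl mxE eqxx mulr1n.
Qed.

Lemma rV_unconsK n : cancel (@rV_uncons n) (@rV_cons n).
Proof.
move=> v; rewrite /rV_cons -[RHS](@hsubmxK _ 1 1 n).
apply: (f_equal2 (@row_mx R 1 1 n)) => //.
by apply/matrixP => i j; rewrite !ord1 !mxE eqxx mulr1n.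
Qed.

Section step.
Variables (n : nat) (mu : {sigma_finite_measure set 'rV[R]_n -> \bar R}).

Definition lebesgue_rV_step : set 'rV[R]_n.+1 -> \bar R :=
  pushforward (@lebesgue_measure R \x mu)%E (@rV_cons n).

HB.instance Definition _ := Measure.copy lebesgue_rV_step
  (measure_function_pushforward__canonical__measure_function_Measure
     (@lebesgue_measure R \x mu)%E (@measurable_rV_cons n)).

Let lebesgue_rV_step_sigma_finite : sigma_finite setT lebesgue_rV_step.
Proof.
have [F FT mF] :
    sigma_finite setT (@lebesgue_measure R \x mu)%E.
  exact: sigma_finite_product.
exists (fun k => @rV_uncons n @^-1` F k).
  by rewrite -preimage_bigcup -FT preimage_setT.
move=> k; have [mFk Foo] := mF k; split.
  rewrite -[X in measurable X]setTI; exact: measurable_rV_uncons.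
rewrite /lebesgue_rV_step /pushforward -comp_preimage.
rewrite (_ : @rV_uncons n \o @rV_cons n = id) //.
by apply/funext => p /=; rewrite rV_consK.
Qed.

HB.instance Definition _ := Measure_isSigmaFinite.Build _ _ _
  lebesgue_rV_step lebesgue_rV_step_sigma_finite.
End step.

(* Lebesgue measure on R^n, as the n-fold product measure; R^0 is a point of
   mass 1. *)
Fixpoint lebesgue_rV n : {sigma_finite_measure set 'rV[R]_n -> \bar R} :=
  match n with
  | 0 => dirac (0 : 'rV[R]_0)
  | m.+1 => lebesgue_rV_step (lebesgue_rV m)
  end.

End lebesgue_measure_rV.
Arguments lebesgue_rV {R} n.

Section partial_derivatives.
Context {R : realType} {n : nat}.

Definition partial (i : 'I_n) (f : 'rV[R]_n -> R) : 'rV[R]_n -> R :=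
  fun x => 'D_(delta_mx ord0 i) f x.

Definition iter_partial (s : seq 'I_n) (f : 'rV[R]_n -> R) : 'rV[R]_n -> R :=
  foldr partial f s.

Definition smooth (f : 'rV[R]_n -> R) : Prop :=
  forall s : seq 'I_n,
    continuous (iter_partial s f) /\
    forall (i : 'I_n) (x : 'rV[R]_n),
      derivable (iter_partial s f) x (delta_mx ord0 i).

(* The directions of a multi-index, coordinate i being repeated alpha_i times. *)
Definition multi_dirs (alpha : 'I_n -> nat) : seq 'I_n :=
  flatten [seq nseq (alpha i) i | i <- enum 'I_n].

(* R[i] has no structure of normed space over R in the library: complex-valued
   functions are differentiated, and below integrated, componentwise. *)
Definition csmooth (f : 'rV[R]_n -> R[i]) : Prop :=
  smooth (fun x => complex.Re (f x)) /\ smooth (fun x => complex.Im (f x)).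

Definition cpartial (alpha : 'I_n -> nat) (f : 'rV[R]_n -> R[i])
    (x : 'rV[R]_n) : R[i] :=
  Complex (iter_partial (multi_dirs alpha) (fun y => complex.Re (f y)) x)
          (iter_partial (multi_dirs alpha) (fun y => complex.Im (f y)) x).

End partial_derivatives.

Definition cintegral d (T : measurableType d) (R : realType)
    (mu : {measure set T -> \bar R}) (D : set T) (f : T -> R[i]) : R[i] :=
  Complex (\int[mu]_(x in D) complex.Re (f x))
          (\int[mu]_(x in D) complex.Im (f x)).

Definition cmod (R : realType) (z : R[i]) : R := Normc.normc z.

(* e^(i t) *)
Definition cis (R : realType) (t : R) : R[i] := Complex (cos t) (sin t).

Definition dotv (R : realType) n (x y : 'rV[R]_n) : R :=
  \sum_i x ord0 i * y ord0 i.

Definition japanese (R : realType) n (z : 'rV[R]_n) : R :=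
  Num.sqrt (1 + dotv z z).

Section function_classes.
Context {R : realType} {n : nat}.

Definition monomial (beta : 'I_n -> nat) (x : 'rV[R]_n) : R :=
  \prod_i x ord0 i ^+ beta i.

Definition schwartz (f : 'rV[R]_n -> R[i]) : Prop :=
  csmooth f /\
  forall alpha beta : 'I_n -> nat, exists C : R, forall x : 'rV[R]_n,
    `|monomial beta x| * cmod (cpartial alpha f x) <= C.

Definition symbol_class (m : R) (sigma : 'rV[R]_n -> R[i]) : Prop :=
  csmooth sigma /\
  forall alpha : 'I_n -> nat, exists C : R, forall z : 'rV[R]_n,
    cmod (cpartial alpha sigma z) <= C * japanese z `^ m.

Definition weighted_Lnorm (q : \bar R) (s : R) (H : 'rV[R]_n -> R) : \bar R :=
  Lnorm (lebesgue_rV n) q (fun z => (H z * japanese z `^ s)%:E).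

Definition weighted_Lspace (q : \bar R) (s : R) (H : 'rV[R]_n -> R) : Prop :=
  measurable_fun setT H /\ (weighted_Lnorm q s H < +oo)%E.

(* A distribution T is represented by the antilinear functional phi |-> <T, phi>,
   of which only the values on Schwartz functions are meaningful. *)
Definition functional : Type := ('rV[R]_n -> R[i]) -> R[i].

Definition regular_distribution (sigma : 'rV[R]_n -> R[i]) : functional :=
  fun phi => cintegral (lebesgue_rV n) setT (fun z => sigma z * (phi z)^*%C).

End function_classes.
Arguments functional R n : clear implicits.

Section born_jordan.
Context {R : realType} {d : nat}.

(* Points of phase space are row_mx x omega : 'rV[R]_(d + d). *)
Definition wigner_tau (tau : R) (f g : 'rV[R]_d -> R[i])
    (z : 'rV[R]_(d + d)) : R[i] :=
  let x := lsubmx z in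
  let omega := rsubmx z in
  cintegral (lebesgue_rV d) setT (fun y =>
    cis (- (2 * pi * dotv y omega)) * f (x + tau *: y) *
    (g (x - (1 - tau) *: y))^*%C).

Definition wigner_BJ (f g : 'rV[R]_d -> R[i]) (z : 'rV[R]_(d + d)) : R[i] :=
  cintegral lebesgue_measure `[0, 1] (fun tau : R => wigner_tau tau f g z).

Definition Op_BJ (sigma : functional R (d + d)) (f : 'rV[R]_d -> R[i]) :
    functional R d :=
  fun g => sigma (wigner_BJ g f).

Definition tf_shift (z : 'rV[R]_(d + d)) (f : 'rV[R]_d -> R[i])
    (t : 'rV[R]_d) : R[i] :=
  cis (2 * pi * dotv (rsubmx z) t) * f (t - lsubmx z).

End born_jordan.

(* Main.v *)
(* All the H_tau can be taken equal to C P^(-N), where P(v) = prod_i (1 + v_i^2) is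
   submultiplicative up to a constant and 1/P is integrable, so it suffices to bound
   the matrix element by C <z>^m P(u - z)^(-N) for every N.  Writing z = (z1, z2),
   u = (u1, u2) and w = u - z, the matrix element is the iterated integral over
   (x, omega), then tau, then y, of
     e^(2 pi i (y.(omega - c2) - w2.x)) sigma(x, omega)
       conj(g(x + tau y - u1)) g(x - (1 - tau) y - z1),
   with c2 = tau u2 + (1 - tau) z2.  Integrating by parts in y produces powers of
   1/(1 + 2 pi i (omega_j - c2_j)), which make the integral absolutely convergent;
   Fubini then brings the (x, omega)-integral inside, and integrating by parts in it
   produces P(w2)^(-N) P(y)^(-N).  Since the difference of the two arguments of g is
   y - w1, the rapid decay of g turns P(y)^(-N) into P(w1)^(-N), and Peetre's
   inequality replaces <(x, omega)>^m by <z>^m up to a power of P(w). *)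

Require Import Defs.
From mathcomp Require Import measurable_realfun ess_sup_inf.
From mathcomp Require Import ring lra.
Set Implicit Arguments.
Unset Strict Implicit.
Unset Printing Implicit Defensive.
Import Order.TTheory GRing.Theory Num.Theory.
Import numFieldNormedType.Exports.
Local Open Scope classical_set_scope.
Local Open Scope ring_scope.

(** * Measurability and integration on R^n *)

(** The obstacle is uniformity in tau: recovering y from a single argument of g divides by tau or 1
    - tau. So only two combinations of a1 = x + tau y - u1 and a2 = x - (1 - tau) y - z1 are used,
    both with bounded coefficients: a1 - a2 = y - w1, and (1 - tau) a1 + tau a2 = x - c1 with c1 =
    (1 - tau) u1 + tau z1. The decay of g thus controls x and y with constants free of tau; decay in
    omega, which g does not see, has to come from the oscillation in y. For the same reason each
    derivative of g(a1) or g(a2) costs only a factor of modulus at most 1. The point (c1, c2)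
    differs from z by ((1 - tau) w1, tau w2), so Peetre's inequality costs a power of P(w), whatever
    tau is. The exponents balance as follows: if Peetre costs k powers of P, then k + 1 powers are
    gained in x and in omega, k as repayment and one for integrability, and k + N powers are gained
    in w, which leaves N. The multipliers 1 + i theta never vanish, so zero frequency needs no
    separate treatment. *)

Lemma cvg_mx (K : numFieldType) T (F : set_system T) (FF : Filter F) m n
    (f : T -> 'M[K]_(m, n)) (a : 'M[K]_(m, n)) :
  (forall i j, f x i j @[x --> F] --> a i j) -> f x @[x --> F] --> a.
Proof.
move=> fa; apply/cvg_ballP => e e0.
have : \forall x \near F, forall ij : 'I_m * 'I_n, ball (a ij.1 ij.2) e (f x ij.1 ij.2).
  by apply: filter_forall => ij; have /cvg_ballP/(_ _ e0) := fa ij.1 ij.2.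
by apply: filterS => x fx; split => // i j; exact: (fx (i, j)).
Qed.

Lemma continuous_mx (K : numFieldType) (T : topologicalType) m n
    (f : T -> 'M[K]_(m, n)) :
  (forall i j, continuous (fun x => f x i j)) -> continuous f.
Proof. by move=> cf x; apply: (cvg_mx (nbhs_filter x)) => i j; exact: cf. Qed.

(** * Joint measurability of functions continuous in a vector variable *)

Section caratheodory.
Context {R : realType} {n : nat} d {T : measurableType d}.

Let grid (k : nat) (p : 'rV[int]_n) : 'rV[R]_n :=
  \row_i ((p ord0 i)%:~R / k.+1%:R).

Let cell (k : nat) (v : 'rV[R]_n) : 'rV[int]_n :=
  \row_i Num.floor (v ord0 i * k.+1%:R).

Let cvg_grid v : (grid k (cell k v)) @[k --> \oo] --> v.
Proof.
apply: cvg_mx => i j; rewrite (ord1 i); under eq_fun do rewrite !mxE.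
apply/cvgrPdist_le => e e0.
have [N _ N0] := near_infty_natSinv_lt (PosNum e0).
exists N => // k /= Nk; have {N0}ke := N0 k Nk.
set x := v ord0 j.
have k0 : (0 : R) < k.+1%:R by rewrite ltr0n.
have /andP[f1 f2] := floor_itv (x * k.+1%:R).
have -> : x - (Num.floor (x * k.+1%:R))%:~R / k.+1%:R
    = (x * k.+1%:R - (Num.floor (x * k.+1%:R))%:~R) / k.+1%:R.
  by rewrite mulrBl mulfK ?gt_eqF.
rewrite ger0_norm; last by rewrite divr_ge0 ?subr_ge0// ltW.
apply: le_trans (ltW ke) => /=; rewrite ler_pdivrMr// mulVf ?gt_eqF//.
by move: f2; rewrite intrD; lra.
Qed.

(* [f] is the pointwise limit of [f (grid k (cell k v), t)], whose dependence on
   [v] takes countably many values. *)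
Lemma measurable_caratheodory (f : 'rV[R]_n -> T -> R) :
  (forall t, continuous (f ^~ t)) -> (forall v, measurable_fun setT (f v)) ->
  measurable_fun setT (fun vt : 'rV[R]_n * T => f vt.1 vt.2).
Proof.
move=> cf mf.
apply: (@measurable_fun_cvg _ _ _ setT
  (fun k (vt : 'rV[R]_n * T) => f (grid k (cell k vt.1)) vt.2)); last first.
  move=> [v t] _ /=.
  by apply: (@cvg_comp _ _ _ (fun k => grid k (cell k v)) (f ^~ t) _ (nbhs v));
    [exact: cvg_grid|exact: cf].
move=> k _ Y mY; rewrite setTI.
rewrite (_ : _ @^-1` _ = \bigcup_(p : 'rV[int]_n)
    ([set v | cell k v = p] `*` (f (grid k p) @^-1` Y))); last first.
  apply/seteqP; split=> [[v t] /= fY|[v t] [p _ [/= <-]]] //.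
  by exists (cell k v).
apply: countable_bigcupT_measurable => // p.
apply: measurableX; last by rewrite -[X in measurable X]setTI; exact: mf.
rewrite (_ : mkset _ = \bigcap_(i in [set: 'I_n])
    ((fun v : 'rV[R]_n => v ord0 i) @^-1`
      `[(p ord0 i)%:~R / k.+1%:R, (p ord0 i + 1)%:~R / k.+1%:R[)).
  apply: fin_bigcap_measurable => // i _; rewrite -[X in measurable X]setTI.
  by apply: measurable_rV_coord => //; exact: measurable_itv.
have k0 : (0 : R) < k.+1%:R by rewrite ltr0n.
apply/seteqP; split=> v /=.
  move=> <- i _ /=; rewrite in_itv/= mxE ler_pdivrMr// ltr_pdivlMr//.
  exact: floor_itv.
move=> h; apply/rowP => i; rewrite mxE; apply: floor_def.
by have := h i I; rewrite /= in_itv/= ler_pdivrMr// ltr_pdivlMr.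
Qed.

End caratheodory.

(** The sigma-algebra on row vectors is generated by the coordinates and is not given as the Borel
    one, so continuity has to be converted by an approximation; the Caratheodory lemma supplies it,
    with a one-point second factor. *)
Lemma continuous_measurable_rV (R : realType) n (f : 'rV[R]_n -> R) :
  continuous f -> measurable_fun setT f.
Proof.
move=> cf.
have mf : measurable_fun setT (fun vt : 'rV[R]_n * unit => f vt.1).
  by apply: (@measurable_caratheodory R n _ unit (fun v _ => f v)).
apply: (@measurableT_comp _ _ _ _ _ _ _ _ (fun v : 'rV[R]_n => (v, tt)) mf).
by apply: measurable_fun_pair => //; exact: measurable_cst.
Qed.

(** * Integrals over the real line *)

Section line.
Context {R : realType}.
Implicit Types (phi psi : R -> R).
Local Notation lam := (@lebesgue_measure R).

Definition kappa (t : R) : R := (1 + t ^+ 2)^-1.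

Lemma kappa_gt0 t : 0 < kappa t.
Proof. by rewrite invr_gt0 ltr_pwDl// sqr_ge0. Qed.

Lemma kappa_ge0 t : 0 <= kappa t.
Proof. exact/ltW/kappa_gt0. Qed.

Lemma continuous_kappa a : continuous (fun t => kappa (t - a)).
Proof.
move=> t; apply: (@continuous_comp _ _ _ (fun t => t - a) kappa).
  by apply: cvgB => //; exact: cvg_cst.
exact: continuous_oneDsqrV.
Qed.

Lemma integral_symmetric_FTC2 phi psi : continuous psi ->
  (forall t : R, is_derive t 1 phi (psi t)) -> forall k : nat,
  (\int[lam]_(t in `[(- k.+1%:R)%R, k.+1%:R%R]) (psi t)%:E =
    (phi k.+1%:R - phi (- k.+1%:R))%:E)%E.
Proof.
move=> cpsi dphi k.
have cphi : continuous phi.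
  by move=> t; apply: differentiable_continuous; apply/derivable1_diffP.
rewrite (@continuous_FTC2 _ psi phi) ?EFinB//.
- by rewrite (lt_trans (y := 0)) ?oppr_lt0 ?ltr0n.
- exact: continuous_in_subspaceT.
- split.
  + by move=> x _; exact: ex_derive.
  + by apply: cvg_at_right_filter; exact: cphi.
  + by apply: cvg_at_left_filter; exact: cphi.
- by move=> x _; rewrite derive1E; exact: derive_val.
Qed.

Lemma bigcup_symmetric : \bigcup_k `[- k.+1%:R, k.+1%:R]%classic = [set: R].
Proof.
apply/seteqP; split=> // t _; exists (Num.truncn `|t|) => //=.
by rewrite in_itv/= -ler_norml ltW// truncnS_gt.
Qed.

Lemma measurable_kappa a : 
  measurable_fun [set: measurableTypeR R] (fun t : R => kappa (t - a)).
Proof. 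
apply: continuous_measurable_fun; exact: continuous_kappa. Qed.

(** [kappa] is the derivative of [atan], so its integral over a symmetric interval is a difference
    of two values in (-pi/2, pi/2); monotone convergence passes to the whole line. The shift [a]
    leaves the bound unchanged. *)
Lemma integral_kappa a : (\int[lam]_t (kappa (t - a))%:E <= pi%:E)%E.
Proof.
rewrite -bigcup_symmetric.
have := @ge0_nondecreasing_set_cvg_integral _ (measurableTypeR R) R
  (fun k : nat => `[- k.+1%:R, k.+1%:R]%classic : set (measurableTypeR R))
  (fun t => (kappa (t - a))%:E) lam.
have nd : {homo (fun k : nat => `[- k.+1%:R, k.+1%:R]%classic : set (measurableTypeR R))
    : n m / (n <= m)%N >-> (n <= m)%O}.
  move=> n m nm; apply/subsetPset => t /=; rewrite !in_itv/= => /andP[t1 t2].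
  have : (n.+1%:R : R) <= m.+1%:R by rewrite ler_nat.
  by move: t1 t2 => + + ?; lra.
have mK : measurable_fun [set: measurableTypeR R] (fun t : R => (kappa (t - a))%:E).
  by apply/measurable_EFinP; exact: measurable_kappa.
move=> /(_ nd (fun=> measurable_itv _) (fun=> measurable_funTS mK)).
have K0 : forall (i : nat) (x : R), `[- i.+1%:R, i.+1%:R]%classic x ->
    (0 <= (kappa (x - a))%:E)%E by move=> *; rewrite lee_fin kappa_ge0.
move=> /(_ K0) cv; rewrite -(cvg_lim _ cv)//.
apply: lime_le; first by apply/cvg_ex; eexists; exact: cv.
apply: nearW => k.
have dA (t : R) : is_derive t 1 (fun t => atan (t - a)) (kappa (t - a)).
  have da : is_derive (t : R) 1 (fun t => t - a) 1.
    by apply: is_derive_eq; rewrite subr0.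
  have := @is_derive1_comp _ (@atan R) (fun t => t - a) t _ 1
    (is_derive1_atan _) da.
  by rewrite mulr1.
rewrite (integral_symmetric_FTC2 (@continuous_kappa a) dA)//.
have := @atan_gtNpi2 R (- k.+1%:R - a); have := @atan_ltpi2 R (k.+1%:R - a).
by rewrite lee_fin; lra.
Qed.

Lemma integrable_kappa (f : R -> R) (C : R) :
  measurable_fun [set: measurableTypeR R] f ->
  (forall t, `|f t| <= C * kappa t) -> lam.-integrable setT (EFin \o f).
Proof.
move=> mf fC; apply: (@le_integrable _ (measurableTypeR R) R lam setT measurableT _
  (fun t => (C * kappa t)%:E)).
- exact/measurable_EFinP.
- by move=> t _ /=; rewrite lee_fin (le_trans (fC t))// ler_norm.
- rewrite [X in _.-integrable _ X](_ : _ =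
    (fun t => C%:E * (kappa (t - 0))%:E)%E); last first.
    by apply/funext => t; rewrite subr0 EFinM.
  apply: integrableZl => //; apply/integrableP; split.
    by apply/measurable_EFinP; exact: measurable_kappa.
  apply: le_lt_trans (ltry pi); apply: le_trans (integral_kappa 0).
  by under eq_integral do rewrite /= ger0_norm ?kappa_ge0//.
Qed.

(** The boundary terms of an integration by parts vanish: on symmetric intervals the integral is an
    increment of [phi], which tends to 0 by the bound on [phi], while the bound on [psi] gives
    dominated convergence to the full integral. *)
Lemma Rintegral_derive_eq0 phi psi (C : R) :
  (forall t : R, is_derive t 1 phi (psi t)) -> continuous psi ->
  (forall t, `|phi t| <= C * kappa t) -> (forall t, `|psi t| <= C * kappa t) ->
  \int[lam]_t psi t = 0.
Proof.
move=> dphi cpsi phiC psiC.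
have mpsi : measurable_fun [set: measurableTypeR R] psi.
  by apply: continuous_measurable_fun.
pose I k := `[- k.+1%:R, k.+1%:R]%classic : set (measurableTypeR R).
have mI k : measurable (I k) by exact: measurable_itv.
pose f_ k (t : measurableTypeR R) := ((psi \_ (I k)) t)%:E.
have mf_ k : measurable_fun [set: measurableTypeR R] (f_ k).
  apply/measurable_EFinP; apply/(measurable_restrictT _ (mI k)).
  exact: measurable_funTS.
have cvf : (\int[lam]_t f_ k t)%E @[k --> \oo] --> (\int[lam]_t (psi t)%:E)%E.
  have [] // := @dominated_convergence _ (measurableTypeR R) R lam setT
    measurableT f_ (EFin \o psi) (fun t => (C * kappa t)%:E) mf_.
  - exact/measurable_EFinP.
  - apply/aeW => t _; apply: cvg_near_cst.
    exists (Num.truncn `|t|) => // k /= tk.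
    have tI : I k t.
      rewrite /I /= in_itv/= -ler_norml ltW//.
      by rewrite (lt_le_trans (truncnS_gt _))// ler_nat.
    by rewrite /f_ patchE mem_set.
  - rewrite [X in _.-integrable _ X](_ : _ = EFin \o (fun t => C * kappa t))//.
    apply: (@integrable_kappa _ C) => //.
      apply: measurable_funM => //.
      by have := measurable_kappa 0; under eq_fun do rewrite subr0.
    move=> t; rewrite ger0_norm// mulr_ge0 ?kappa_ge0//.
    have := le_trans (normr_ge0 _) (psiC t).
    by rewrite pmulr_lge0 ?kappa_gt0.
  - apply/aeW => t k _; rewrite /f_ lee_fin patchE; case: ifPn => // _.
    by rewrite normr0 (le_trans _ (psiC t)).
have Ef k : (\int[lam]_t f_ k t)%E = (phi k.+1%:R - phi (- k.+1%:R))%:E.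
  rewrite -(integral_symmetric_FTC2 cpsi dphi) [RHS]integral_mkcond.
  by apply: eq_integral => t _; rewrite /f_ !patchE; case: ifP.
have cv0 : (\int[lam]_t f_ k t)%E @[k --> \oo] --> 0%E.
  under eq_fun do rewrite Ef.
  apply: cvg_EFin; first exact: nearW.
  apply/norm_cvg0P.
  apply: (@squeeze_cvgr _ _ _ _ (fun=> 0) (fun k => (2 * C) * k.+1%:R^-1)).
  - apply: nearW => k /=; rewrite normr_ge0/=.
    apply: le_trans (ler_normB _ _) _.
    have := phiC k.+1%:R; have := phiC (- k.+1%:R); rewrite /kappa sqrrN.
    have C0 : 0 <= C.
      by have := le_trans (normr_ge0 _) (psiC 0); rewrite pmulr_lge0 ?kappa_gt0.
    (* Weakening the boundary bound to a multiple of 1/(k+1) reduces its limit to that of the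
       harmonic sequence. *)
    have : C * (1 + k.+1%:R ^+ 2)^-1 <= C * k.+1%:R^-1.
      apply: ler_wpM2l => //; rewrite lef_pV2 ?posrE ?ltr0n//.
        by rewrite -[leLHS]add0r lerD// expr2 ler_peMr ?ler1n.
    move=> h h1 h2; rewrite -mulrA mulr_natl mulr2n.
    by apply: lerD; [exact: le_trans h2 h|exact: le_trans h1 h].
  - exact: cvg_cst.
  - rewrite -[X in _ --> X](mulr0 (2 * C)); apply: cvgMr.
    exact: cvg_harmonic.
by rewrite /Rintegral (cvg_unique _ cvf cv0).
Qed.

End line.

Section lines.
Context {R : realType}.

Lemma is_derive_lineP (V : normedModType R) (F : V -> R) (y w : V) (dF : R) :
  is_derive y w F dF <-> is_derive (0 : R) 1 (fun s : R => F (s *: w + y)) dF.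
Proof.
suff E : (fun h : R => h^-1 *: ((F \o shift y) (h *: w) - F y)) =
    (fun h : R => h^-1 *: (((fun s : R => F (s *: w + y)) \o shift 0) (h *: (1 : R))
      - F (0 *: w + y))).
  by split=> -[d e]; split; move: d e; rewrite /derivable /derive E.
by apply/funext => h /=; rewrite addr0 scale0r add0r scaler1.
Qed.

(** Chain rule for a map that carries lines of direction [w] to lines of direction [u] at speed [c].
    Restricting to the line reduces it to one variable, so that directional derivatives suffice. *)
Lemma is_derive_along (V W : normedModType R) (f : W -> R) (M : V -> W)
    (y w : V) (u : W) (c df : R) :
  (forall s : R, M (s *: w + y) = (s * c) *: u + M y) ->
  is_derive (M y) u f df -> is_derive y w (f \o M) (c * df).
Proof.
move=> Mline /is_derive_lineP df0; apply/is_derive_lineP.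
have -> : (fun s : R => (f \o M) (s *: w + y)) =
    (fun r : R => f (r *: u + M y)) \o (fun s : R => s * c).
  by apply/funext => s /=; rewrite Mline.
rewrite mulrC; apply: is_derive1_comp; first by rewrite mul0r.
have := @is_deriveM R R id (cst c) 0 1 1 0 _ _.
by rewrite scaler0 add0r /= scaler1 => /(_ _); apply.
Qed.

End lines.

Section dominated.
Context d (T : measurableType d) {R : realType} (mu : {measure set T -> \bar R}).

Lemma integrable_dominated (f h : T -> R) :
  measurable_fun setT f -> mu.-integrable setT (EFin \o h) ->
  (forall x, `|f x| <= h x) -> mu.-integrable setT (EFin \o f).
Proof.
move=> mf ih fh; apply: le_integrable ih => //; first exact/measurable_EFinP.
by move=> x _; rewrite lee_fin (le_trans (fh x))// ler_norm.
Qed.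

Lemma normr_Rintegral_le (f h : T -> R) :
  measurable_fun setT f -> mu.-integrable setT (EFin \o h) ->
  (forall x, `|f x| <= h x) -> `|\int[mu]_x f x| <= \int[mu]_x h x.
Proof.
move=> mf ih fh; have intf := integrable_dominated mf ih fh.
apply: le_trans (le_normr_Rintegral measurableT intf) _.
by apply: le_Rintegral => //; exact: (integrable_abse intf).
Qed.

End dominated.

(** * Fubini under a product bound *)

Section fubini_dominated.
Context d1 d2 (T1 : measurableType d1) (T2 : measurableType d2) {R : realType}.
Variable m1 : {sigma_finite_measure set T1 -> \bar R}.
Variable m2 : {sigma_finite_measure set T2 -> \bar R}.
Implicit Type f : T1 * T2 -> R.

(** By definition the real integral is [fine] of a difference between the integrals of the positive
    and negative parts, and Tonelli makes each of these measurable in x; finiteness does not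
    enter. *)
Lemma measurable_Rintegral f : measurable_fun setT f ->
  measurable_fun setT (fun x => \int[m2]_y f (x, y)).
Proof.
move=> /measurable_EFinP mf.
have -> : (fun x => \int[m2]_y f (x, y)) = (fun x => fine
    (fubini_F m2 (EFin \o f)^\+%E x - fubini_F m2 (EFin \o f)^\-%E x)%E).
  apply/funext => x; rewrite /Rintegral integralE; congr fine.
  by congr (_ - _)%E; apply: eq_integral => y _; rewrite unlock.
apply: (measurableT_comp (fine_measurable _)) => //.
by apply: emeasurable_funB; apply: measurable_fun_fubini_tonelli_F => //;
  [exact: measurable_funepos|exact: measurable_funeneg].
Qed.

Variables (f : T1 * T2 -> R) (h1 : T1 -> R) (h2 : T2 -> R).
Hypotheses (mf : measurable_fun setT f)
  (ih1 : m1.-integrable setT (EFin \o h1))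
  (ih2 : m2.-integrable setT (EFin \o h2))
  (fh : forall x y, `|f (x, y)| <= h1 x * h2 y).

Let ih1x x : m2.-integrable setT (EFin \o (fun y => h1 x * h2 y)).
Proof.
rewrite (_ : EFin \o _ = fun y => ((h1 x)%:E * (h2 y)%:E)%E).
  exact: integrableZl.
by apply/funext => y /=; rewrite EFinM.
Qed.

Let mfx x : measurable_fun setT (fun y => f (x, y)).
Proof. exact: measurableT_comp. Qed.

Lemma integrable_prod_dominated : (m1 \x m2)%E.-integrable setT (EFin \o f).
Proof.
apply/integrable12ltyP; first exact/measurable_EFinP.
have ih : m1.-integrable setT (fun x => ((h1 x)%:E * (\int[m2]_y h2 y)%:E)%E).
  by apply: integrableZr.
apply: le_lt_trans (integral_fune_lt_pinfty measurableT ih).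
have mF : measurable_fun setT (EFin \o f) by exact/measurable_EFinP.
apply: ge0_le_integral => //.
- by move=> x _; exact: integral_ge0.
- apply: (@measurable_fun_fubini_tonelli_F _ _ _ _ _ m2 (abse \o (EFin \o f))).
    exact: measurableT_comp.
  by move=> z; exact: abse_ge0.
- exact: (measurable_int _ ih).
move=> x _; rewrite -EFinM -RintegralZl// /Rintegral fineK.
  apply: ge0_le_integral => //.
  - by apply/measurable_EFinP; apply: measurableT_comp => //; exact: mfx.
  - exact: (measurable_int _ (ih1x x)).
  - by move=> y _; rewrite lee_fin.
exact: integrable_fin_num (ih1x x).
Qed.

Lemma Rintegral12_prod :
  \int[m1]_x \int[m2]_y f (x, y) = \int[(m1 \x m2)%E]_z f z.
Proof.
rewrite /Rintegral -(integral12_prod_meas1 integrable_prod_dominated).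
congr fine; apply: eq_integral => x _; rewrite fineK//.
by apply: integrable_fin_num => //; apply: integrable_dominated (ih1x x) _.
Qed.

End fubini_dominated.

Lemma Rintegral_swap d1 d2 (T1 : measurableType d1) (T2 : measurableType d2)
    (R : realType) (m1 : {sigma_finite_measure set T1 -> \bar R})
    (m2 : {sigma_finite_measure set T2 -> \bar R})
    (f : T1 * T2 -> R) (h1 : T1 -> R) (h2 : T2 -> R) :
  measurable_fun setT f -> m1.-integrable setT (EFin \o h1) ->
  m2.-integrable setT (EFin \o h2) ->
  (forall x y, `|f (x, y)| <= h1 x * h2 y) ->
  \int[m1]_x \int[m2]_y f (x, y) = \int[m2]_y \int[m1]_x f (x, y).
Proof.
move=> mf ih1 ih2 fh.
have ipf := integrable_prod_dominated mf ih1 ih2 fh.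
rewrite (Rintegral12_prod mf ih1 ih2 fh).
rewrite /Rintegral -(integral21_prod_meas1 ipf).
congr fine; apply: eq_integral => y _; rewrite fineK//.
apply: integrable_fin_num => //; apply: (@integrable_dominated _ _ _ _ _ (fun x => h1 x * h2 y)).
- exact: measurableT_comp.
- rewrite (_ : EFin \o _ = fun x => ((h1 x)%:E * (h2 y)%:E)%E).
    exact: integrableZr.
  by apply/funext => x /=; rewrite EFinM.
- by [].
Qed.

(** * The product weight P and its integral *)

Section weight.
Context {R : realType}.

(** A product over coordinates, so that its inverse is integrated one variable at a time and the
    weight factors over the blocks of [row_mx]; a power of the Japanese bracket would do neither. *)
Definition pw n (v : 'rV[R]_n) : R := \prod_i (1 + v ord0 i ^+ 2).

Definition ipw n (v : 'rV[R]_n) : R := (pw v)^-1.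

Lemma pw_ge1 n (v : 'rV[R]_n) : 1 <= pw v.
Proof.
by rewrite /pw; elim/big_ind: _ => // [x y|i _]; [exact: mulr_ege1|rewrite lerDl sqr_ge0].
Qed.

Lemma pw_gt0 n (v : 'rV[R]_n) : 0 < pw v.
Proof. exact: lt_le_trans (pw_ge1 v). Qed.

Lemma pw_ge0 n (v : 'rV[R]_n) : 0 <= pw v.
Proof. exact/ltW/pw_gt0. Qed.

Lemma ipw_gt0 n (v : 'rV[R]_n) : 0 < ipw v.
Proof. by rewrite invr_gt0 pw_gt0. Qed.

Lemma ipw_ge0 n (v : 'rV[R]_n) : 0 <= ipw v.
Proof. exact/ltW/ipw_gt0. Qed.

Lemma pwN n (v : 'rV[R]_n) : pw (- v) = pw v.
Proof. by apply: eq_bigr => i _; rewrite mxE sqrrN. Qed.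

(* From [1 + (a + b)^2 <= 2 (1 + a^2) (1 + b^2)]. *)
Lemma pwD n (v w : 'rV[R]_n) : pw (v + w) <= 2 ^+ n * (pw v * pw w).
Proof.
rewrite /pw -big_split/= -[X in _ ^+ X]card_ord -prodr_const -big_split/=.
apply: ler_prod => i _; rewrite addr_ge0 ?sqr_ge0//= mxE.
set a := v _ _; set b := w _ _.
have := sqr_ge0 (a - b); have := sqr_ge0 (a * b).
by rewrite !exprMn; nra.
Qed.

Lemma pw_row_mx m n (v : 'rV[R]_m) (w : 'rV[R]_n) :
  pw (row_mx v w) = pw v * pw w.
Proof.
rewrite /pw big_split_ord/=; congr (_ * _); apply: eq_bigr => i _.
  by rewrite row_mxEl.
by rewrite row_mxEr.
Qed.

Lemma pw_cons n (t : R) (v : 'rV[R]_n) : pw (rV_cons (t, v)) = (1 + t ^+ 2) * pw v.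
Proof.
have := pw_row_mx (t%:M : 'rV[R]_1) v; rewrite /rV_cons/= => ->.
by rewrite /pw big_ord1 mxE eqxx mulr1n.
Qed.

Lemma ipw_cons n (t : R) (v : 'rV[R]_n) : ipw (rV_cons (t, v)) = kappa t * ipw v.
Proof. by rewrite /ipw pw_cons invfM. Qed.

Lemma rV_consD n (t t' : R) (v v' : 'rV[R]_n) :
  rV_cons (t + t', v + v') = rV_cons (t, v) + rV_cons (t', v').
Proof.
have := add_row_mx (t%:M : 'rV[R]_1) v (t'%:M : 'rV[R]_1) v'.
by rewrite -raddfD => /esym.
Qed.

Lemma rV_consN n (t : R) (v : 'rV[R]_n) :
  rV_cons (- t, - v) = - rV_cons (t, v).
Proof.
by have := opp_row_mx (t%:M : 'rV[R]_1) v; rewrite -raddfN => /esym.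
Qed.

Lemma continuous_pw n : continuous (@pw n).
Proof.
rewrite /pw => v; have Fv : Filter (nbhs v) by exact: nbhs_filter.
apply: cvg_big => [|i _]; first exact: mul_continuous.
by apply: cvgD; [exact: cvg_cst|apply: cvgM; exact: coord_continuous].
Qed.

Lemma continuous_ipw n (a : 'rV[R]_n) : continuous (fun v : 'rV[R]_n => ipw (v - a)).
Proof.
move=> v; apply: (@continuous_comp 'rV[R]_n 'rV[R]_n R (fun v => v - a) (@ipw n)).
  by apply: (@continuousB R _ _ id (cst a)); [exact: cvg_id|exact: cst_continuous].
have Fv : Filter (nbhs (v - a)) by exact: nbhs_filter.
by apply: cvgV; [exact: lt0r_neq0 (pw_gt0 _)|exact: continuous_pw].
Qed.

Lemma measurable_ipw n (a : 'rV[R]_n) :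
  measurable_fun setT (fun v : 'rV[R]_n => ipw (v - a)).
Proof. by apply: continuous_measurable_rV; exact: continuous_ipw. Qed.

Lemma ge0_integral_rVS n (f : 'rV[R]_n.+1 -> \bar R) :
  measurable_fun setT f -> (forall v, 0 <= f v)%E ->
  (\int[lebesgue_rV n.+1]_v f v =
   \int[@lebesgue_measure R]_t \int[lebesgue_rV n]_v f (rV_cons (t, v)))%E.
Proof.
move=> mf f0; have mfc := measurableT_comp mf (@measurable_rV_cons R n).
rewrite -[RHS]/(\int[_]_t fubini_F _ (f \o @rV_cons R n) t)%E.
have <- := @fubini_tonelli1 _ _ _ _ _ (@lebesgue_measure R) (lebesgue_rV n)
  (f \o @rV_cons R n) mfc (fun z => f0 _).
have := @ge0_integral_pushforward _ _ _ _ _ _ (@measurable_rV_cons R n)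
  (@lebesgue_measure R \x lebesgue_rV n)%E setT f measurableT mf (fun v _ => f0 v).
by rewrite preimage_setT => <-; apply: eq_measure_integral => //; exact: measurable_rV_cons.
Qed.

Lemma Rintegral_rVS_prod n (f : 'rV[R]_n.+1 -> R) :
  measurable_fun setT f ->
  (lebesgue_measure \x lebesgue_rV n)%E.-integrable setT
    (EFin \o (f \o @rV_cons R n)) ->
  \int[lebesgue_rV n.+1]_v f v =
  \int[(@lebesgue_measure R \x lebesgue_rV n)%E]_z f (rV_cons z).
Proof.
move=> mf ifc; rewrite /Rintegral; congr fine.
have := @integral_pushforward _ _ _ _ _ _ (@measurable_rV_cons R n)
  (@lebesgue_measure R \x lebesgue_rV n)%E setT (EFin \o f).
rewrite preimage_setT => <- //; exact/measurable_EFinP.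
Qed.

(** The shift is carried through the induction, the one-variable bound being the same for every
    shift; this replaces translation invariance of the measure. *)
Lemma integral_ipw_le n (a : 'rV[R]_n) :
  (\int[lebesgue_rV n]_v (ipw (v - a))%:E <= (pi ^+ n)%:E)%E.
Proof.
have mf m (b : 'rV[R]_m) : measurable_fun setT (fun v : 'rV[R]_m => (ipw (v - b))%:E).
  by apply/measurable_EFinP; exact: measurable_ipw.
elim: n a => [|n IH] a.
  rewrite integral_dirac//; last exact: mf.
  rewrite diracE in_setT mul1e lee_fin expr0 /ipw.
  by rewrite invf_le1 ?pw_gt0 ?pw_ge1.
rewrite ge0_integral_rVS//; last by move=> v; rewrite lee_fin ipw_ge0.
have aE : a = rV_cons (rV_uncons a) by rewrite rV_unconsK.
set a0 := (rV_uncons a).1; set a1 := (rV_uncons a).2.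
have E t v : ipw (rV_cons (t, v) - a) = kappa (t - a0) * ipw (v - a1).
  rewrite -ipw_cons rV_consD rV_consN; congr (ipw (_ - _)).
  by rewrite /a0 /a1 -surjective_pairing.
under eq_integral => t _.
  under eq_integral => v _ do rewrite E EFinM.
  rewrite ge0_integralZl//; last 3 first.
  - by apply/measurable_EFinP; exact: measurable_ipw.
  - by move=> v _; rewrite lee_fin ipw_ge0.
  - by rewrite lee_fin kappa_ge0.
  over.
rewrite ge0_integralZr//; last 3 first.
- by apply/measurable_EFinP; exact: measurable_kappa.
- by move=> t _; rewrite lee_fin kappa_ge0.
- by apply: integral_ge0 => v _; rewrite lee_fin ipw_ge0.
rewrite exprS EFinM; apply: lee_pmul => //.
- by apply: integral_ge0 => t _; rewrite lee_fin kappa_ge0.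
- by apply: integral_ge0 => v _; rewrite lee_fin ipw_ge0.
- exact: integral_kappa.
Qed.

Lemma integrable_ipw n (C : R) (a : 'rV[R]_n) :
  (lebesgue_rV n).-integrable setT (fun v => (C * ipw (v - a))%:E).
Proof.
rewrite (_ : (fun v => _) = (fun v => C%:E * (ipw (v - a))%:E)%E).
  apply: integrableZl => //; apply/integrableP; split.
    by apply/measurable_EFinP; exact: measurable_ipw.
  apply: le_lt_trans (ltry (pi ^+ n)); apply: le_trans (integral_ipw_le a).
  by under eq_integral do rewrite /= ger0_norm ?ipw_ge0//.
by apply/funext => v; rewrite EFinM.
Qed.

Lemma Rintegral_ipw_le n (a : 'rV[R]_n) :
  \int[lebesgue_rV n]_v ipw (v - a) <= pi ^+ n.
Proof.
have := integrable_ipw 1 a; under eq_fun do rewrite mul1r.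
move=> /(integrable_fin_num measurableT) h.
by rewrite -lee_fin /Rintegral fineK// integral_ipw_le.
Qed.

End weight.

(** * Iterated integrals and integrals of partial derivatives *)

Section iterated.
Context {R : realType}.
Local Notation lam := (@lebesgue_measure R).

(** Both orders are recorded because [Rintegral_partial_eq0] must put innermost whichever of the
    head and the tail contains the differentiated coordinate. *)
Lemma Rintegral_rVS n (f : 'rV[R]_n.+1 -> R) (C : R) :
  measurable_fun setT f -> (forall v, `|f v| <= C * ipw v) ->
  (\int[lebesgue_rV n.+1]_v f v =
     \int[lam]_t \int[lebesgue_rV n]_v f (rV_cons (t, v))) /\
  (\int[lebesgue_rV n.+1]_v f v =
     \int[lebesgue_rV n]_v \int[lam]_t f (rV_cons (t, v))).
Proof.
move=> mf fC.
have mfc : measurable_fun setT (f \o @rV_cons R n).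
  by apply: (measurableT_comp mf); exact: measurable_rV_cons.
have ik : lam.-integrable setT (EFin \o (fun t : R => C * kappa t)).
  apply: (@integrable_kappa _ _ `|C|).
    apply: measurable_funM => //.
    by have := @measurable_kappa R 0; under eq_fun do rewrite subr0.
  by move=> t; rewrite normrM (ger0_norm (kappa_ge0 _)).
have ip : (lebesgue_rV n).-integrable setT (EFin \o (@ipw R n)).
  by have := @integrable_ipw R n 1 0; under eq_fun do rewrite mul1r subr0.
have bd (t : R) (v : 'rV[R]_n) : `|(f \o @rV_cons R n) (t, v)| <= C * kappa t * ipw v.
  by rewrite -mulrA -ipw_cons; exact: fC.
have E1 := Rintegral12_prod mfc ik ip bd.
have E2 := Rintegral_swap mfc ik ip bd.
rewrite (Rintegral_rVS_prod mf (integrable_prod_dominated mfc ik ip bd)).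
by rewrite -[X in X = _ /\ _]E1 -[X in _ /\ X = _]E1 -E2.
Qed.

Lemma rV_cons0E n (t : R) (v : 'rV[R]_n) : rV_cons (t, v) ord0 ord0 = t.
Proof.
transitivity ((row_mx (t%:M : 'M[R]_1) v) ord0 (lshift n ord0)).
  by congr (fun_of_matrix _ _ _); exact/val_inj.
by rewrite row_mxEl mxE eqxx mulr1n.
Qed.

Lemma rV_consSE n (t : R) (v : 'rV[R]_n) k :
  rV_cons (t, v) ord0 (lift ord0 k) = v ord0 k.
Proof.
transitivity ((row_mx (t%:M : 'M[R]_1) v) ord0 (rshift 1 k)).
  by congr (fun_of_matrix _ _ _); exact/val_inj.
by rewrite row_mxEr.
Qed.

Lemma continuous_rV_cons n (t : R) : continuous (fun v : 'rV[R]_n => rV_cons (t, v)).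
Proof.
apply: continuous_mx => i k; rewrite (ord1 i).
case: (unliftP ord0 k) => [l ->|->].
  by under eq_fun do rewrite rV_consSE; exact: coord_continuous.
by under eq_fun do rewrite rV_cons0E; exact: cst_continuous.
Qed.

Lemma continuous_rV_consl n (v : 'rV[R]_n) : continuous (fun t : R => rV_cons (t, v)).
Proof.
apply: continuous_mx => i k; rewrite (ord1 i).
case: (unliftP ord0 k) => [l ->|->].
  by under eq_fun do rewrite rV_consSE; exact: cst_continuous.
by under eq_fun do rewrite rV_cons0E; move=> t; exact: cvg_id.
Qed.

Lemma Rintegral_partial_eq0 n (j : 'I_n) (phi psi : 'rV[R]_n -> R) (C : R) :
  (forall v, is_derive v (delta_mx ord0 j) phi (psi v)) -> continuous psi ->
  (forall v, `|phi v| <= C * ipw v) -> (forall v, `|psi v| <= C * ipw v) ->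
  \int[lebesgue_rV n]_v psi v = 0.
Proof.
elim: n j phi psi C => [[]//|n IH] j phi psi C dphi cpsi phiC psiC.
have C0 : 0 <= C.
  by have := le_trans (normr_ge0 _) (psiC 0); rewrite pmulr_lge0 ?ipw_gt0.
have mpsi : measurable_fun setT psi by exact: continuous_measurable_rV.
have [E1 E2] := Rintegral_rVS mpsi psiC.
case: (unliftP ord0 j) => [k jk|j0].
- rewrite E1 /Rintegral integral0_eq// => t _.
  (* On the slice of head coordinate [t] the weight factors, and [C * kappa t] is the constant left
     for the remaining coordinates. *)
  congr EFin; apply: (IH k (fun v => phi (rV_cons (t, v))) _ (C * kappa t)).
  + move=> v; rewrite -[X in is_derive _ _ _ X]mul1r.
    apply: (is_derive_along (M := fun v => rV_cons (t, v)) _ (dphi _)) => s.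
    rewrite mulr1 jk; apply/rowP => i.
    by case: (unliftP ord0 i) => [l ->|->]; rewrite ?(rV_consSE, rV_cons0E, mxE)/=;
      rewrite ?(inj_eq lift_inj) ?(eq_sym ord0) ?(negPf (neq_lift _ _)) /= ?mulr0 ?add0r.
  + move=> v; apply: (@continuous_comp _ _ _ (fun v => rV_cons (t, v)) psi).
      exact: continuous_rV_cons.
    exact: cpsi.
  + by move=> v; rewrite -mulrA -ipw_cons.
  + by move=> v; rewrite -mulrA -ipw_cons.
- rewrite E2 /Rintegral integral0_eq// => v _.
  congr EFin.
  apply: (@Rintegral_derive_eq0 _ (fun t => phi (rV_cons (t, v))) _ (C * ipw v)).
  + move=> t; rewrite -[X in is_derive _ _ _ X]mul1r.
    apply: (is_derive_along (M := fun t => rV_cons (t, v)) _ (dphi _)) => s.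
    rewrite mulr1 j0; apply/rowP => i.
    by case: (unliftP ord0 i) => [l ->|->]; rewrite ?(rV_consSE, rV_cons0E, mxE)/=;
      rewrite ?eqxx ?mulr1 ?scaler1 ?(eq_sym _ ord0) ?(negPf (neq_lift _ _)) /= ?mulr0 ?add0r.
  + move=> t; apply: (@continuous_comp _ _ _ (fun t => rV_cons (t, v)) psi).
      exact: continuous_rV_consl.
    exact: cpsi.
  + by move=> t; rewrite mulrAC -mulrA -ipw_cons.
  + by move=> t; rewrite mulrAC -mulrA -ipw_cons.
Qed.

End iterated.

(** * Complex-valued functions and integration by parts *)

Section complex_values.
Context {R : realType}.
Implicit Types (x y z : R[i]) (a b t : R).

Lemma cReM x y : complex.Re (x * y) =
  complex.Re x * complex.Re y - complex.Im x * complex.Im y.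
Proof. by case: x; case: y. Qed.

Lemma cImM x y : complex.Im (x * y) =
  complex.Re x * complex.Im y + complex.Im x * complex.Re y.
Proof. by case: x => a b; case: y => c d /=; rewrite [b * c]mulrC. Qed.

Lemma cReD x y : complex.Re (x + y) = complex.Re x + complex.Re y.
Proof. by case: x; case: y. Qed.

Lemma cImD x y : complex.Im (x + y) = complex.Im x + complex.Im y.
Proof. by case: x; case: y. Qed.

Lemma cReN x : complex.Re (- x) = - complex.Re x.
Proof. by case: x. Qed.

Lemma cImN x : complex.Im (- x) = - complex.Im x.
Proof. by case: x. Qed.

Lemma cReB x y : complex.Re (x - y) = complex.Re x - complex.Re y.
Proof. by rewrite cReD cReN. Qed.

Lemma cImB x y : complex.Im (x - y) = complex.Im x - complex.Im y.
Proof. by rewrite cImD cImN. Qed.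

Lemma cReJ x : complex.Re (x^*%C) = complex.Re x.
Proof. by case: x. Qed.

Lemma cImJ x : complex.Im (x^*%C) = - complex.Im x.
Proof. by case: x. Qed.

Lemma complex_ext x y :
  complex.Re x = complex.Re y -> complex.Im x = complex.Im y -> x = y.
Proof. by case: x => a b; case: y => c d /= -> ->. Qed.

Lemma cmodE x : cmod x = Num.sqrt (complex.Re x ^+ 2 + complex.Im x ^+ 2).
Proof. by case: x. Qed.

Lemma cmod_ge0 x : 0 <= cmod x.
Proof. by rewrite cmodE sqrtr_ge0. Qed.

Lemma cmod_sqr x : cmod x ^+ 2 = complex.Re x ^+ 2 + complex.Im x ^+ 2.
Proof. by rewrite cmodE sqr_sqrtr// addr_ge0 ?sqr_ge0. Qed.

Lemma cmodM x y : cmod (x * y) = cmod x * cmod y.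
Proof. exact: Normc.normcM. Qed.

Lemma cmodD x y : cmod (x + y) <= cmod x + cmod y.
Proof. exact: le_normcD. Qed.

Lemma cmodN x : cmod (- x) = cmod x.
Proof. exact: normcN. Qed.

Lemma cmod1 : cmod (1 : R[i]) = 1.
Proof. exact: Normc.normc1. Qed.

Lemma cmodX x k : cmod (x ^+ k) = cmod x ^+ k.
Proof. by elim: k => [|k IH]; rewrite ?expr0 ?cmod1// !exprS cmodM IH. Qed.

Lemma cmod_prod I (s : seq I) (F : I -> R[i]) :
  cmod (\prod_(i <- s) F i) = \prod_(i <- s) cmod (F i).
Proof. by elim/big_rec2: _ => [|i u v _ <-]; rewrite ?cmod1 ?cmodM. Qed.

Lemma cmodJ x : cmod (x^*%C) = cmod x.
Proof. by rewrite !cmodE cReJ cImJ sqrrN. Qed.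

Lemma ler_Re_cmod x : `|complex.Re x| <= cmod x.
Proof. by rewrite cmodE -sqrtr_sqr ler_wsqrtr// lerDl sqr_ge0. Qed.

Lemma ler_Im_cmod x : `|complex.Im x| <= cmod x.
Proof. by rewrite cmodE -sqrtr_sqr ler_wsqrtr// lerDr sqr_ge0. Qed.

Lemma cmod_le_ReIm x : cmod x <= `|complex.Re x| + `|complex.Im x|.
Proof.
rewrite -(ler_pXn2r (n := 2)) ?nnegrE ?cmod_ge0 ?addr_ge0// cmod_sqr.
rewrite -[complex.Re x ^+ 2]real_normK ?num_real//.
rewrite -[complex.Im x ^+ 2]real_normK ?num_real// sqrrD.
by rewrite addrAC lerDl mulrn_wge0// mulr_ge0.
Qed.

Lemma cmod_real a : cmod (Complex a 0) = `|a|.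
Proof. by rewrite cmodE/= expr0n addr0 sqrtr_sqr. Qed.

Lemma cmod_cis t : cmod (cis t) = 1.
Proof. by rewrite cmodE/= cos2Dsin2 sqrtr1. Qed.

Lemma cisD a b : cis (a + b) = cis a * cis b :> R[i].
Proof. by apply: complex_ext; rewrite ?cReM ?cImM/= ?cosD ?sinD//; rewrite addrC. Qed.

Lemma cisN a : cis (- a) = (cis a)^*%C :> R[i].
Proof. by rewrite /cis cosN sinN. Qed.

Lemma conjcM x y : (x * y)^*%C = x^*%C * y^*%C.
Proof. exact: rmorphM. Qed.

End complex_values.

Section cintegral.
Context d (T : measurableType d) {R : realType} (mu : {measure set T -> \bar R}).
Implicit Types (f g : T -> R[i]) (h : T -> R).

Definition cmeasurable d' (T' : measurableType d') (f : T' -> R[i]) :=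
  measurable_fun setT (fun x => complex.Re (f x)) /\
  measurable_fun setT (fun x => complex.Im (f x)).

Definition cintegrable f :=
  mu.-integrable setT (EFin \o (fun x => complex.Re (f x))) /\
  mu.-integrable setT (EFin \o (fun x => complex.Im (f x))).

Lemma cintegrable_dominated f h : cmeasurable f ->
  mu.-integrable setT (EFin \o h) -> (forall x, cmod (f x) <= h x) -> cintegrable f.
Proof.
move=> [mr mi] ih fh; split; apply: integrable_dominated ih _ => // x.
  exact: le_trans (ler_Re_cmod _) (fh x).
exact: le_trans (ler_Im_cmod _) (fh x).
Qed.

(** The factor 2 comes from estimating the real and imaginary parts separately, as the integral is
    defined componentwise. *)
Lemma cmod_cintegral_le f h : cmeasurable f ->
  mu.-integrable setT (EFin \o h) -> (forall x, cmod (f x) <= h x) ->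
  cmod (cintegral mu setT f) <= 2 * \int[mu]_x h x.
Proof.
move=> [mr mi] ih fh; apply: le_trans (cmod_le_ReIm _) _ => /=.
rewrite mulr_natl mulr2n; apply: lerD; apply: normr_Rintegral_le => // x.
  exact: le_trans (ler_Re_cmod _) (fh x).
exact: le_trans (ler_Im_cmod _) (fh x).
Qed.

Lemma eq_cintegral D f g : (forall x, D x -> f x = g x) ->
  cintegral mu D f = cintegral mu D g.
Proof.
by move=> fg; rewrite /cintegral; congr Complex; apply: eq_Rintegral => x /set_mem Dx;
  rewrite fg.
Qed.

Lemma cintegralB f g : cintegrable f -> cintegrable g ->
  cintegral mu setT (fun x => f x - g x) =
  cintegral mu setT f - cintegral mu setT g.
Proof.
move=> [fr fi] [gr gi]; rewrite /cintegral; apply: complex_ext => /=.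
  by rewrite -RintegralB//; apply: eq_Rintegral => x _; rewrite cReB.
by rewrite -RintegralB//; apply: eq_Rintegral => x _; rewrite cImB.
Qed.

Let integrableMl (a : R) h : mu.-integrable setT (EFin \o h) ->
  mu.-integrable setT (EFin \o (fun x => a * h x)).
Proof.
move=> ih; rewrite (_ : EFin \o _ = fun x => (a%:E * (h x)%:E)%E).
  exact: integrableZl.
by apply/funext => x /=; rewrite EFinM.
Qed.

Lemma cintegralZl z f : cintegrable f ->
  cintegral mu setT (fun x => z * f x) = z * cintegral mu setT f.
Proof.
move=> [fr fi]; rewrite /cintegral; apply: complex_ext; rewrite ?cReM ?cImM/=.
  rewrite -!RintegralZl// -RintegralB//; do ?exact: integrableMl.
  by apply: eq_Rintegral => x _; rewrite cReM.
rewrite -!RintegralZl// -RintegralD//; do ?exact: integrableMl.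
by apply: eq_Rintegral => x _; rewrite cImM.
Qed.

End cintegral.

Section complex_derivatives.
Context {R : realType}.

Definition cder n (j : 'I_n) (f f' : 'rV[R]_n -> R[i]) := forall v,
  is_derive v (delta_mx ord0 j) (fun x => complex.Re (f x)) (complex.Re (f' v)) /\
  is_derive v (delta_mx ord0 j) (fun x => complex.Im (f x)) (complex.Im (f' v)).

Definition ccont (T : topologicalType) (f : T -> R[i]) :=
  continuous (fun x => complex.Re (f x)) /\ continuous (fun x => complex.Im (f x)).

Lemma ccontM (T : topologicalType) (f g : T -> R[i]) :
  ccont f -> ccont g -> ccont (fun x => f x * g x).
Proof.
move=> [fr fi] [gr gi]; split.
  rewrite (funext (fun x => cReM (f x) (g x))) => x.
  by apply: cvgB; apply: cvgM; [exact: fr|exact: gr|exact: fi|exact: gi].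
rewrite (funext (fun x => cImM (f x) (g x))) => x.
by apply: cvgD; apply: cvgM; [exact: fr|exact: gi|exact: fi|exact: gr].
Qed.

Lemma ccontD (T : topologicalType) (f g : T -> R[i]) :
  ccont f -> ccont g -> ccont (fun x => f x + g x).
Proof.
move=> [fr fi] [gr gi]; split.
  rewrite (funext (fun x => cReD (f x) (g x))) => x.
  by apply: cvgD; [exact: fr|exact: gr].
rewrite (funext (fun x => cImD (f x) (g x))) => x.
by apply: cvgD; [exact: fi|exact: gi].
Qed.

Lemma ccont_cst (T : topologicalType) (z : R[i]) : ccont (fun _ : T => z).
Proof. by split=> x; exact: cvg_cst. Qed.

Lemma ccontN (T : topologicalType) (f : T -> R[i]) :
  ccont f -> ccont (fun x => - f x).
Proof.
move=> cf; have := ccontM (ccont_cst T (-1)) cf.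
by under eq_fun do rewrite mulN1r.
Qed.

Lemma ccont_comp (S T : topologicalType) (M : S -> T) (f : T -> R[i]) :
  continuous M -> ccont f -> ccont (f \o M).
Proof.
move=> cM [fr fi]; split=> x.
  by apply: (@continuous_comp _ _ _ M (fun x => complex.Re (f x))); [exact: cM|exact: fr].
by apply: (@continuous_comp _ _ _ M (fun x => complex.Im (f x))); [exact: cM|exact: fi].
Qed.

Lemma ccont_cis (T : topologicalType) (f : T -> R) :
  continuous f -> ccont (fun x => cis (f x)).
Proof.
move=> cf; split=> x /=.
  by apply: (@continuous_comp _ _ _ f (@cos R)); [exact: cf|exact: continuous_cos].
by apply: (@continuous_comp _ _ _ f (@sin R)); [exact: cf|exact: continuous_sin].
Qed.

Lemma cmeasurable_cont n (f : 'rV[R]_n -> R[i]) : ccont f -> cmeasurable f.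
Proof. by move=> [fr fi]; split; exact: continuous_measurable_rV. Qed.

Lemma cderM n (j : 'I_n) (f f' g g' : 'rV[R]_n -> R[i]) :
  cder j f f' -> cder j g g' ->
  cder j (fun v => f v * g v) (fun v => f v * g' v + f' v * g v).
Proof.
move=> df dg v; have [dfr dfi] := df v; have [dgr dgi] := dg v; split.
  have := is_deriveB (is_deriveM dfr dgr) (is_deriveM dfi dgi).
  set F := (X in is_derive _ _ X _); set G := (X in _ -> is_derive _ _ X _).
  have -> : F = G by apply/funext => x; rewrite /F /G cReM.
  by move=> h; apply: is_derive_eq; rewrite cReD !cReM /GRing.scale/=; ring.
have := is_deriveD (is_deriveM dfr dgi) (is_deriveM dfi dgr).
set F := (X in is_derive _ _ X _); set G := (X in _ -> is_derive _ _ X _).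
have -> : F = G by apply/funext => x; rewrite /F /G cImM.
by move=> h; apply: is_derive_eq; rewrite cImD !cImM /GRing.scale/=; ring.
Qed.

Lemma cderD n (j : 'I_n) (f f' g g' : 'rV[R]_n -> R[i]) :
  cder j f f' -> cder j g g' -> cder j (fun v => f v + g v) (fun v => f' v + g' v).
Proof.
move=> df dg v; have [dfr dfi] := df v; have [dgr dgi] := dg v; split.
  have := is_deriveD dfr dgr; rewrite -cReD.
  by set F := (X in is_derive _ _ X _); set G := (X in _ -> is_derive _ _ X _);
    have -> : F = G by apply/funext => x; rewrite /F /G cReD.
have := is_deriveD dfi dgi; rewrite -cImD.
by set F := (X in is_derive _ _ X _); set G := (X in _ -> is_derive _ _ X _);
  have -> : F = G by apply/funext => x; rewrite /F /G cImD.
Qed.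

Lemma cder_cst n (j : 'I_n) (z : R[i]) : cder j (fun=> z) (fun=> 0).
Proof. by move=> v; split; exact: is_derive_cst. Qed.

Lemma cderN n (j : 'I_n) (f f' : 'rV[R]_n -> R[i]) :
  cder j f f' -> cder j (fun v => - f v) (fun v => - f' v).
Proof.
move=> /(cderM (cder_cst j (-1))) h v; move: (h v).
under eq_fun do rewrite mulN1r; rewrite mul0r addr0 mulN1r.
by under [in X in _ /\ X]eq_fun do rewrite mulN1r.
Qed.

Lemma cderJ n (j : 'I_n) (f f' : 'rV[R]_n -> R[i]) :
  cder j f f' -> cder j (fun v => (f v)^*%C) (fun v => (f' v)^*%C).
Proof.
move=> df v; have [dfr dfi] := df v; split.
  by under eq_fun do rewrite cReJ; rewrite cReJ.
have := is_deriveN dfi; rewrite -cImJ.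
by under [in X in _ -> X]eq_fun do rewrite cImJ.
Qed.

Lemma cder_along m n (j : 'I_m) (k : 'I_n) (c : R) (M : 'rV[R]_m -> 'rV[R]_n) f f' :
  (forall v s, M (s *: delta_mx ord0 j + v) = (s * c) *: delta_mx ord0 k + M v) ->
  cder k f f' -> cder j (f \o M) (fun v => Complex c 0 * f' (M v)).
Proof.
move=> Ml df v; have [dfr dfi] := df (M v); split.
  rewrite cReM/= mul0r subr0.
  by apply: (is_derive_along (f := fun x => complex.Re (f x)) (Ml v)).
rewrite cImM/= mul0r addr0.
by apply: (is_derive_along (f := fun x => complex.Im (f x)) (Ml v)).
Qed.

Lemma dotvZl n (a : R) (x y : 'rV[R]_n) : dotv (a *: x) y = a * dotv x y.
Proof. by rewrite /dotv mulr_sumr; apply: eq_bigr => i _; rewrite mxE mulrA. Qed.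

Lemma dotvC n (x y : 'rV[R]_n) : dotv x y = dotv y x.
Proof. by apply: eq_bigr => i _; rewrite mulrC. Qed.

Lemma dotvDl n (x y z : 'rV[R]_n) : dotv (x + y) z = dotv x z + dotv y z.
Proof. by rewrite /dotv -big_split; apply: eq_bigr => i _; rewrite mxE mulrDl. Qed.

Lemma dotvDr n (x y z : 'rV[R]_n) : dotv z (x + y) = dotv z x + dotv z y.
Proof. by rewrite dotvC dotvDl !(dotvC z). Qed.

Lemma dotvZr n (a : R) (x y : 'rV[R]_n) : dotv x (a *: y) = a * dotv x y.
Proof. by rewrite dotvC dotvZl dotvC. Qed.

Lemma dotv_delta n (j : 'I_n) (c : 'rV[R]_n) : dotv c (delta_mx ord0 j) = c ord0 j.
Proof.
rewrite /dotv (bigD1 j)//= mxE !eqxx mulr1 big1 ?addr0// => i ij.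
by rewrite mxE (negPf ij) mulr0.
Qed.

Lemma continuous_dotv n (c : 'rV[R]_n) : continuous (dotv c).
Proof.
move=> v; have Fv : Filter (nbhs v) by exact: nbhs_filter.
apply: cvg_big => [|i _]; first exact: add_continuous.
by apply: cvgM; [exact: cvg_cst|exact: coord_continuous].
Qed.

Lemma cder_cis n (j : 'I_n) (c : 'rV[R]_n) (c0 : R) :
  cder j (fun v => cis (dotv c v + c0))
    (fun v => Complex 0 (c ord0 j) * cis (dotv c v + c0)).
Proof.
move=> v; pose M (v : 'rV[R]_n) := dotv c v + c0 : R.
have Ml (s : R) : M (s *: delta_mx ord0 j + v) = (s * c ord0 j) *: (1 : R) + M v.
  by rewrite /M dotvDr dotvZr dotv_delta addrA scaler1.
rewrite cReM cImM /= !mul0r !add0r; split.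
  rewrite -mulrN.
  exact: (is_derive_along (f := @cos R) Ml (is_derive_cos _)).
exact: (is_derive_along (f := @sin R) Ml (is_derive_sin _)).
Qed.

Lemma cintegral_cder_eq0 n (j : 'I_n) (f f' : 'rV[R]_n -> R[i]) (C : R) :
  cder j f f' -> ccont f' -> (forall v, cmod (f v) <= C * ipw v) ->
  (forall v, cmod (f' v) <= C * ipw v) -> cintegral (lebesgue_rV n) setT f' = 0.
Proof.
move=> df [cr ci] fC f'C; rewrite /cintegral; apply: complex_ext => /=.
  apply: (@Rintegral_partial_eq0 _ _ j (fun x => complex.Re (f x)) _ C) => // v.
  - by have [] := df v.
  - exact: le_trans (ler_Re_cmod _) (fC v).
  - exact: le_trans (ler_Re_cmod _) (f'C v).
apply: (@Rintegral_partial_eq0 _ _ j (fun x => complex.Im (f x)) _ C) => // v.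
- by have [] := df v.
- exact: le_trans (ler_Im_cmod _) (fC v).
- exact: le_trans (ler_Im_cmod _) (f'C v).
Qed.

Lemma cintegrable_ipw n (f : 'rV[R]_n -> R[i]) (C : R) :
  ccont f -> (forall v, cmod (f v) <= C * ipw v) -> cintegrable (lebesgue_rV n) f.
Proof.
move=> cf fC; apply: cintegrable_dominated fC; first exact: cmeasurable_cont.
by have := @integrable_ipw R n C 0; under eq_fun do rewrite subr0.
Qed.

(** The operator 1 + d_j multiplies the exponential by 1 + i c_j, and the integral of d_j of the
    product vanishes, which moves d_j onto [A] with the opposite sign. Compared with the multiplier
    i c_j, this one can be divided out for every frequency. *)
Lemma cintegral_by_parts n (j : 'I_n) (c : 'rV[R]_n) (c0 : R)
    (A A' : 'rV[R]_n -> R[i]) (C : R) :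
  cder j A A' -> ccont A -> ccont A' ->
  (forall v, cmod (A v) <= C * ipw v) -> (forall v, cmod (A' v) <= C * ipw v) ->
  Complex 1 (c ord0 j) *
    cintegral (lebesgue_rV n) setT (fun v => cis (dotv c v + c0) * A v) =
  cintegral (lebesgue_rV n) setT (fun v => cis (dotv c v + c0) * (A v - A' v)).
Proof.
move=> dA cA cA' AC A'C; set e := fun v => cis (dotv c v + c0).
have C0 : 0 <= C.
  by have := le_trans (cmod_ge0 _) (AC 0); rewrite pmulr_lge0 ?ipw_gt0.
have ce : ccont e.
  apply: ccont_cis => v; have Fv : Filter (nbhs v) by exact: nbhs_filter.
  by apply: cvgD; [exact: continuous_dotv|exact: cvg_cst].
pose D v := e v * A' v + Complex 0 (c ord0 j) * e v * A v.
have d1 : cder j (fun v => e v * A v) D by exact: cderM (cder_cis j c c0) dA.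
have cD : ccont D.
  apply: ccontD; first exact: ccontM.
  by apply: ccontM => //; apply: ccontM => //; exact: ccont_cst.
(* The constant [(1 + |c_j|) C] serves both the product and its derivative: the latter consists of a
   term in [A'] and a term in [A] with the extra factor i c_j. *)
have eC v : cmod (e v * A v) <= (1 + `|c ord0 j|) * C * ipw v.
  rewrite cmodM cmod_cis mul1r (le_trans (AC v))// ler_wpM2r ?ipw_ge0//.
  by rewrite ler_peMl// lerDl.
have DC v : cmod (D v) <= (1 + `|c ord0 j|) * C * ipw v.
  apply: le_trans (cmodD _ _) _.
  rewrite !cmodM !cmod_cis !mul1r mulr1 -!mulrA mulrDl mul1r lerD//.
  rewrite cmodE/= expr0n add0r sqrtr_sqr ler_wpM2l//.
have I0 : cintegral (lebesgue_rV n) setT D = 0.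
  exact: (cintegral_cder_eq0 d1 cD eC DC).
have ieA : cintegrable (lebesgue_rV n) (fun v => e v * A v).
  by apply: (cintegrable_ipw _ eC); exact: ccontM.
have iD : cintegrable (lebesgue_rV n) D by exact: (cintegrable_ipw cD DC).
have izA : cintegrable (lebesgue_rV n) (fun v => Complex 1 (c ord0 j) * (e v * A v)).
  apply: (@cintegrable_ipw _ _ (cmod (Complex 1 (c ord0 j)) * ((1 + `|c ord0 j|) * C))).
    by apply: ccontM; [exact: ccont_cst|exact: ccontM].
  by move=> v; rewrite cmodM -mulrA ler_wpM2l ?cmod_ge0.
rewrite -cintegralZl// -[LHS]subr0 -I0 -cintegralB//.
apply: eq_cintegral => v _; rewrite /D -/(e v).
rewrite (_ : Complex 1 _ = 1 + Complex 0 (c ord0 j)); first by ring.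
by apply: complex_ext; rewrite ?cReD ?cImD /= ?addr0 ?add0r.
Qed.

End complex_derivatives.

(** * Amplitudes and repeated integration by parts *)

Section amplitudes.
Context {R : realType} {N : nat} {P : Type}.
Implicit Types (A : R -> P -> 'rV[R]_N -> R[i]) (B : R -> P -> 'rV[R]_N -> R).

Definition bounded_by B A := exists2 C, 0 <= C &
  forall t p v, 0 <= t <= 1 -> cmod (A t p v) <= C * B t p v.

(* Families [A t p] whose coordinate derivatives of order at most [k] are all O([B])
   uniformly in [p] and in the time [t] of [0, 1].  Derivatives are only asserted to
   exist: an integration by parts then never has to name its outcome. *)
Fixpoint amplitude k B A : Prop :=
  [/\ forall t p, ccont (A t p),
      forall p v, cmeasurable (fun t : measurableTypeR R => A t p v),
      bounded_by B A &
      if k is k'.+1 then forall j, exists2 A' : R -> P -> 'rV[R]_N -> R[i],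
        forall t p, cder j (A t p) (A' t p) & amplitude k' B A'
      else True].

Lemma amplitudeW k B A : amplitude k.+1 B A -> amplitude k B A.
Proof.
elim: k A => [|k IH] A [cA mA bA dA]; first by [].
split=> // j; have [A' dA' /IH aA'] := dA j; by exists A'.
Qed.

Lemma amplitude0 k B A : amplitude k B A ->
  [/\ forall t p, ccont (A t p),
      forall p v, cmeasurable (fun t : measurableTypeR R => A t p v) &
      bounded_by B A].
Proof. by case: k => [|k] []. Qed.

Lemma amplitude_le k B B' A (C : R) : 0 <= C ->
  (forall t p v, 0 <= t <= 1 -> B t p v <= C * B' t p v) ->
  amplitude k B A -> amplitude k B' A.
Proof.
move=> C0 BB'.
have bb A0 : bounded_by B A0 -> bounded_by B' A0.
  move=> [D D0 AD]; exists (D * C); first exact: mulr_ge0.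
  move=> t p v t01; apply: le_trans (AD _ _ _ t01) _.
  by rewrite -mulrA ler_wpM2l// BB'.
elim: k A => [|k IH] A [cA mA bA dA]; first by split=> //; exact: bb.
split=> //; first exact: bb.
by move=> j; have [A' dA' /IH aA'] := dA j; exists A'.
Qed.

Lemma cmeasurable_cst d (T : measurableType d) (z : R[i]) :
  cmeasurable (fun _ : T => z).
Proof.
by split; [exact: (measurable_cst (complex.Re z))|exact: (measurable_cst (complex.Im z))].
Qed.

Lemma cmeasurableM d (T : measurableType d) (f g : T -> R[i]) :
  cmeasurable f -> cmeasurable g -> cmeasurable (fun x => f x * g x).
Proof.
move=> [fr fi] [gr gi]; split.
  rewrite (funext (fun x => cReM (f x) (g x))).
  by apply: measurable_funB; exact: measurable_funM.
rewrite (funext (fun x => cImM (f x) (g x))).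
by apply: measurable_funD; exact: measurable_funM.
Qed.

Lemma cmeasurableD d (T : measurableType d) (f g : T -> R[i]) :
  cmeasurable f -> cmeasurable g -> cmeasurable (fun x => f x + g x).
Proof.
move=> [fr fi] [gr gi]; split.
  by rewrite (funext (fun x => cReD (f x) (g x))); exact: measurable_funD.
by rewrite (funext (fun x => cImD (f x) (g x))); exact: measurable_funD.
Qed.

Lemma cmeasurableN d (T : measurableType d) (f : T -> R[i]) :
  cmeasurable f -> cmeasurable (fun x => - f x).
Proof.
move=> [fr fi]; split.
  by rewrite (funext (fun x => cReN (f x))); exact: measurableT_comp.
by rewrite (funext (fun x => cImN (f x))); exact: measurableT_comp.
Qed.

Lemma cmeasurableJ d (T : measurableType d) (f : T -> R[i]) :
  cmeasurable f -> cmeasurable (fun x => (f x)^*%C).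
Proof.
move=> [fr fi]; split; first by rewrite (funext (fun x => cReJ (f x))).
by rewrite (funext (fun x => cImJ (f x))); exact: measurableT_comp.
Qed.

Lemma ccontJ (T : topologicalType) (f : T -> R[i]) :
  ccont f -> ccont (fun x => (f x)^*%C).
Proof.
move=> [fr fi]; split; first by rewrite (funext (fun x => cReJ (f x))).
by rewrite (funext (fun x => cImJ (f x))) => x; apply: cvgN; exact: fi.
Qed.

Lemma amplitudeD k B A A' : amplitude k B A -> amplitude k B A' ->
  amplitude k B (fun t p v => A t p v + A' t p v).
Proof.
have bb A0 A1 : bounded_by B A0 -> bounded_by B A1 ->
    bounded_by B (fun t p v => A0 t p v + A1 t p v).
  move=> [C C0 hA] [C' C'0 hA']; exists (C + C'); first exact: addr_ge0.
  move=> t p v t01; apply: le_trans (cmodD _ _) _.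
  by rewrite mulrDl lerD ?hA ?hA'.
elim: k A A' => [|k IH] A A' [cA mA bA dA] [cA' mA' bA' dA'].
  split=> //; [by move=> t p; exact: ccontD|by move=> p v; exact: cmeasurableD|exact: bb].
split; [by move=> t p; exact: ccontD|by move=> p v; exact: cmeasurableD|exact: bb|].
move=> j; have [A1 d1 a1] := dA j; have [A2 d2 a2] := dA' j.
exists (fun t p v => A1 t p v + A2 t p v); last exact: IH.
by move=> t p; exact: cderD.
Qed.

Lemma amplitudeN k B A : amplitude k B A -> amplitude k B (fun t p v => - A t p v).
Proof.
have bb A0 : bounded_by B A0 -> bounded_by B (fun t p v => - A0 t p v).
  by move=> [C C0 hA]; exists C => // t p v t01; rewrite cmodN hA.
elim: k A => [|k IH] A [cA mA bA dA].
  split=> //; [by move=> t p; exact: ccontN|by move=> p v; exact: cmeasurableN|exact: bb].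
split; [by move=> t p; exact: ccontN|by move=> p v; exact: cmeasurableN|exact: bb|].
move=> j; have [A1 d1 a1] := dA j.
exists (fun t p v => - A1 t p v); last exact: IH.
by move=> t p; exact: cderN.
Qed.

Lemma amplitudeJ k B A : amplitude k B A ->
  amplitude k B (fun t p v => (A t p v)^*%C).
Proof.
have bb A0 : bounded_by B A0 -> bounded_by B (fun t p v => (A0 t p v)^*%C).
  by move=> [C C0 hA]; exists C => // t p v t01; rewrite cmodJ hA.
elim: k A => [|k IH] A [cA mA bA dA].
  split=> //; [by move=> t p; exact: ccontJ|by move=> p v; exact: cmeasurableJ|exact: bb].
split; [by move=> t p; exact: ccontJ|by move=> p v; exact: cmeasurableJ|exact: bb|].
move=> j; have [A1 d1 a1] := dA j.
exists (fun t p v => (A1 t p v)^*%C); last exact: IH.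
by move=> t p; exact: cderJ.
Qed.

Lemma amplitudeM k B B' A A' : amplitude k B A -> amplitude k B' A' ->
  amplitude k (fun t p v => B t p v * B' t p v) (fun t p v => A t p v * A' t p v).
Proof.
have bb A0 A1 : bounded_by B A0 -> bounded_by B' A1 ->
    bounded_by (fun t p v => B t p v * B' t p v) (fun t p v => A0 t p v * A1 t p v).
  move=> [C C0 hA] [C' C'0 hA']; exists (C * C'); first exact: mulr_ge0.
  by move=> t p v t01; rewrite cmodM mulrACA ler_pM ?cmod_ge0 ?hA ?hA'.
elim: k A A' => [|k IH] A A'.
  move=> [cA mA bA dA] [cA' mA' bA' dA'].
  split=> //; [by move=> t p; exact: ccontM|by move=> p v; exact: cmeasurableM|exact: bb].
move=> aA aA'; have [cA mA bA dA] := aA; have [cA' mA' bA' dA'] := aA'.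
split; [by move=> t p; exact: ccontM|by move=> p v; exact: cmeasurableM|exact: bb|].
move=> j; have [A1 d1 a1] := dA j; have [A2 d2 a2] := dA' j.
exists (fun t p v => A t p v * A2 t p v + A1 t p v * A' t p v).
  by move=> t p; exact: cderM.
by apply: amplitudeD; apply: IH => //; exact: amplitudeW.
Qed.

Lemma amplitude_cst k (c : R -> R[i]) :
  cmeasurable (c : measurableTypeR R -> R[i]) ->
  (exists2 C, 0 <= C & forall t, 0 <= t <= 1 -> cmod (c t) <= C) ->
  amplitude k (fun _ _ _ => 1) (fun t _ _ => c t).
Proof.
move=> mc [C C0 cC].
have b : bounded_by (fun _ _ _ => 1) (fun t _ _ => c t).
  by exists C => // t p v /cC; rewrite mulr1.
elim: k c mc cC b => [|k IH] c mc cC b.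
  by split=> // t p; exact: ccont_cst.
split=> // [t p|j]; first exact: ccont_cst.
exists (fun _ _ _ => 0); first by move=> t p; exact: cder_cst.
have c0 : forall t : R, 0 <= t <= 1 -> cmod (0 : R[i]) <= C.
  by move=> t _; rewrite -[X in cmod X]/(Complex 0 0) cmod_real normr0.
apply: (IH (fun=> 0) _ c0); first exact: (@cmeasurable_cst _ (measurableTypeR R)).
by exists C => // t p v /c0; rewrite mulr1.
Qed.

Lemma amplitude_prod k I (s : seq I) (B : I -> R -> P -> 'rV[R]_N -> R)
    (A : I -> R -> P -> 'rV[R]_N -> R[i]) :
  (forall i, amplitude k (B i) (A i)) ->
  amplitude k (fun t p v => \prod_(i <- s) B i t p v)
    (fun t p v => \prod_(i <- s) A i t p v).
Proof.
move=> aA; elim: s => [|i s IH].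
  have -> : (fun t p v => \prod_(i <- [::]) B i t p v) = (fun _ _ _ => 1).
    by do 3 apply/funext => ?; rewrite big_nil.
  have -> : (fun t p v => \prod_(i <- [::]) A i t p v) = (fun _ _ _ => 1).
    by do 3 apply/funext => ?; rewrite big_nil.
  apply: (@amplitude_cst _ (fun=> 1)); first exact: (@cmeasurable_cst _ (measurableTypeR R)).
  by exists 1 => // t _; rewrite cmod1.
have -> : (fun t p v => \prod_(i <- i :: s) B i t p v) =
    (fun t p v => B i t p v * \prod_(i <- s) B i t p v).
  by do 3 apply/funext => ?; rewrite big_cons.
have -> : (fun t p v => \prod_(i <- i :: s) A i t p v) =
    (fun t p v => A i t p v * \prod_(i <- s) A i t p v).
  by do 3 apply/funext => ?; rewrite big_cons.
exact: amplitudeM.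
Qed.

(* [F] parametrizes a slice of R^N parallel to the coordinates [f j]; the outcome [A']
   of the integrations by parts does not depend on the slice. *)
Lemma amplitude_parts n (f : 'I_n -> 'I_N) (s : seq 'I_n) k B A :
  amplitude (size s + k) B A ->
  exists2 A' : R -> P -> 'rV[R]_N -> R[i], amplitude k B A' &
    forall t p (F : 'rV[R]_n -> 'rV[R]_N) (c : 'rV[R]_n) (c0 C : R),
    0 <= t <= 1 -> continuous F ->
    (forall j v r, F (r *: delta_mx ord0 j + v) = r *: delta_mx ord0 (f j) + F v) ->
    (forall v, B t p (F v) <= C * ipw v) ->
    (\prod_(j <- s) Complex 1 (c ord0 j)) * cintegral (lebesgue_rV n) setT
      (fun v => cis (dotv c v + c0) * A t p (F v)) =
    cintegral (lebesgue_rV n) setT (fun v => cis (dotv c v + c0) * A' t p (F v)).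
Proof.
elim: s A => [|j s IH] A aA.
  by exists A => // t p F c c0 C _ _ _ _; rewrite big_nil mul1r.
have [cA _ bA dA] := aA; have [A1 d1 a1] := dA (f j).
have [cA1 _ bA1] := amplitude0 a1.
(* One integration by parts replaces the amplitude by itself minus its derivative: one order of
   regularity is spent and the bound [B] is kept. *)
have [A' aA' E] := IH _ (amplitudeD (amplitudeW aA) (amplitudeN a1)).
exists A' => // t p F c c0 C t01 cF Fl BC.
rewrite big_cons -(E t p F c c0 C)// mulrAC mulrC; congr (_ * _).
have [D D0 AD] := bA; have [D1 D10 AD1] := bA1.
(* The sum covers the amplitude and its derivative at once; the absolute value is there because the
   sign of [C] is unknown. *)
pose K := (D + D1) * `|C|.
apply: (@cintegral_by_parts _ _ j c c0 (fun v => A t p (F v)) (fun v => A1 t p (F v)) K).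
- have Fl' v r : F (r *: delta_mx ord0 j + v) = (r * 1) *: delta_mx ord0 (f j) + F v.
    by rewrite mulr1.
  have := cder_along Fl' (d1 t p).
  by under [X in cder _ _ X]eq_fun do rewrite (_ : Complex 1 0 = 1)// mul1r.
- exact: (ccont_comp cF).
- exact: (ccont_comp cF).
- move=> v; apply: le_trans (AD _ _ _ t01) _.
  rewrite /K mulrDl mulrDl -[leLHS]addr0 lerD//.
    rewrite -mulrA ler_wpM2l// (le_trans (BC v))// ler_wpM2r ?ipw_ge0 ?ler_norm//.
  by rewrite !mulr_ge0 ?ipw_ge0.
- move=> v; apply: le_trans (AD1 _ _ _ t01) _.
  rewrite /K mulrDl mulrDl -[leLHS]add0r lerD//.
    by rewrite !mulr_ge0 ?ipw_ge0.
  rewrite -mulrA ler_wpM2l// (le_trans (BC v))// ler_wpM2r ?ipw_ge0 ?ler_norm//.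
Qed.

End amplitudes.

(** * Symmetry of mixed derivatives, symbol estimates *)

Section clairaut.
Context {R : realType}.

Lemma is_derive_on_line (V : normedModType R) (f D : V -> R) (e y : V) (s : R) :
  (forall y, is_derive y e f (D y)) ->
  is_derive s 1 (fun s : R => f (s *: e + y)) (D (s *: e + y)).
Proof.
move=> df; rewrite -[X in is_derive _ _ _ X]mul1r.
apply: (is_derive_along (M := fun s : R => s *: e + y) _ (df _)) => r.
by rewrite mulr1 scaler1 scalerDl addrA.
Qed.

Lemma continuous_is_derive (f D : R -> R) :
  (forall s : R, is_derive s 1 f (D s)) -> continuous f.
Proof.
by move=> df s; apply: differentiable_continuous; apply/derivable1_diffP.
Qed.

(** The mean value theorem applies first to the increment of [f] in direction [e'], as a function of
    the position along [e], and then to [D1] along [e']. *)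
Lemma second_difference (V : normedModType R) (f D1 D2 : V -> R) (e e' x : V) :
  (forall y, is_derive y e f (D1 y)) -> (forall y, is_derive y e' D1 (D2 y)) ->
  forall h : R, 0 < h -> exists a b : R,
  [/\ 0 < a < h, 0 < b < h &
  f (h *: e + (h *: e' + x)) - f (h *: e + x) - (f (h *: e' + x) - f x) =
  h ^+ 2 * D2 (a *: e + (b *: e' + x))].
Proof.
move=> d1 d2 h h0.
pose phi (s : R) := f (s *: e + (h *: e' + x)) - f (s *: e + x).
have dphi (s : R) : is_derive s 1 phi
    (D1 (s *: e + (h *: e' + x)) - D1 (s *: e + x)).
  by apply: is_deriveB; exact: is_derive_on_line.
have cphi := continuous_is_derive dphi.
have [a + phiE] := MVT h0 (fun s _ => dphi s) (continuous_in_subspaceT (fun s _ => cphi s)).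
rewrite in_itv/= => /andP[a0 ah].
pose psi (r : R) := D1 (r *: e' + (a *: e + x)).
have dpsi (r : R) : is_derive r 1 psi (D2 (r *: e' + (a *: e + x))).
  exact: is_derive_on_line.
have cpsi := continuous_is_derive dpsi.
have [b + psiE] := MVT h0 (fun s _ => dpsi s) (continuous_in_subspaceT (fun s _ => cpsi s)).
rewrite in_itv/= => /andP[b0 bh].
exists a, b; rewrite a0 ah b0 bh; split=> //.
move: phiE; rewrite /phi !scale0r !add0r => ->.
rewrite [a *: e + (h *: e' + x)]addrCA.
move: psiE; rewrite /psi scale0r add0r => ->.
by rewrite subr0 [a *: e + (b *: e' + x)]addrCA; ring.
Qed.

(* Both mixed derivatives are limits of the same second difference quotient. *)
Lemma clairaut (V : normedModType R) (f D1 D1' D2 D2' : V -> R) (e e' x : V) :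
  (forall y, is_derive y e f (D1 y)) -> (forall y, is_derive y e' D1 (D2 y)) ->
  (forall y, is_derive y e' f (D1' y)) -> (forall y, is_derive y e D1' (D2' y)) ->
  {for x, continuous D2} -> {for x, continuous D2'} -> D2 x = D2' x.
Proof.
move=> d1 d2 d1' d2' c2 c2'.
apply/eqP; rewrite -subr_eq0 -normr_le0; apply/ler_addgt0Pl => eps eps0; rewrite addr0.
have eps2 : 0 < eps / 2 by rewrite divr_gt0.
have /nbhs_normP[del /= del0 Hdel] : \forall y \near x,
    `|D2 x - D2 y| <= eps / 2 /\ `|D2' x - D2' y| <= eps / 2.
  apply: filterI.
    by move: c2 => /cvgrPdist_le/(_ _ eps2).
  by move: c2' => /cvgrPdist_le/(_ _ eps2).
pose h := del / (`|e| + `|e'| + 1).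
have n0 : 0 < `|e| + `|e'| + 1 by rewrite ltr_wpDl// addr_ge0.
have h0 : 0 < h by rewrite divr_gt0.
have near_pt (a b : R) : 0 < a < h -> 0 < b < h ->
    `|D2 x - D2 (a *: e + (b *: e' + x))| <= eps / 2 /\
    `|D2' x - D2' (a *: e + (b *: e' + x))| <= eps / 2.
  move=> /andP[a0 ah] /andP[b0 bh]; apply: Hdel => /=.
  rewrite addrA opprD addrCA subrr addr0 normrN.
  apply: le_lt_trans (ler_normD _ _) _; rewrite !normrZ !gtr0_norm//.
  apply: (@le_lt_trans _ _ (h * (`|e| + `|e'|))).
    by rewrite mulrDr lerD// ler_wpM2r// ltW.
  by rewrite /h mulrAC ltr_pdivrMr// ltr_pM2l// ltrDl.
have [a [b [ah bh E]]] := second_difference x d1 d2 h0.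
have [a' [b' [ah' bh' E']]] := second_difference x d1' d2' h0.
have [H1 _] := near_pt _ _ ah bh; have [_ H2] := near_pt _ _ bh' ah'.
have EE : D2 (a *: e + (b *: e' + x)) = D2' (b' *: e + (a' *: e' + x)).
  apply: (mulfI (lt0r_neq0 (exprn_gt0 2 h0))); rewrite -E.
  rewrite [b' *: e + _]addrCA -E' [h *: e' + (h *: e + x)]addrCA; ring.
rewrite (_ : D2 x - D2' x = (D2 x - D2 (a *: e + (b *: e' + x))) -
    (D2' x - D2' (b' *: e + (a' *: e' + x)))); last by rewrite EE; ring.
by apply: le_trans (ler_normB _ _) _; rewrite [eps]splitr lerD.
Qed.

End clairaut.

Section iterated_partials.
Context {R : realType} {n : nat}.
Implicit Types (f : 'rV[R]_n -> R) (s : seq 'I_n).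

Lemma iter_partial_rcons s i f :
  iter_partial s (partial i f) = iter_partial (rcons s i) f.
Proof. by rewrite /iter_partial foldr_rcons. Qed.

Lemma smooth_partial i f : smooth f -> smooth (partial i f).
Proof. by move=> sf s; rewrite iter_partial_rcons. Qed.

Lemma smooth_iter_partial s f : smooth f -> smooth (iter_partial s f).
Proof. by elim: s => //= i s IH sf; apply: smooth_partial; exact: IH. Qed.

Lemma smooth_is_derive f : smooth f -> forall i v,
  is_derive v (delta_mx ord0 i) f (partial i f v).
Proof. by move=> sf i v; apply: DeriveDef => //; have [_] := sf [::]; apply. Qed.

Lemma partialC i j f : smooth f -> partial i (partial j f) = partial j (partial i f).
Proof.
move=> sf; apply/funext => x.
apply: (@clairaut R _ f (partial j f) (partial i f) _ _
  (delta_mx ord0 j) (delta_mx ord0 i)).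
- exact: smooth_is_derive.
- exact/smooth_is_derive/smooth_partial.
- exact: smooth_is_derive.
- exact/smooth_is_derive/smooth_partial.
- by have [+ _] := sf [:: i; j]; apply.
- by have [+ _] := sf [:: j; i]; apply.
Qed.

(** The Schwartz and symbol classes bound derivatives taken in the canonical order of [multi_dirs],
    whereas integrations by parts differentiate in arbitrary order; sorting the directions bridges
    the two. *)
Lemma iter_partial_perm s s' f : smooth f -> perm_eq s s' ->
  iter_partial s f = iter_partial s' f.
Proof.
move=> sf; elim: s s' => [|i s IH] s' ss'.
  by rewrite (perm_nilP (s := s') _)// perm_sym.
have is' : i \in s' by rewrite -(perm_mem ss') mem_head.
move: ss'; case/splitPr: is' => s1 s2 ss'.
have ss12 : perm_eq s (s1 ++ s2).
  by move: ss'; rewrite perm_sym perm_catC /= perm_cons perm_catC perm_sym.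
rewrite /= (IH _ ss12) {ss' ss12}; elim: s1 => //= j s1 <-.
by apply: partialC; exact: smooth_iter_partial.
Qed.

Lemma perm_multi_dirs s : perm_eq s (multi_dirs (fun i => count_mem i s)).
Proof.
apply/allP => i _ /=; rewrite /multi_dirs count_flatten sumnE big_map big_map big_enum/=.
rewrite (bigD1 i)//= count_nseq /= eqxx mul1n big1 ?addn0// => j ji.
by rewrite count_nseq /= (negPf ji).
Qed.

End iterated_partials.

Lemma prod_multi_dirs (R : comPzRingType) n (e : nat) (F : 'I_n -> R) :
  \prod_(j <- multi_dirs (fun=> e)) F j = \prod_j F j ^+ e.
Proof.
rewrite /multi_dirs big_flatten/= big_map big_enum/=.
by apply: eq_bigr => j _; rewrite big_nseq iter_mulr_1.
Qed.

(** * Symbol estimates and their pullbacks *)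

Section symbol_bounds.
Context {R : realType} {n : nat}.

(** The common form of [schwartz] (with [b] a power of [ipw]) and [symbol_class] (with [b] a power
    of the Japanese bracket), for derivatives in any order; unlike the originals it is visibly
    stable under [partial]. *)
Definition symbol_bounded (b : 'rV[R]_n -> R) (f : 'rV[R]_n -> R[i]) :=
  csmooth f /\ forall s : seq 'I_n, exists2 C, 0 <= C & forall v,
    cmod (Complex (iter_partial s (fun y => complex.Re (f y)) v)
                  (iter_partial s (fun y => complex.Im (f y)) v)) <= C * b v.

Lemma symbol_boundedP b f : (forall v, 0 <= b v) -> csmooth f ->
  (forall alpha, exists C, forall v, cmod (cpartial alpha f v) <= C * b v) ->
  symbol_bounded b f.
Proof.
move=> b0 [sr si] h; split=> // s.
have [C hC] := h (fun i => count_mem i s); exists (`|C|) => // v.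
rewrite !(iter_partial_perm _ (perm_multi_dirs s))//.
by apply: le_trans (hC v) _; rewrite ler_wpM2r// ler_norm.
Qed.

Lemma symbol_bounded_partial b f i : symbol_bounded b f ->
  symbol_bounded b (fun v => Complex (partial i (fun y => complex.Re (f y)) v)
                                     (partial i (fun y => complex.Im (f y)) v)).
Proof.
move=> [[sr si] bf]; split; first by split; exact: smooth_partial.
move=> s; have [C C0 hC] := bf (rcons s i); exists C => // v.
by rewrite -!iter_partial_rcons in hC; exact: hC.
Qed.

Lemma symbol_bounded_cder b f i : symbol_bounded b f ->
  cder i f (fun v => Complex (partial i (fun y => complex.Re (f y)) v)
                             (partial i (fun y => complex.Im (f y)) v)).
Proof. by move=> [[sr si] _] v; split; exact: smooth_is_derive. Qed.

Lemma symbol_bounded_cont b f : symbol_bounded b f -> ccont f.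
Proof. by move=> [[sr si] _]; split; [have [] := sr [::]|have [] := si [::]]. Qed.

Lemma symbol_bounded_le b f : symbol_bounded b f ->
  exists2 C, 0 <= C & forall v, cmod (f v) <= C * b v.
Proof.
move=> [_ /(_ [::])[C C0 hC]]; exists C => // v; apply: le_trans (hC v).
by rewrite /=; case: (f v).
Qed.

Lemma cmeasurable_contR (f : R -> R[i]) : ccont f ->
  cmeasurable (f : measurableTypeR R -> R[i]).
Proof. by move=> [fr fi]; split; exact: continuous_measurable_fun. Qed.

(** Since [M] sends each coordinate direction to a multiple of a coordinate direction, the chain
    rule has one term: a derivative of [f], with the same weight, times a speed of modulus at most 1
    on [0, 1]. This is what makes the bounds uniform in time. *)
Lemma amplitude_pullback k N (P : Type) (b : 'rV[R]_n -> R) (f : 'rV[R]_n -> R[i])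
    (M : R -> P -> 'rV[R]_N -> 'rV[R]_n) (q : 'I_N -> 'I_n) (c : R -> 'I_N -> R) :
  symbol_bounded b f -> (forall t p, continuous (M t p)) ->
  (forall p v, continuous (fun t => M t p v)) -> (forall j, continuous (c ^~ j)) ->
  (forall t j, 0 <= t <= 1 -> `|c t j| <= 1) ->
  (forall t p j v r, M t p (r *: delta_mx ord0 j + v) =
    (r * c t j) *: delta_mx ord0 (q j) + M t p v) ->
  amplitude k (fun t p v => b (M t p v)) (fun t p v => f (M t p v)).
Proof.
move=> bf cM cMt cc c1 Ml.
have reg f0 : symbol_bounded b f0 -> [/\ forall t p, ccont (fun v => f0 (M t p v)),
    forall p v, cmeasurable (fun t : measurableTypeR R => f0 (M t p v)) &
    bounded_by (fun t p v => b (M t p v)) (fun t p v => f0 (M t p v))].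
  move=> bf0; have [C C0 hC] := symbol_bounded_le bf0.
  have cf0 := symbol_bounded_cont bf0; split=> [t p|p v|].
  - exact: (ccont_comp (cM t p)).
  - by apply: cmeasurable_contR; exact: (ccont_comp (cMt p v)).
  - by exists C => // t p v _; exact: hC.
elim: k f bf => [|k IH] f bf; have [r1 r2 r3] := reg _ bf; split=> // j.
 set f' := fun v => Complex (partial (q j) (fun y => complex.Re (f y)) v)
                             (partial (q j) (fun y => complex.Im (f y)) v).
exists (fun t p v => Complex (c t j) 0 * f' (M t p v)).
  move=> t p; apply: (cder_along (M := M t p)); last exact: symbol_bounded_cder bf.
  by move=> v r; exact: Ml.
have := @amplitudeM R N P k (fun _ _ _ => 1) (fun t p v => b (M t p v))
  (fun t _ _ => Complex (c t j) 0) (fun t p v => f' (M t p v)).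
have -> : (fun t p v => 1 * b (M t p v)) = (fun t p v => b (M t p v)).
  by do 3 apply/funext => ?; rewrite mul1r.
apply; last exact/IH/symbol_bounded_partial.
apply: (@amplitude_cst _ _ _ _ (fun t => Complex (c t j) 0)).
  by apply: cmeasurable_contR; split; [exact: cc|exact: cst_continuous].
by exists 1 => // t t01; rewrite cmod_real c1.
Qed.

End symbol_bounds.

(** * The frequency factors 1/(1 + i t) *)

Section resolvent.
Context {R : realType}.

Definition rinv (t : R) : R[i] := (Complex 1 t)^-1.

Lemma rinvE t : rinv t = Complex (kappa t) (- (t * kappa t)).
Proof. by rewrite /rinv /kappa; apply: complex_ext; rewrite /= expr1n ?mul1r. Qed.

Lemma rinvK t : rinv t * Complex 1 t = 1.
Proof.
rewrite /rinv mulVf//; apply/eqP => /(congr1 (@complex.Re R))/= /eqP.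
by rewrite oner_eq0.
Qed.

Lemma cmod_rinv_sqr t : cmod (rinv t) ^+ 2 = kappa t.
Proof.
have k0 : 1 + t ^+ 2 != 0 by rewrite gt_eqF// ltr_pwDl// sqr_ge0.
by rewrite rinvE cmod_sqr/= /kappa; field.
Qed.

Lemma cmod_Complex1_sqr t : cmod (Complex 1 t) ^+ 2 = 1 + t ^+ 2 :> R.
Proof. by rewrite cmod_sqr/= expr1n. Qed.

Lemma cmod_rinv_le1 t : cmod (rinv t) <= 1.
Proof.
rewrite -(ler_pXn2r (n := 2)) ?nnegrE ?cmod_ge0// cmod_rinv_sqr expr1n.
by rewrite /kappa invf_le1 ?lerDl ?sqr_ge0// ltr_pwDl// sqr_ge0.
Qed.

Lemma ccont_rinv : ccont rinv.
Proof.
have ck : continuous (@kappa R) by exact: continuous_oneDsqrV.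
split.
  by rewrite (_ : (fun t => _) = @kappa R)//; apply/funext => t; rewrite rinvE.
rewrite (_ : (fun t => _) = (fun t => - (t * kappa t))).
  by move=> t; apply: cvgN; apply: cvgM; [exact: cvg_id|exact: ck].
by apply/funext => t; rewrite rinvE.
Qed.

(* [rinv' = - i rinv^2], so every derivative of [rinv] is bounded by [rinv] itself. *)
Lemma is_derive_rinv (t : R) :
  is_derive t 1 (fun t => complex.Re (rinv t))
    (complex.Re (Complex 0 (-1) * (rinv t * rinv t))) /\
  is_derive t 1 (fun t => complex.Im (rinv t))
    (complex.Im (Complex 0 (-1) * (rinv t * rinv t))).
Proof.
have k0 : 1 + t ^+ 2 != 0 by rewrite gt_eqF// ltr_pwDl// sqr_ge0.
have dk : is_derive t 1 (@kappa R) (- (2 * t) * kappa t ^+ 2).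
  have d1 : is_derive t 1 (fun t : R => 1 + t ^+ 2) (2 * t).
    apply: is_derive_eq; rewrite /GRing.scale/=; ring.
  have := @is_deriveV R (fun t : R => 1 + t ^+ 2) t _ 1 k0 d1.
  by move=> h; apply: is_derive_eq; rewrite /kappa /GRing.scale/= exprVn; ring.
rewrite !rinvE; split.
  rewrite (_ : (fun t => _) = @kappa R); last by apply/funext => s; rewrite rinvE.
  by apply: is_derive_eq => /=; ring.
rewrite (_ : (fun t => _) = (fun t => - (t * kappa t))); last first.
  by apply/funext => s; rewrite rinvE.
have := is_deriveN (is_deriveM (is_derive_id t 1) dk).
move=> h; apply: is_derive_eq => /=; rewrite /kappa /GRing.scale/=; field.
exact: k0.
Qed.

Lemma amplitude_rinv k N (P : Type) (M : R -> P -> 'rV[R]_N -> R) (c : 'I_N -> R) :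
  (forall t p, continuous (M t p)) -> (forall p v, continuous (fun t => M t p v)) ->
  (forall t p j v r, M t p (r *: delta_mx ord0 j + v) = r * c j + M t p v) ->
  amplitude k (fun t p v => cmod (rinv (M t p v))) (fun t p v => rinv (M t p v)).
Proof.
move=> cM cMt Ml.
have [r1 r2 r3] : [/\ forall t p, ccont (fun v => rinv (M t p v)),
    forall p v, cmeasurable (fun t : measurableTypeR R => rinv (M t p v)) &
    bounded_by (fun t p v => cmod (rinv (M t p v))) (fun t p v => rinv (M t p v))].
  split=> [t p|p v|]; first exact: (ccont_comp (cM t p) ccont_rinv).
    by apply: cmeasurable_contR; exact: (ccont_comp (cMt p v) ccont_rinv).
  by exists 1 => // t p v _; rewrite mul1r.
elim: k => [|k IH]; split=> // j; exists (fun t p v => Complex (c j) 0 *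
    (Complex 0 (-1) * (rinv (M t p v) * rinv (M t p v)))).
  move=> t p v; have [dr di] := is_derive_rinv (M t p v).
  have Ml' (r : R) : M t p (r *: delta_mx ord0 j + v) = (r * c j) *: (1 : R) + M t p v.
    by rewrite Ml scaler1.
  split.
    rewrite cReM (_ : complex.Im (Complex (c j) 0) = 0)// mul0r subr0.
    exact: (is_derive_along (f := fun t => complex.Re (rinv t)) Ml').
  rewrite cImM (_ : complex.Im (Complex (c j) 0) = 0)// mul0r addr0.
  exact: (is_derive_along (f := fun t => complex.Im (rinv t)) Ml').
rewrite (_ : (fun t p v => _) = fun t p v => Complex (c j) 0 * Complex 0 (-1) *
    (rinv (M t p v) * rinv (M t p v))); last by do 3 apply/funext => ?; rewrite mulrA.
apply: (@amplitude_le _ _ _ _ (fun t p v => 1 *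
    (cmod (rinv (M t p v)) * cmod (rinv (M t p v)))) _ _ 1) => //.
  by move=> t p v _; rewrite !mul1r ler_piMr ?cmod_ge0 ?cmod_rinv_le1.
apply: amplitudeM; last exact: amplitudeM.
apply: (@amplitude_cst _ _ _ _ (fun=> Complex (c j) 0 * Complex 0 (-1))).
  exact: (@cmeasurable_cst _ _ (measurableTypeR R)).
by exists (cmod (Complex (c j) 0 * Complex 0 (-1))) => //; exact: cmod_ge0.
Qed.

End resolvent.

(** * Weights *)

Section schwartz_bounds.
Context {R : realType} {n : nat}.

Lemma monomial_addsqr (beta : 'I_n -> nat) i (v : 'rV[R]_n) :
  monomial (fun j => (beta j + (j == i).*2)%N) v = v ord0 i ^+ 2 * monomial beta v.
Proof.
rewrite /monomial (bigD1 i)//= [in RHS](bigD1 i)//= eqxx exprD -mulrA mulrCA.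
congr (_ * (_ * _)).
by apply: eq_bigr => j /negPf ->; rewrite addn0.
Qed.

(** Expand one factor [1 + v_i^2] at a time: its second term raises the exponent of the monomial at
    [i] by 2. The statement is therefore proved for all [beta] at once. *)
Lemma schwartz_weight (h : 'rV[R]_n -> R) (s : seq 'I_n) :
  (forall v, 0 <= h v) ->
  (forall beta : 'I_n -> nat, exists C, forall v, `|monomial beta v| * h v <= C) ->
  forall beta : 'I_n -> nat, exists C, forall v : 'rV[R]_n,
    \prod_(i <- s) (1 + v ord0 i ^+ 2) * (`|monomial beta v| * h v) <= C.
Proof.
move=> h0 hb; elim: s => [|i s IH] beta.
  by have [C hC] := hb beta; exists C => v; rewrite big_nil mul1r.
have [C hC] := IH beta.
have [C' hC'] := IH (fun j => (beta j + (j == i).*2)%N).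
exists (C + C') => v; rewrite big_cons.
apply: le_trans (lerD (hC v) (hC' v)).
rewrite monomial_addsqr normrM ger0_norm ?sqr_ge0// le_eqVlt.
by apply/orP; left; apply/eqP; ring.
Qed.

Lemma schwartz_symbol_bounded (g : 'rV[R]_n -> R[i]) k : schwartz g ->
  symbol_bounded (fun v => ipw v ^+ k) g.
Proof.
move=> [sg hg]; apply: symbol_boundedP => // [v|alpha]; first by rewrite exprn_ge0 ?ipw_ge0.
(* Listing every coordinate [k] times turns the product into [pw v ^+ k]; the monomial is
   trivial. *)
have [C hC] := @schwartz_weight (fun v => cmod (cpartial alpha g v))
  (multi_dirs (fun=> k)) (fun v => cmod_ge0 _) (hg alpha) (fun=> 0%N).
exists C => v; have := hC v; rewrite prod_multi_dirs prodrXl -/(pw v).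
rewrite {1}/monomial; under eq_bigr do rewrite expr0.
rewrite big1_eq normr1 mul1r /ipw exprVn ler_pdivlMr ?exprn_gt0 ?pw_gt0//.
by rewrite mulrC.
Qed.

End schwartz_bounds.

(** * The Japanese bracket against P, and Peetre's inequality *)

Section japanese_bounds.
Context {R : realType} {n : nat}.
Implicit Types v w : 'rV[R]_n.

Let jj v : R := 1 + dotv v v.

Let dotv_ge0 v : 0 <= dotv v v.
Proof. by apply: sumr_ge0 => i _; rewrite -expr2 sqr_ge0. Qed.

Let jj_gt0 v : 0 < jj v.
Proof. by rewrite ltr_pwDl. Qed.

Lemma japanese_powR v (m : R) : japanese v `^ m = (1 + dotv v v) `^ (m / 2).
Proof. by rewrite mulrC powRrM powR12_sqrt; last exact: ltW (jj_gt0 v). Qed.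

Lemma dotv_le_pw v : 1 + dotv v v <= pw v.
Proof.
(* The induction also carries the nonnegativity of the partial sum, which makes the partial product
   at least 1. *)
rewrite /dotv /pw; apply: (@proj2 (0 <= \sum_i v ord0 i * v ord0 i)).
elim/big_rec2: _ => [|i y x _ [x0 xy]]; first by rewrite addr0.
rewrite -expr2; have s0 := sqr_ge0 (v ord0 i).
split; first exact: addr_ge0.
rewrite addrCA mulrDl mul1r addrC lerD// ler_peMr//.
by apply: le_trans xy; rewrite lerDl.
Qed.

Lemma japanese_powR_le v (s : R) (k : nat) : 0 <= s -> s <= k%:R ->
  japanese v `^ s <= pw v ^+ k.
Proof.
move=> s0 sk; rewrite japanese_powR -powR_mulrn ?pw_ge0//.
apply: (@le_trans _ _ (pw v `^ (s / 2))).
  by apply: ge0_ler_powR; rewrite ?nnegrE ?divr_ge0 ?pw_ge0 ?(ltW (jj_gt0 v)) ?dotv_le_pw.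
by apply: ler_powR; [exact: pw_ge1|rewrite ler_pdivrMr//; lra].
Qed.

Let jjD v w : jj (v + w) <= 2 * pw w * jj v.
Proof.
have h : jj (v + w) <= 2 * (jj v * jj w).
  have : dotv (v + w) (v + w) <= 2 * dotv v v + 2 * dotv w w.
    rewrite /dotv !mulr_sumr -big_split/=; apply: ler_sum => i _; rewrite mxE.
    have := sqr_ge0 (v ord0 i - w ord0 i); rewrite expr2; lra.
  have := mulr_ge0 (dotv_ge0 v) (dotv_ge0 w); rewrite /jj; lra.
apply: le_trans h _; rewrite -mulrA ler_wpM2l// mulrC.
by apply: ler_wpM2r; [exact: ltW (jj_gt0 v)|exact: dotv_le_pw].
Qed.

(* Peetre's inequality, with the polynomial weight [pw] on one side. *)
Lemma japanese_powR_peetre (m : R) : exists2 k : nat, `|m| <= k%:R & forall v w,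
  japanese (v + w) `^ m <= 2 ^+ k * (japanese v `^ m * pw w ^+ k).
Proof.
exists (Num.truncn `|m|).+1; first by rewrite ltW// truncnS_gt.
move=> v w; set k := (Num.truncn _).+1; rewrite !japanese_powR -!/(jj _).
have K1 : 1 <= 2 * pw w by rewrite -[leLHS]mulr1 ler_pM ?pw_ge1 ?ler1n.
have K0 : 0 < 2 * pw w by exact: lt_le_trans K1.
rewrite [leRHS]mulrCA -exprMn.
have Kk (e : R) : e <= `|m| / 2 -> (2 * pw w) `^ e <= (2 * pw w) ^+ k.
  move=> em; rewrite -powR_mulrn ?(ltW K0)//; apply: ler_powR => //.
  have : `|m| < k%:R by rewrite truncnS_gt.
  by have := normr_ge0 m; lra.
have [m0|m0] := leP 0 m.
  apply: (@le_trans _ _ ((2 * pw w * jj v) `^ (m / 2))).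
    apply: ge0_ler_powR;
      by rewrite ?nnegrE ?divr_ge0 ?mulr_ge0 ?pw_ge0 ?(ltW (jj_gt0 _)) ?jjD.
  rewrite powRM ?(ltW (jj_gt0 _)) ?(ltW K0)// mulrC ler_wpM2l ?powR_ge0// Kk//.
  by rewrite ger0_norm.
(* For negative [m] the comparison is used with [v] and [v + w] exchanged, [pw] being even. *)
have jj' : jj v <= 2 * pw w * jj (v + w).
  by have := jjD (v + w) (- w); rewrite addrK pwN.
have anti : (2 * pw w * jj (v + w)) `^ (m / 2) <= jj v `^ (m / 2).
  rewrite -[m / 2]opprK [leLHS]powRN [leRHS]powRN.
  rewrite lef_pV2 ?posrE ?powR_gt0 ?mulr_gt0 ?pw_gt0//.
  apply: ge0_ler_powR; rewrite ?nnegrE ?mulr_ge0 ?pw_ge0 ?(ltW (jj_gt0 _)) ?jj'//.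
  by rewrite oppr_ge0 pmulr_lle0 ?invr_gt0// ltW.
rewrite powRM ?(ltW (jj_gt0 _)) ?(ltW K0)// in anti.
apply: (@le_trans _ _ ((2 * pw w) `^ (- (m / 2)) * jj v `^ (m / 2))); last first.
  rewrite mulrC ler_wpM2l ?powR_ge0// Kk// ltr0_norm//.
  by rewrite mulNr.
by rewrite powRN ler_pdivlMl ?powR_gt0.
Qed.

End japanese_bounds.

(** * Weighted Lebesgue norms of powers of 1/P *)

Section weighted_norm.
Context {R : realType} {n : nat}.

Lemma powR_ipw_le (r : R) (k : nat) (v : 'rV[R]_n) : 1 <= k%:R * r ->
  0 <= r -> (ipw v ^+ k) `^ r <= ipw v.
Proof.
move=> kr r0; rewrite -powR_mulrn ?ipw_ge0// -powRrM /ipw -powR_inv1 ?pw_ge0//.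
rewrite -powRrM; apply: ler_powR; first exact: pw_ge1.
by rewrite mulN1r lerN2.
Qed.

(** Some [ks >= s] powers of [ipw] absorb the weight; for finite [q], at least 1/q further powers
    make the q-th power of the rest at most [ipw], which is integrable. The exponent is chosen
    before [C0] because the constant of the decay estimate depends on the exponent. *)
Lemma weighted_Lnorm_ipw (q : \bar R) (s : R) : (0 < q)%E -> 0 <= s ->
  exists k : nat, forall C0 : R, 0 <= C0 -> exists2 C : R, 0 < C &
    weighted_Lspace q s (fun w : 'rV[R]_n => C0 * ipw w ^+ k) /\
    (weighted_Lnorm q s (fun w : 'rV[R]_n => C0 * ipw w ^+ k)%R <= C%:E)%E.
Proof.
move=> q0 s0; pose ks := (Num.truncn s).+1.
have sks : s <= ks%:R by rewrite ltW// truncnS_gt.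
have mipw k : measurable_fun setT (fun w : 'rV[R]_n => ipw w ^+ k).
  apply: measurable_funX.
  by have := @measurable_ipw R n 0; under eq_fun do rewrite subr0.
have mH k C0 : measurable_fun setT (fun w : 'rV[R]_n => C0 * ipw w ^+ k).
  by apply: measurable_funM => //; exact: measurable_cst.
have mj : measurable_fun setT (fun w : 'rV[R]_n => japanese w `^ s).
  rewrite (_ : (fun w => _) = (fun w : 'rV[R]_n => (1 + dotv w w) `^ (s / 2))).
    apply: (measurableT_comp (measurable_powR _)); apply: continuous_measurable_rV => v.
    have Fv : Filter (nbhs v) by exact: nbhs_filter.
    apply: cvgD; first exact: cvg_cst.
    apply: cvg_big => [|i _]; first exact: add_continuous.
    by apply: cvgM; exact: coord_continuous.
  by apply/funext => w; rewrite japanese_powR.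
have bnd k C0 (w : 'rV[R]_n) : 0 <= C0 ->
    `|C0 * ipw w ^+ (k + ks) * japanese w `^ s| <= C0 * ipw w ^+ k.
  move=> C00; rewrite ger0_norm ?mulr_ge0 ?exprn_ge0 ?ipw_ge0 ?powR_ge0//.
  rewrite -mulrA ler_wpM2l// exprD -mulrA ler_piMr ?exprn_ge0 ?ipw_ge0//.
  rewrite {1}/ipw exprVn mulrC ler_pdivrMr ?exprn_gt0 ?pw_gt0// mul1r.
  exact: japanese_powR_le.
suff [k h] : exists k : nat, forall C0 : R, 0 <= C0 -> exists2 C : R, 0 < C &
    (weighted_Lnorm q s (fun w : 'rV[R]_n => C0 * ipw w ^+ (k + ks)%N)%R <= C%:E)%E.
  exists (k + ks)%N => C0 /h[C C_gt0 hC]; exists C => //; split=> //; split=> //.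
  exact: le_lt_trans (ltry C).
case: q q0 => [r r0| |//].
  rewrite lte_fin in r0.
  pose k := (Num.truncn r^-1).+1.
  have kr : 1 <= k%:R * r by rewrite -ler_pdivrMr// div1r ltW// truncnS_gt.
  exists k => C0 C00.
  pose D : R := C0 `^ r * pi ^+ n.
  (* The summand 1 makes the constant positive even for [C0 = 0]. *)
  exists (1 + D `^ r^-1); first by rewrite ltr_pwDl ?powR_ge0.
  rewrite /weighted_Lnorm unlock.
  have D0 : 0 <= D by rewrite mulr_ge0 ?powR_ge0 ?exprn_ge0 ?pi_ge0.
  apply: (@le_trans _ _ (D%:E `^ r^-1)%E); last first.
    by rewrite poweR_EFin lee_fin lerDr.
  apply: gt0_ler_poweR; rewrite ?invr_ge0 ?(ltW r0)//.
  - by rewrite in_itv/= leey andbT integral_ge0// => w _; exact: poweR_ge0.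
  - by rewrite in_itv/= leey andbT lee_fin.
  rewrite /D EFinM; apply: (@le_trans _ _ ((C0 `^ r)%:E *
      \int[lebesgue_rV n]_v (ipw (v - 0))%:E)%E); last first.
    by apply: lee_wpmul2l; [rewrite lee_fin powR_ge0|exact: integral_ipw_le].
  rewrite -ge0_integralZl//; last 3 first.
  - by apply/measurable_EFinP; exact: measurable_ipw.
  - by move=> w _; rewrite lee_fin ipw_ge0.
  - by rewrite lee_fin powR_ge0.
  apply: ge0_le_integral => //.
  - by move=> w _; exact: poweR_ge0.
  - apply: (measurableT_comp (measurable_poweR _)); apply: measurableT_comp => //.
    by apply/measurable_EFinP; exact: measurable_funM.
  - apply: emeasurable_funM => //.
    by apply/measurable_EFinP; exact: measurable_ipw.
  move=> w _; rewrite subr0 -EFinM [X in (X `^ _)%E]/= poweR_EFin lee_fin.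
  apply: (@le_trans _ _ ((C0 * ipw w ^+ k) `^ r)).
    by apply: ge0_ler_powR; rewrite ?nnegrE ?(ltW r0) ?mulr_ge0 ?exprn_ge0 ?ipw_ge0 ?bnd.
  rewrite powRM ?exprn_ge0 ?ipw_ge0// ler_wpM2l ?powR_ge0//.
  by rewrite powR_ipw_le// (ltW r0).
(* For infinite [q] the powers that absorb the weight already give boundedness. *)
exists 0%N => C0 C00; exists (1 + C0); first by rewrite ltr_pwDl.
rewrite /weighted_Lnorm unlock; case: ifP => _; last by rewrite lee_fin addr_ge0.
apply/ess_supP; apply: aeW => w /=; rewrite lee_fin.
by apply: le_trans (bnd 0%N C0 w C00) _; rewrite expr0 mulr1 lerDr.
Qed.

End weighted_norm.

(** * The oscillatory integral of the matrix element *)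

Section phase_space.
Context {R : realType} {d : nat}.
Local Notation rVN := 'rV[R]_(d + (d + d)).
Local Notation par := ('rV[R]_(d + d) * 'rV[R]_(d + d))%type.
Implicit Types (t : R) (p : par) (V : rVN).

(* Points [V = row_mx y (row_mx x omega)] collect the integration variable [y] of the
   Wigner distribution and the phase space variables; [p = (u, z)]. *)
Definition arg1 t p V : 'rV[R]_d := lsubmx (rsubmx V) + t *: lsubmx V - lsubmx p.1.

Definition arg2 t p V : 'rV[R]_d :=
  lsubmx (rsubmx V) - (1 - t) *: lsubmx V - lsubmx p.2.

(** In [(1 - t) *: arg1 + t *: arg2] the variable y cancels and [x - centre1] remains; [centre2] is
    the value of omega at which the phase is stationary in y. Note the exchange of the weights t and
    1 - t between the two. *)
Definition centre1 t p : 'rV[R]_d := (1 - t) *: lsubmx p.1 + t *: lsubmx p.2.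

Definition centre2 t p : 'rV[R]_d := t *: rsubmx p.1 + (1 - t) *: rsubmx p.2.

Definition freq (j : 'I_d) t p V : R :=
  2 * pi * (rsubmx (rsubmx V) ord0 j - centre2 t p ord0 j).

Definition phase t p V : R :=
  2 * pi * (dotv (lsubmx V) (rsubmx (rsubmx V) - centre2 t p)
            - dotv (rsubmx (p.1 - p.2)) (lsubmx (rsubmx V))).

(** Moving [V] along coordinate [i] moves the arguments of g along coordinate [fold_idx i] at speed
    [coef a i], where [a] is t for [arg1] and -(1 - t) for [arg2]: speed [a] for a coordinate of y,
    1 for x and 0 for omega. In the last case the index is a dummy. *)
Definition fold_idx (i : 'I_(d + (d + d))) : 'I_d :=
  match fintype.split i with
  | inl j => j
  | inr k => match fintype.split k with inl j => j | inr j => j end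
  end.

Definition coef (a : R) (i : 'I_(d + (d + d))) : R :=
  match fintype.split i with
  | inl _ => a
  | inr k => match fintype.split k with inl _ => 1 | inr _ => 0 end
  end.

Lemma arg_delta (i : 'I_(d + (d + d))) (a : R) :
  lsubmx (rsubmx (delta_mx ord0 i : rVN)) + a *: lsubmx (delta_mx ord0 i : rVN) =
  coef a i *: delta_mx ord0 (fold_idx i) :> 'rV[R]_d.
Proof.
rewrite /coef /fold_idx; case: split_ordP => [j ->|k ->].
  by rewrite delta_mx_lshift row_mxKr row_mxKl linear0 add0r.
rewrite delta_mx_rshift row_mxKr row_mxKl scaler0 addr0.
case: split_ordP => j ->.
  by rewrite delta_mx_lshift row_mxKl scale1r.
by rewrite delta_mx_rshift row_mxKl scale0r.
Qed.

Lemma arg1_line t p i V r : arg1 t p (r *: delta_mx ord0 i + V) =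
  (r * coef t i) *: delta_mx ord0 (fold_idx i) + arg1 t p V.
Proof.
by rewrite -scalerA -arg_delta; apply/rowP => j; rewrite !mxE; ring.
Qed.

Lemma arg2_line t p i V r : arg2 t p (r *: delta_mx ord0 i + V) =
  (r * coef (- (1 - t)) i) *: delta_mx ord0 (fold_idx i) + arg2 t p V.
Proof.
by rewrite -scalerA -arg_delta; apply/rowP => j; rewrite !mxE; ring.
Qed.

Lemma continuous_arg1 t p : continuous (arg1 t p).
Proof.
apply: continuous_mx => i j; under eq_fun do rewrite !mxE.
move=> V; have FV : Filter (nbhs V) by exact: nbhs_filter.
apply: cvgB; last exact: cvg_cst.
apply: cvgD; first exact: coord_continuous.
by apply: cvgM; [exact: cvg_cst|exact: coord_continuous].
Qed.

Lemma continuous_arg2 t p : continuous (arg2 t p).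
Proof.
apply: continuous_mx => i j; under eq_fun do rewrite !mxE.
move=> V; have FV : Filter (nbhs V) by exact: nbhs_filter.
apply: cvgB; last exact: cvg_cst.
apply: cvgB; first exact: coord_continuous.
by apply: cvgM; [exact: cvg_cst|exact: coord_continuous].
Qed.

Lemma continuous_arg1_time p V : continuous (fun t => arg1 t p V).
Proof.
apply: continuous_mx => i j; under eq_fun do rewrite !mxE.
move=> t; apply: cvgB; last exact: cvg_cst.
apply: cvgD; first exact: cvg_cst.
by apply: cvgM; [exact: cvg_id|exact: cvg_cst].
Qed.

Lemma continuous_arg2_time p V : continuous (fun t => arg2 t p V).
Proof.
apply: continuous_mx => i j; under eq_fun do rewrite !mxE.
move=> t; apply: cvgB; last exact: cvg_cst.
apply: cvgB; first exact: cvg_cst.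
apply: cvgM; last exact: cvg_cst.
by apply: cvgB; [exact: cvg_cst|exact: cvg_id].
Qed.

Lemma continuous_rsubmx : continuous (fun V : rVN => rsubmx V).
Proof.
by apply: continuous_mx => i j; under eq_fun do rewrite !mxE; exact: coord_continuous.
Qed.

Lemma continuous_freq j t p : continuous (freq j t p).
Proof.
rewrite /freq; under eq_fun do rewrite 2!mxE.
move=> V; have FV : Filter (nbhs V) by exact: nbhs_filter.
apply: cvgM; first exact: cvg_cst.
by apply: cvgB; [exact: coord_continuous|exact: cvg_cst].
Qed.

Lemma continuous_centre2 p j : continuous (fun t => centre2 t p ord0 j).
Proof.
under eq_fun do rewrite !mxE.
move=> t; apply: cvgD; apply: cvgM; try exact: cvg_cst; first exact: cvg_id.
by apply: cvgB; [exact: cvg_cst|exact: cvg_id].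
Qed.

Lemma continuous_freq_time j p V : continuous (fun t => freq j t p V).
Proof.
move=> t; apply: cvgM; first exact: cvg_cst.
by apply: cvgB; [exact: cvg_cst|exact: continuous_centre2].
Qed.

Lemma freq_line j t p i V r : freq j t p (r *: delta_mx ord0 i + V) =
  r * (2 * pi * rsubmx (rsubmx (delta_mx ord0 i : rVN)) ord0 j) + freq j t p V.
Proof. by rewrite /freq !linearD !linearZ/= 2!mxE; ring. Qed.

Lemma continuous_dotv_comp (T : topologicalType) n (f h : T -> 'rV[R]_n) :
  continuous f -> continuous h -> continuous (fun x => dotv (f x) (h x)).
Proof.
move=> cf ch x; have Fx : Filter (nbhs x) by exact: nbhs_filter.
apply: cvg_big => [|i _]; first exact: add_continuous.
apply: cvgM.
  exact: (cvg_comp f (fun v => v ord0 i) (cf x) (@coord_continuous R 1 n ord0 i _)).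
exact: (cvg_comp h (fun v => v ord0 i) (ch x) (@coord_continuous R 1 n ord0 i _)).
Qed.

Lemma continuous_phase t p : continuous (phase t p).
Proof.
have c1 : continuous (fun V : rVN =>
    dotv (lsubmx V) (rsubmx (rsubmx V) - centre2 t p)).
  apply: continuous_dotv_comp; apply: continuous_mx => i j.
    by under eq_fun do rewrite mxE; exact: coord_continuous.
  under eq_fun do rewrite !mxE; move=> W.
  have FW : Filter (nbhs W) by exact: nbhs_filter.
  by apply: cvgB; [exact: coord_continuous|exact: cvg_cst].
have c2 : continuous (fun V : rVN =>
    dotv (rsubmx (p.1 - p.2)) (lsubmx (rsubmx V))).
  apply: continuous_dotv_comp; first exact: cst_continuous.
  apply: continuous_mx => i j.
  by under eq_fun do rewrite !mxE; exact: coord_continuous.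
move=> V; have FV : Filter (nbhs V) by exact: nbhs_filter.
by apply: cvgM; [exact: cvg_cst|apply: cvgB; [exact: c1|exact: c2]].
Qed.

Lemma continuous_phase_time p V : continuous (fun t => phase t p V).
Proof.
have c1 : continuous (fun t => dotv (lsubmx V) (rsubmx (rsubmx V) - centre2 t p)).
  apply: continuous_dotv_comp; first exact: cst_continuous.
  apply: continuous_mx => i j; rewrite (ord1 i).
  under eq_fun do rewrite 2!mxE [(- centre2 _ _) _ _]mxE.
  by move=> r; apply: cvgB; [exact: cvg_cst|exact: continuous_centre2].
move=> t; apply: cvgM; first exact: cvg_cst.
by apply: cvgB; [exact: c1|exact: cvg_cst].
Qed.

(** The phase is affine in y for fixed (x, omega), and affine in (x, omega) for fixed y by
    [phaseE_right]: the two shapes that [amplitude_parts] accepts. *)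
Lemma phaseE_left t p (y : 'rV[R]_d) (zeta : 'rV[R]_(d + d)) :
  phase t p (row_mx y zeta) =
  dotv ((2 * pi) *: (rsubmx zeta - centre2 t p)) y +
  - (2 * pi * dotv (rsubmx (p.1 - p.2)) (lsubmx zeta)).
Proof.
by rewrite /phase row_mxKl row_mxKr dotvZl [dotv y _]dotvC mulrBr.
Qed.

Lemma dotv_row_mx m n (a b : 'rV[R]_m) (a' b' : 'rV[R]_n) :
  dotv (row_mx a a') (row_mx b b') = dotv a b + dotv a' b'.
Proof.
rewrite /dotv big_split_ord/=; congr (_ + _); apply: eq_bigr => i _.
  by rewrite !row_mxEl.
by rewrite !row_mxEr.
Qed.

Lemma phaseE_right t p (y : 'rV[R]_d) (zeta : 'rV[R]_(d + d)) :
  phase t p (row_mx y zeta) =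
  dotv (row_mx (- (2 * pi) *: rsubmx (p.1 - p.2)) ((2 * pi) *: y)) zeta +
  - (2 * pi * dotv y (centre2 t p)).
Proof.
rewrite /phase row_mxKl row_mxKr -[zeta in RHS]hsubmxK dotv_row_mx !dotvZl.
by rewrite dotvDr -scaleN1r dotvZr; ring.
Qed.

Lemma amplitude_ambiguity (g : 'rV[R]_d -> R[i]) k M : schwartz g ->
  amplitude k (fun t p V => ipw (arg1 t p V) ^+ M * ipw (arg2 t p V) ^+ M)
    (fun t p V => (g (arg1 t p V))^*%C * g (arg2 t p V)).
Proof.
move=> sg; have bg := schwartz_symbol_bounded M sg.
apply: amplitudeM.
- apply: amplitudeJ.
  apply: (@amplitude_pullback R d k _ par _ _ arg1 fold_idx coef bg
    continuous_arg1 continuous_arg1_time).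
  + by move=> j; rewrite /coef; case: fintype.split => [_|l t]; [move=> t; exact: cvg_id|
      case: fintype.split => _; exact: cvg_cst].
  + move=> t j /andP[t0 t1]; rewrite /coef.
    case: fintype.split => [_|l]; first by rewrite ger0_norm.
    by case: fintype.split => _; rewrite ?normr1 ?normr0.
  + by move=> t p j V r; exact: arg1_line.
- apply: (@amplitude_pullback R d k _ par _ _ arg2 fold_idx
    (fun t => coef (- (1 - t))) bg continuous_arg2 continuous_arg2_time).
  + move=> j; rewrite /coef; case: fintype.split => [_|l] t.
      by apply: cvgN; apply: cvgB; [exact: cvg_cst|exact: cvg_id].
    by case: fintype.split => _; exact: cvg_cst.
  + move=> t j /andP[t0 t1]; rewrite /coef; case: fintype.split => [_|l].
      by rewrite normrN ger0_norm ?subr_ge0// gerBl.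
    by case: fintype.split => _; rewrite ?normr1 ?normr0.
  + by move=> t p j V r; exact: arg2_line.
Qed.

Lemma amplitude_symbol (sigma : 'rV[R]_(d + d) -> R[i]) (m : R) k :
  symbol_class m sigma ->
  amplitude k (fun t (p : par) V => japanese (rsubmx V) `^ m) (fun t p V => sigma (rsubmx V)).
Proof.
move=> [ss hs].
have bs : symbol_bounded (fun v => japanese v `^ m) sigma.
  by apply: symbol_boundedP => // v; exact: powR_ge0.
pose q (i : 'I_(d + (d + d))) :=
  match fintype.split i with inl j => lshift d j | inr k => k end.
pose c (_ : R) (i : 'I_(d + (d + d))) : R :=
  match fintype.split i with inl j => 0 | inr k => 1 end.
apply: (@amplitude_pullback _ _ k _ par _ _ (fun _ _ V => rsubmx V) q c bs).
- by move=> t p; exact: continuous_rsubmx.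
- by move=> p V; exact: cst_continuous.
- by move=> j; exact: cst_continuous.
- by move=> t j _; rewrite /c; case: fintype.split => _; rewrite ?normr1 ?normr0.
move=> t p j V r; rewrite linearD linearZ/= /c /q.
case: split_ordP => [l ->|l ->].
  by rewrite delta_mx_lshift row_mxKr mulr0 !scale0r scaler0.
by rewrite delta_mx_rshift row_mxKr mulr1.
Qed.

(** The factors gained from the y-integration depend on omega, so the later integrations by parts in
    (x, omega) differentiate them; their decay must survive this. *)
Lemma amplitude_freq k (s : seq 'I_d) :
  amplitude k (fun t p V => \prod_(j <- s) cmod (rinv (freq j t p V)))
    (fun t p V => \prod_(j <- s) rinv (freq j t p V)).
Proof.
apply: amplitude_prod => j.
apply: (amplitude_rinv k (c := fun i =>
    2 * pi * rsubmx (rsubmx (delta_mx ord0 i : rVN)) ord0 j)).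
- exact: continuous_freq.
- exact: continuous_freq_time.
- by move=> *; exact: freq_line.
Qed.

End phase_space.

(** * Weight inequalities on phase space *)

Section weight_bounds.
Context {R : realType}.

Lemma pwZ_le n (r : R) (v : 'rV[R]_n) : 0 <= r <= 1 -> pw (r *: v) <= pw v.
Proof.
move=> /andP[r0 r1]; apply: ler_prod => i _; rewrite addr_ge0 ?sqr_ge0//= mxE lerD2l.
by rewrite exprMn ler_piMl ?sqr_ge0// exprn_ile1.
Qed.

Lemma ipw_shift n (v a : 'rV[R]_n) : ipw (v - a) <= 2 ^+ n * pw a * ipw v.
Proof.
rewrite /ipw -[leLHS]div1r ler_pdivrMr ?pw_gt0// mulrAC ler_pdivlMr ?pw_gt0// mul1r.
by have := pwD (v - a) a; rewrite subrK -mulrA [pw a * _]mulrC.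
Qed.

Lemma ipw_row_mx m n (v : 'rV[R]_m) (w : 'rV[R]_n) :
  ipw (row_mx v w) = ipw v * ipw w.
Proof. by rewrite /ipw pw_row_mx invfM. Qed.

Lemma ipw_le1 n (v : 'rV[R]_n) : ipw v <= 1.
Proof. by rewrite invf_le1 ?pw_gt0 ?pw_ge1. Qed.

Lemma ipwE n (v : 'rV[R]_n) : ipw v = \prod_i kappa (v ord0 i).
Proof. by rewrite /ipw /pw -prodfV. Qed.

Lemma kappaZ_le (a t : R) : 1 <= a -> kappa (a * t) <= kappa t.
Proof.
move=> a1; rewrite /kappa lef_pV2 ?posrE ?ltr_pwDl ?sqr_ge0// lerD2l exprMn.
by rewrite ler_peMl ?sqr_ge0// exprn_ege1.
Qed.

Lemma two_pi_ge1 : 1 <= 2 * pi :> R.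
Proof. have := @pi_ge2 R; lra. Qed.

Lemma ipwZ_le n (v : 'rV[R]_n) : ipw ((2 * pi) *: v) <= ipw v.
Proof.
rewrite !ipwE; apply: ler_prod => i _; rewrite kappa_ge0/= mxE.
exact/kappaZ_le/two_pi_ge1.
Qed.

Lemma prod_Complex1_sqr n (c : 'rV[R]_n) k :
  cmod (\prod_(j <- multi_dirs (fun=> (2 * k)%N)) Complex 1 (c ord0 j)) = pw c ^+ k.
Proof.
rewrite prod_multi_dirs cmod_prod /pw -prodrXl; apply: eq_bigr => j _.
by rewrite exprM !cmodX cmod_Complex1_sqr.
Qed.

Context {d : nat}.
Local Notation par := ('rV[R]_(d + d) * 'rV[R]_(d + d))%type.

Lemma prod_freq_le k t (p : par) (V : 'rV[R]_(d + (d + d))) :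
  \prod_(j <- multi_dirs (fun=> (2 * k)%N)) cmod (rinv (freq j t p V)) <=
  ipw (rsubmx (rsubmx V) - centre2 t p) ^+ k.
Proof.
rewrite prod_multi_dirs ipwE -prodrXl; apply: ler_prod => j _.
rewrite exprn_ge0 ?cmod_ge0//= exprM cmod_rinv_sqr lerXn2r ?nnegrE ?kappa_ge0//.
rewrite /freq [(rsubmx (rsubmx V) - _) _ _]mxE [(- centre2 _ _) _ _]mxE.
exact/kappaZ_le/two_pi_ge1.
Qed.

Lemma centre_arg t (p : par) V :
  lsubmx (rsubmx V) - centre1 t p = (1 - t) *: arg1 t p V + t *: arg2 t p V.
Proof. by apply/rowP => j; rewrite !mxE; ring. Qed.

Lemma diff_arg t (p : par) V :
  lsubmx V - lsubmx (p.1 - p.2) = arg1 t p V - arg2 t p V.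
Proof. by apply/rowP => j; rewrite !mxE; ring. Qed.

Definition centre t (p : par) : 'rV[R]_(d + d) := row_mx (centre1 t p) (centre2 t p).

Lemma sub_centre t (p : par) (V : 'rV[R]_(d + (d + d))) : rsubmx V - centre t p =
  row_mx (lsubmx (rsubmx V) - centre1 t p) (rsubmx (rsubmx V) - centre2 t p).
Proof.
rewrite /centre -[rsubmx V in LHS]hsubmxK.
by rewrite (opp_row_mx (centre1 t p)) add_row_mx.
Qed.

(** [centre t p - z] is [u - z] with its two blocks scaled by [1 - t] and [t]. *)
Lemma pw_centre_sub t (p : par) : 0 <= t <= 1 -> pw (centre t p - p.2) <= pw (p.1 - p.2).
Proof.
move=> t01; have -> : centre t p - p.2 =
    row_mx ((1 - t) *: lsubmx (p.1 - p.2)) (t *: rsubmx (p.1 - p.2)).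
  rewrite /centre -[p.2 in LHS]hsubmxK (opp_row_mx (lsubmx p.2)) add_row_mx.
  by congr row_mx; apply/rowP => j; rewrite !mxE; ring.
rewrite -[leRHS](congr1 (@pw R (d + d)) (hsubmxK _)) !pw_row_mx.
apply: ler_pM; rewrite ?pw_ge0 ?pwZ_le//.
by move: t01 => /andP[? ?]; rewrite subr_ge0 gerBl; apply/andP.
Qed.

Lemma pw_centre_arg_le t (p : par) V : 0 <= t <= 1 ->
  pw (lsubmx (rsubmx V) - centre1 t p) <=
  2 ^+ d * (pw (arg1 t p V) * pw (arg2 t p V)).
Proof.
move=> t01; rewrite centre_arg; apply: le_trans (pwD _ _) _.
rewrite ler_wpM2l ?exprn_ge0// ler_pM ?pw_ge0 ?pwZ_le//.
by move: t01 => /andP[? ?]; rewrite subr_ge0 gerBl; apply/andP.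
Qed.

Lemma pw_diff_arg_le t (p : par) V :
  pw (lsubmx V - lsubmx (p.1 - p.2)) <=
  2 ^+ d * (pw (arg1 t p V) * pw (arg2 t p V)).
Proof. by rewrite (diff_arg t); apply: le_trans (pwD _ _) _; rewrite pwN. Qed.

(** Here [x], [o], [w], [e], [a], [b] stand for P at x - centre1, omega - centre2, u - z, y - w1 and
    the two arguments of g; [D] is 2^d, [jap] and [jz] are the Japanese powers at (x, omega) and z,
    and [pr] is the frequency product. Peetre costs [k] powers of each of [x], [o], [w]. The
    frequency product repays [o] and the first [k.+1] powers of [a b] repay [x], both with one power
    to spare; the other [N] powers become decay in [e]. *)
Let combine (k N : nat) (x o w e a b D jap jz pr : R) :
  0 < x -> 0 < o -> 0 < w -> 0 < e -> 0 < a -> 0 < b -> 0 < D -> 0 <= jap ->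
  0 <= jz -> 0 <= pr ->
  x <= D * (a * b) -> e <= D * (a * b) ->
  jap <= 2 ^+ k * (jz * (D ^+ 2 * (x * o * w)) ^+ k) -> pr <= o^-1 ^+ k.+1 ->
  jap * pr * (a^-1 ^+ (k.+1 + N) * b^-1 ^+ (k.+1 + N)) <=
  2 ^+ k * (D ^+ 2) ^+ k * D ^+ (k.+1 + N) *
    (jz * w ^+ k * e^-1 ^+ N * (x^-1 * o^-1)).
Proof.
move=> x0 o0 w0 e0 a0 b0 D0 jap0 jz0 pr0 xab eab hj hp.
have inv_le y : 0 < y -> y <= D * (a * b) -> a^-1 * b^-1 <= D * y^-1.
  move=> y0 h; rewrite -invfM -[leLHS]div1r ler_pdivrMr ?mulr_gt0// mulrAC.
  by rewrite ler_pdivlMr// mul1r.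
have ab0 : 0 <= a^-1 * b^-1 by rewrite mulr_ge0 ?invr_ge0 ?ltW.
have h1 : (a^-1 * b^-1) ^+ k.+1 <= (D * x^-1) ^+ k.+1.
  by rewrite lerXn2r ?nnegrE ?inv_le// mulr_ge0 ?invr_ge0 ?(ltW D0) ?(ltW x0).
have h2 : (a^-1 * b^-1) ^+ N <= (D * e^-1) ^+ N.
  by rewrite lerXn2r ?nnegrE ?inv_le// mulr_ge0 ?invr_ge0 ?(ltW D0) ?(ltW e0).
apply: (@le_trans _ _ (2 ^+ k * (jz * (D ^+ 2 * (x * o * w)) ^+ k) * o^-1 ^+ k.+1 *
    ((D * x^-1) ^+ k.+1 * (D * e^-1) ^+ N))).
  rewrite -exprMn exprD; apply: ler_pM; rewrite ?mulr_ge0 ?exprn_ge0//.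
    exact: ler_pM.
  by apply: ler_pM; rewrite ?exprn_ge0.
rewrite !exprMn exprD !exprS le_eqVlt; apply/orP; left; apply/eqP.
have xx : x ^+ k * x^-1 ^+ k = 1 by rewrite -exprMn divff ?expr1n ?gt_eqF.
have oo : o ^+ k * o^-1 ^+ k = 1 by rewrite -exprMn divff ?expr1n ?gt_eqF.
transitivity (2 ^+ k * (D * D) ^+ k * (D * D ^+ k * D ^+ N) *
  (jz * w ^+ k * e^-1 ^+ N * (x^-1 * o^-1)) *
  (x ^+ k * x^-1 ^+ k) * (o ^+ k * o^-1 ^+ k)).
  by rewrite !exprMn ?expr0; ring.
by rewrite xx oo !mulr1 ?expr0 ?exprMn; ring.
Qed.

(** [k] depends only on [m] and the dimension. It must precede [N], since the decay required later
    includes [k] powers that compensate [pw (u - z) ^+ k]. The last factor on the right is the spare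
    power that makes the (x, omega)-integral converge. *)
Lemma weight_bound (m : R) : exists k : nat, forall N : nat,
  exists2 C : R, 0 <= C & forall t (p : par) V, 0 <= t <= 1 ->
  japanese (rsubmx V) `^ m *
    \prod_(j <- multi_dirs (fun=> (2 * k.+1)%N)) cmod (rinv (freq j t p V)) *
    (ipw (arg1 t p V) ^+ (k.+1 + N) * ipw (arg2 t p V) ^+ (k.+1 + N)) <=
  C * (japanese p.2 `^ m * pw (p.1 - p.2) ^+ k *
       ipw (lsubmx V - lsubmx (p.1 - p.2)) ^+ N * ipw (rsubmx V - centre t p)).
Proof.
have [k _ peetre] := @japanese_powR_peetre R (d + d) m.
exists k => N; exists (2 ^+ k * ((2 ^+ d) ^+ 2) ^+ k * (2 ^+ d) ^+ (k.+1 + N)).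
  by rewrite !mulr_ge0 ?exprn_ge0.
move=> t p V t01; rewrite sub_centre ipw_row_mx.
apply: combine; rewrite ?pw_gt0 ?exprn_gt0 ?powR_ge0 ?prodr_ge0 ?pw_centre_arg_le
  ?pw_diff_arg_le//.
- by move=> j _; exact: cmod_ge0.
- have := peetre p.2 (rsubmx V - p.2); rewrite addrC subrK => h.
  apply: le_trans h _; rewrite ler_wpM2l ?exprn_ge0// ler_wpM2l ?powR_ge0//.
  rewrite lerXn2r ?nnegrE ?pw_ge0 ?mulr_ge0 ?exprn_ge0 ?pw_ge0//.
  rewrite -pw_row_mx -sub_centre.
  (* The difference (x, omega) - z is split at [centre]: the distance to [centre] is paid for by
     decay, and that from [centre] to z has weight at most P(u - z). *)
  rewrite -[X in pw (X - p.2)](subrK (centre t p)) -addrA.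
  apply: le_trans (pwD _ _) _; rewrite exprD -expr2 ler_wpM2l ?exprn_ge0//.
  by rewrite ler_wpM2l ?pw_ge0// pw_centre_sub.
- exact: prod_freq_le.
Qed.

(** The difference of the two arguments gives decay in y - w1, recentred at y. The constant depends
    on [p]: this bound secures integrability in y and stays out of the final estimate. *)
Lemma ambiguity_weight_le t (p : par) (y : 'rV[R]_d) zeta k :
  ipw (arg1 t p (row_mx y zeta)) ^+ k.+1 * ipw (arg2 t p (row_mx y zeta)) ^+ k.+1 <=
  2 ^+ d * (2 ^+ d * pw (lsubmx (p.1 - p.2))) * ipw y.
Proof.
rewrite -exprMn exprS.
have h := pw_diff_arg_le t p (row_mx y zeta); rewrite row_mxKl in h.
have a0 := ipw_ge0 (arg1 t p (row_mx y zeta)).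
have b0 := ipw_ge0 (arg2 t p (row_mx y zeta)).
apply: (@le_trans _ _ (ipw (arg1 t p (row_mx y zeta)) * ipw (arg2 t p (row_mx y zeta)))).
  by rewrite ler_piMr ?mulr_ge0// exprn_ile1 ?mulr_ge0// mulr_ile1 ?ipw_le1.
apply: (@le_trans _ _ (2 ^+ d * ipw (y - lsubmx (p.1 - p.2)))).
  rewrite {1 2 3}/ipw -invfM -[leLHS]div1r ler_pdivrMr ?mulr_gt0 ?pw_gt0// mulrAC.
  by rewrite ler_pdivlMr ?pw_gt0// mul1r.
by rewrite -mulrA ler_wpM2l ?exprn_ge0// ipw_shift.
Qed.

Lemma pw_centre_le t (p : par) : 0 <= t <= 1 -> pw (centre t p) <=
  2 ^+ (d + d) * (pw p.2 * pw (p.1 - p.2)).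
Proof.
move=> t01; rewrite -[centre t p](subrK p.2) addrC; apply: le_trans (pwD _ _) _.
by rewrite ler_wpM2l ?exprn_ge0// ler_wpM2l ?pw_ge0// pw_centre_sub.
Qed.

End weight_bounds.

(** * Conjugation and Fubini for complex integrals *)

Section complex_fubini.
Context {R : realType}.

(** Valid even if the positive or the negative part has infinite integral, because [fine] sends both
    infinities to 0; so conjugation commutes with [cintegral] unconditionally. *)
Lemma RintegralN d (T : measurableType d) (mu : {measure set T -> \bar R}) D (f : T -> R) :
  \int[mu]_(x in D) - f x = - \int[mu]_(x in D) f x.
Proof.
rewrite /Rintegral (integralE mu D (fun x => (f x)%:E)).
rewrite (_ : (fun x => (- f x)%:E) = (\- (EFin \o f))%E)//.
rewrite integralE funeposN funenegN.
have := integral_ge0 mu (fun x (_ : D x) => funepos_ge0 (EFin \o f) x).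
have := integral_ge0 mu (fun x (_ : D x) => funeneg_ge0 (EFin \o f) x).
rewrite -/(EFin \o f).
case: (\int[mu]_(x in D) _)%E => [a| |//] _;
  case: (\int[mu]_(x in D) _)%E => [b| |//] _ //=;
  by rewrite ?oppr0// opprB.
Qed.

Lemma conj_cintegral d (T : measurableType d) (mu : {measure set T -> \bar R}) D
    (f : T -> R[i]) :
  (cintegral mu D f)^*%C = cintegral mu D (fun x => (f x)^*%C).
Proof.
rewrite /cintegral; apply: complex_ext => /=.
  by apply: eq_Rintegral => x _; rewrite cReJ.
by rewrite -RintegralN; apply: eq_Rintegral => x _; rewrite cImJ.
Qed.

(** Turns the tau-integral over [0, 1] into one over the line, in the form the Fubini lemmas
    require. *)
Lemma cintegral_mkcond d (T : measurableType d) (mu : {measure set T -> \bar R}) D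
    (f : T -> R[i]) :
  cintegral mu D f = cintegral mu setT (fun x => Complex (\1_D x) 0 * f x).
Proof.
rewrite /cintegral; apply: complex_ext => /=; rewrite Rintegral_mkcond;
  apply: eq_Rintegral => x _; rewrite patchE indicE (cReM, cImM)/=;
  by case: ifP => _; rewrite ?mul1r ?mul0r ?subr0 ?addr0.
Qed.

Lemma cintegral_eq0 d (T : measurableType d) (mu : {measure set T -> \bar R}) D
    (f : T -> R[i]) : (forall x, f x = 0) -> cintegral mu D f = 0.
Proof.
by move=> f0; rewrite /cintegral; apply: complex_ext => /=;
  rewrite /Rintegral integral0_eq// => x _; rewrite f0.
Qed.

Lemma cmeasurable_comp d1 d2 (T1 : measurableType d1) (T2 : measurableType d2)
    (f : T2 -> R[i]) (h : T1 -> T2) :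
  cmeasurable f -> measurable_fun setT h -> cmeasurable (fun x => f (h x)).
Proof.
move=> [fr fi] mh; split.
  exact: (measurableT_comp fr mh).
exact: (measurableT_comp fi mh).
Qed.

Lemma cmeasurable_cintegral d1 d2 (T1 : measurableType d1) (T2 : measurableType d2)
    (m2 : {sigma_finite_measure set T2 -> \bar R}) (f : T1 -> T2 -> R[i]) :
  cmeasurable (fun z : T1 * T2 => f z.1 z.2) ->
  cmeasurable (fun x => cintegral m2 setT (f x)).
Proof.
move=> [fr fi]; split.
  exact: (measurable_Rintegral m2 fr).
exact: (measurable_Rintegral m2 fi).
Qed.

Lemma cintegral_swap d1 d2 (T1 : measurableType d1) (T2 : measurableType d2)
    (m1 : {sigma_finite_measure set T1 -> \bar R})
    (m2 : {sigma_finite_measure set T2 -> \bar R})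
    (f : T1 -> T2 -> R[i]) (h1 : T1 -> R) (h2 : T2 -> R) :
  cmeasurable (fun z : T1 * T2 => f z.1 z.2) ->
  m1.-integrable setT (EFin \o h1) -> m2.-integrable setT (EFin \o h2) ->
  (forall x y, cmod (f x y) <= h1 x * h2 y) ->
  cintegral m1 setT (fun x => cintegral m2 setT (f x)) =
  cintegral m2 setT (fun y => cintegral m1 setT (f ^~ y)).
Proof.
move=> [fr fi] ih1 ih2 fh; rewrite /cintegral; apply: complex_ext => /=.
  apply: (Rintegral_swap fr ih1 ih2) => x y.
  exact: le_trans (ler_Re_cmod _) (fh x y).
apply: (Rintegral_swap fi ih1 ih2) => x y.
exact: le_trans (ler_Im_cmod _) (fh x y).
Qed.

Lemma cmeasurable_caratheodory n d (T : measurableType d) (f : T -> 'rV[R]_n -> R[i]) :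
  (forall t, ccont (f t)) -> (forall v, cmeasurable (f ^~ v)) ->
  cmeasurable (fun z : T * 'rV[R]_n => f z.1 z.2).
Proof.
have ms : measurable_fun setT (fun z : T * 'rV[R]_n => (z.2, z.1)).
  by apply: measurable_fun_pair; [exact: measurable_snd|exact: measurable_fst].
move=> cf mf; split.
  have h := @measurable_caratheodory R n _ T (fun v t => complex.Re (f t v))
    (fun t => (cf t).1) (fun v => (mf v).1).
  exact: (measurableT_comp h ms).
have h := @measurable_caratheodory R n _ T (fun v t => complex.Im (f t v))
  (fun t => (cf t).2) (fun v => (mf v).2).
exact: (measurableT_comp h ms).
Qed.

Lemma measurable_row_mx d (T : measurableType d) m n (a : T -> 'rV[R]_m)
    (b : T -> 'rV[R]_n) : measurable_fun setT a -> measurable_fun setT b ->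
  measurable_fun setT (fun x => row_mx (a x) (b x)).
Proof.
move=> ma mb; apply: measurable_fun_rVP => i; case: (split_ordP i) => j ->.
  rewrite (_ : (fun x => _) = (fun v : 'rV[R]_m => v ord0 j) \o a).
    by apply: (measurableT_comp (measurable_rV_coord j)).
  by apply/funext => x /=; rewrite row_mxEl.
rewrite (_ : (fun x => _) = (fun v : 'rV[R]_n => v ord0 j) \o b).
  by apply: (measurableT_comp (measurable_rV_coord j)).
by apply/funext => x /=; rewrite row_mxEr.
Qed.

Lemma integrable_indic01 (c : R) :
  (@lebesgue_measure R).-integrable setT (EFin \o (fun t => c * \1_(`[0, 1]) t)).
Proof.
have i1 : (@lebesgue_measure R).-integrable `[0, 1] (EFin \o (fun=> c)).
  by apply: continuous_compact_integrable; [exact: segment_compact|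
    apply: continuous_in_subspaceT => x _; exact: cvg_cst].
have /(_ i1) := (@integrable_mkcond _ (measurableTypeR R) R (@lebesgue_measure R)
  `[0, 1]%classic (EFin \o (fun=> c)) (measurable_itv _)).1.
apply: eq_integrable => // t _; rewrite patchE /= indicE.
by case: ifP => _; rewrite ?mulr1 ?mulr0.
Qed.

Lemma Rintegral_indic01 (c : R) :
  \int[@lebesgue_measure R]_t (c * \1_(`[0, 1]) t) = c.
Proof.
transitivity (\int[@lebesgue_measure R]_(t in `[0, 1]) c).
  rewrite [RHS]Rintegral_mkcond; apply: eq_Rintegral => t _; rewrite patchE indicE.
  by case: ifP => _; rewrite ?mulr1 ?mulr0.
by rewrite Rintegral_cst//= lebesgue_measure_itv/= lte01 -EFinB/= subr0 mulr1.
Qed.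

Lemma measurable_indic01 :
  measurable_fun [set: measurableTypeR R] (\1_(`[0, 1]) : R -> R).
Proof. by apply: measurable_indic; exact: measurable_itv. Qed.

End complex_fubini.

(** * Integrations by parts in y and in (x, omega) *)

Section oscillatory.
Context {R : realType} {d : nat}.
Local Notation par := ('rV[R]_(d + d) * 'rV[R]_(d + d))%type.
Local Notation rVN := 'rV[R]_(d + (d + d)).
Implicit Types (t : R) (p : par) (V : rVN).

Definition osc (A : R -> par -> rVN -> R[i]) t p V : R[i] :=
  cis (phase t p V) * A t p V.

Definition ambiguity (g : 'rV[R]_d -> R[i]) t p V : R[i] :=
  (g (arg1 t p V))^*%C * g (arg2 t p V).

Lemma conj_wigner (g : 'rV[R]_d -> R[i]) t u z (zeta : 'rV[R]_(d + d)) :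
  (wigner_tau t (tf_shift u g) (tf_shift z g) zeta)^*%C =
  cintegral (lebesgue_rV d) setT
    (fun y => osc (ambiguity g) t (u, z) (row_mx y zeta)).
Proof.
rewrite /wigner_tau conj_cintegral; apply: eq_cintegral => y _.
rewrite /osc /ambiguity /tf_shift !conjcM !conjcK -!cisN.
rewrite /arg1 /arg2 row_mxKl row_mxKr /=.
set x := lsubmx zeta; set w := rsubmx zeta.
set a := g _; set b := g _.
rewrite mulrA [_ * (_ * a^*%C)]mulrA -!mulrA [a^*%C * _]mulrCA !mulrA -!cisD.
congr (_ * _ * _); congr cis; rewrite /phase row_mxKl row_mxKr /= -/x -/w /centre2 /=.
have dB n (e f h : 'rV[R]_n) : dotv e (f - h) = dotv e f - dotv e h.
  by rewrite dotvDr -scaleN1r dotvZr mulN1r.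
rewrite linearB/= !dB !dotvDr !dotvZr [dotv (_ - _) x]dotvC dB.
rewrite ![dotv y (rsubmx _)]dotvC ![dotv x (rsubmx _)]dotvC.
by ring.
Qed.

Lemma ccont_osc A t p : ccont (A t p) -> ccont (osc A t p).
Proof. by apply: ccontM; apply: ccont_cis; exact: continuous_phase. Qed.

Lemma cmod_osc A t p V : cmod (osc A t p V) = cmod (A t p V).
Proof. by rewrite cmodM cmod_cis mul1r. Qed.

Lemma cmeasurable_osc k B A p : amplitude k B A ->
  cmeasurable (fun z : measurableTypeR R * rVN => osc A z.1 p z.2).
Proof.
move=> /amplitude0[cA mA _].
apply: (@cmeasurable_caratheodory _ _ _ (measurableTypeR R) (fun t V => osc A t p V)).
  by move=> t; exact: ccont_osc.
move=> V.
apply: cmeasurableM => //; apply: cmeasurable_contR; apply: ccont_cis.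
exact: continuous_phase_time.
Qed.

Lemma freq_row_mx j t p (y : 'rV[R]_d) zeta : freq j t p (row_mx y zeta) =
  ((2 * pi) *: (rsubmx zeta - centre2 t p)) ord0 j.
Proof. by rewrite /freq row_mxKr !mxE. Qed.

Lemma continuous_row_mxl (zeta : 'rV[R]_(d + d)) :
  continuous (fun y : 'rV[R]_d => row_mx y zeta).
Proof.
apply: continuous_mx => i k; rewrite (ord1 i); case: (split_ordP k) => l ->.
  by under eq_fun do rewrite row_mxEl; exact: coord_continuous.
by under eq_fun do rewrite row_mxEr; exact: cst_continuous.
Qed.

Lemma continuous_row_mxr (y : 'rV[R]_d) :
  continuous (fun zeta : 'rV[R]_(d + d) => row_mx y zeta).
Proof.
apply: continuous_mx => i k; rewrite (ord1 i); case: (split_ordP k) => l ->.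
  by under eq_fun do rewrite row_mxEl; exact: cst_continuous.
by under eq_fun do rewrite row_mxEr; exact: coord_continuous.
Qed.

Lemma ccont_osc_left A t p (zeta : 'rV[R]_(d + d)) : ccont (A t p) ->
  ccont (fun y : 'rV[R]_d => osc A t p (row_mx y zeta)).
Proof.
move=> /ccont_osc cA; have [] := ccont_comp (@continuous_row_mxl zeta) cA; by split.
Qed.

Lemma ccont_osc_right A t p (y : 'rV[R]_d) : ccont (A t p) ->
  ccont (fun zeta : 'rV[R]_(d + d) => osc A t p (row_mx y zeta)).
Proof.
move=> /ccont_osc cA; have [] := ccont_comp (@continuous_row_mxr y) cA; by split.
Qed.

Lemma row_mx_linel (zeta : 'rV[R]_(d + d)) j (y : 'rV[R]_d) (r : R) :
  row_mx (r *: delta_mx ord0 j + y) zeta =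
  r *: delta_mx ord0 (lshift (d + d) j) + row_mx y zeta.
Proof. by rewrite delta_mx_lshift scale_row_mx add_row_mx scaler0 add0r. Qed.

Lemma row_mx_liner (y : 'rV[R]_d) j (zeta : 'rV[R]_(d + d)) (r : R) :
  row_mx y (r *: delta_mx ord0 j + zeta) =
  r *: delta_mx ord0 (rshift d j) + row_mx y zeta.
Proof. by rewrite delta_mx_rshift scale_row_mx add_row_mx scaler0 add0r. Qed.

(** After the integrations by parts, the nonvanishing factors 1 + i freq are divided out. Their
    inverses are constant in y but stay under the integral, since they will be part of the amplitude
    in which omega varies. *)
Lemma osc_parts_left (s : seq 'I_d) k B A (D : par -> R) :
  amplitude (size s + k) B A ->
  (forall t p y zeta, 0 <= t <= 1 -> B t p (row_mx y zeta) <= D p * ipw y) ->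
  exists2 A', amplitude k B A' & forall t p zeta, 0 <= t <= 1 ->
    cintegral (lebesgue_rV d) setT (fun y => osc A t p (row_mx y zeta)) =
    cintegral (lebesgue_rV d) setT (fun y =>
      (\prod_(j <- s) rinv (freq j t p (row_mx y zeta))) * osc A' t p (row_mx y zeta)).
Proof.
move=> aA BD; have [A' aA' E] := amplitude_parts (lshift (d + d)) aA.
exists A' => // t p zeta t01.
pose c := (2 * pi) *: (rsubmx zeta - centre2 t p).
pose r := \prod_(j <- s) rinv (c ord0 j).
have [cA' _ [C C0 hC]] := amplitude0 aA'.
have iA' : cintegrable (lebesgue_rV d) (fun y => osc A' t p (row_mx y zeta)).
  apply: (@cintegrable_ipw _ _ _ (C * D p)).
    exact: ccont_osc_left.
  move=> y; rewrite cmod_osc; apply: le_trans (hC _ _ _ t01) _.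
  by rewrite -mulrA ler_wpM2l// BD.
rewrite [RHS](_ : _ = cintegral (lebesgue_rV d) setT
    (fun y => r * osc A' t p (row_mx y zeta))); last first.
  by apply: eq_cintegral => y _; congr (_ * _); apply: eq_bigr => j _; rewrite freq_row_mx.
rewrite cintegralZl//.
have := E t p (fun y => row_mx y zeta) c
  (- (2 * pi * dotv (rsubmx (p.1 - p.2)) (lsubmx zeta))) (D p) t01
  (@continuous_row_mxl zeta) (row_mx_linel zeta) (fun y => BD t p y zeta t01).
have Eo A0 : cintegral (lebesgue_rV d) setT (fun y => osc A0 t p (row_mx y zeta)) =
    cintegral (lebesgue_rV d) setT (fun y => cis (dotv c y +
      - (2 * pi * dotv (rsubmx (p.1 - p.2)) (lsubmx zeta))) * A0 t p (row_mx y zeta)).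
  by apply: eq_cintegral => y _; rewrite /osc phaseE_left.
rewrite -!Eo => <-; rewrite mulrA /r -big_split/= big1 ?mul1r// => j _.
exact: rinvK.
Qed.

Lemma pw_two_pi n (v : 'rV[R]_n) : pw v <= pw ((2 * pi) *: v).
Proof. by rewrite -lef_pV2 ?posrE ?pw_gt0//; exact: ipwZ_le. Qed.

(** For fixed y the frequency of the phase in (x, omega) is (-2 pi w2, 2 pi y): the x-coordinates
    yield decay in w2 and the omega-coordinates decay in y. Two integrations per power are used
    because |1 + i c|^2 = 1 + c^2. *)
Lemma osc_parts_right N B A (D : R -> par -> 'rV[R]_d -> R) :
  amplitude (size (multi_dirs (fun _ : 'I_(d + d) => (2 * N)%N)) + 0) B A ->
  (forall t p y, 0 <= D t p y) ->
  (forall t p y zeta, 0 <= t <= 1 ->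
    B t p (row_mx y zeta) <= D t p y * ipw (zeta - centre t p)) ->
  exists2 C : R, 0 <= C & forall t p (y : 'rV[R]_d), 0 <= t <= 1 ->
    cmod (cintegral (lebesgue_rV (d + d)) setT (fun zeta => osc A t p (row_mx y zeta))) <=
    C * (ipw (rsubmx (p.1 - p.2)) ^+ N * ipw y ^+ N * D t p y).
Proof.
set s := multi_dirs _ => aA D0 BD.
have [A' aA' E] := amplitude_parts (@rshift d (d + d)) aA.
have [cA' _ [C C0 hC]] := amplitude0 aA'.
exists (2 * (C * pi ^+ (d + d))); first by rewrite !mulr_ge0 ?exprn_ge0 ?pi_ge0.
move=> t p y t01.
pose c := row_mx (- (2 * pi) *: rsubmx (p.1 - p.2)) ((2 * pi) *: y) : 'rV[R]_(d + d).
(* Integration by parts asks for a bound centred at 0. The resulting constant depends on [p] but is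
   used only there; the size of the integral is estimated with the bound centred at [centre t p]. *)
have BD' zeta : B t p (row_mx y zeta) <=
    D t p y * (2 ^+ (d + d) * pw (centre t p)) * ipw zeta.
  by apply: le_trans (BD _ _ _ _ t01) _; rewrite -mulrA ler_wpM2l// ipw_shift.
have := E t p (fun zeta => row_mx y zeta) c
  (- (2 * pi * dotv y (centre2 t p))) _ t01
  (@continuous_row_mxr y) (row_mx_liner y) BD'.
have Eo A0 : cintegral (lebesgue_rV (d + d)) setT (fun zeta => osc A0 t p (row_mx y zeta)) =
    cintegral (lebesgue_rV (d + d)) setT (fun zeta => cis (dotv c zeta +
      - (2 * pi * dotv y (centre2 t p))) * A0 t p (row_mx y zeta)).
  by apply: eq_cintegral => zeta _; rewrite /osc phaseE_right.
rewrite -!Eo => /(congr1 (@cmod R)); rewrite cmodM prod_Complex1_sqr => EE.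
have cA'y := ccont_osc_right y (cA' t p).
have ih : (lebesgue_rV (d + d)).-integrable setT
    (EFin \o (fun zeta => C * D t p y * ipw (zeta - centre t p))).
  exact: integrable_ipw.
have hle zeta : cmod (osc A' t p (row_mx y zeta)) <=
    C * D t p y * ipw (zeta - centre t p).
  rewrite cmod_osc; apply: le_trans (hC _ _ _ t01) _.
  by rewrite -mulrA ler_wpM2l// BD.
have := cmod_cintegral_le (cmeasurable_cont cA'y) ih hle.
rewrite -EE RintegralZl//; last first.
  by have := @integrable_ipw R (d + d) 1 (centre t p); under eq_fun do rewrite mul1r.
move=> le1; have cc : pw (rsubmx (p.1 - p.2)) * pw y <= pw c.
  rewrite pw_row_mx scaleNr pwN; apply: ler_pM; rewrite ?pw_ge0 ?pw_two_pi//.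
set I := cmod _ in le1 *.
have le2 : (pw (rsubmx (p.1 - p.2)) * pw y) ^+ N * I <= 2 * (C * pi ^+ (d + d)) * D t p y.
  apply: le_trans (le_trans _ le1) _.
    rewrite ler_wpM2r ?cmod_ge0// lerXn2r ?nnegrE ?pw_ge0// mulr_ge0 ?pw_ge0//.
  rewrite -!mulrA !ler_wpM2l// [leRHS]mulrC ler_wpM2l//.
  exact: Rintegral_ipw_le.
rewrite -exprMn -invfM exprVn mulrCA mulrC ler_pdivlMr; last first.
  by rewrite exprn_gt0// mulr_gt0 ?pw_gt0.
by rewrite mulrC.
Qed.

End oscillatory.

(** * Exchanging the order of integration *)

Section decay.
Context {R : realType} {d : nat}.
Local Notation par := ('rV[R]_(d + d) * 'rV[R]_(d + d))%type.
Local Notation lam := (@lebesgue_measure R).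

Lemma indic01P (t : R) :
  (0 <= t <= 1 /\ \1_(`[0, 1]) t = 1 :> R) \/ \1_(`[0, 1]) t = 0 :> R.
Proof.
rewrite indicE; have [t01|t01] := boolP (0 <= t <= 1).
  by left; split=> //; rewrite mem_set//= in_itv.
by right; rewrite memNset//= in_itv/=; exact/negP.
Qed.

Lemma integrable_ipw1 n : (lebesgue_rV n).-integrable setT (EFin \o @ipw R n).
Proof. by have := @integrable_ipw R n 1 0; under eq_fun do rewrite mul1r subr0. Qed.

(** Two exchanges bring the (x, omega)-integral inside, first past tau and then past y. [Cp] only
    has to be finite for this; the estimate rests on [D], with a factor 2 from the tau-integral over
    a set of mass 1. *)
Lemma cmod_iterated_osc_le k B A (p : par) (Cp D : R) :
  amplitude k B A -> 0 <= Cp ->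
  (forall t y zeta, 0 <= t <= 1 ->
    cmod (A t p (row_mx y zeta)) <= Cp * (ipw y * ipw zeta)) ->
  (forall t, 0 <= t <= 1 -> cmod (cintegral (lebesgue_rV d) setT (fun y =>
    cintegral (lebesgue_rV (d + d)) setT (fun zeta => osc A t p (row_mx y zeta)))) <= D) ->
  cmod (cintegral (lebesgue_rV (d + d)) setT (fun zeta =>
    cintegral lam setT (fun t => Complex (\1_(`[0, 1]) t) 0 *
      cintegral (lebesgue_rV d) setT (fun y => osc A t p (row_mx y zeta))))) <= 2 * D.
Proof.
move=> aA Cp0 AC hD.
(* The bounds on [A] hold for times in [0, 1] alone; with the indicator inside, the kernel is
   bounded and measurable over the whole line. *)
pose Kn (t : R) (y : 'rV[R]_d) (zeta : 'rV[R]_(d + d)) : R[i] :=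
  Complex (\1_(`[0, 1]) t) 0 * osc A t p (row_mx y zeta).
have KnC t y zeta : cmod (Kn t y zeta) <= Cp * \1_(`[0, 1]) t * (ipw y * ipw zeta).
  rewrite /Kn cmodM cmod_real cmod_osc.
  case: (indic01P t) => [[t01 ->]|->]; last by rewrite normr0 !(mul0r, mulr0).
  by rewrite normr1 mul1r mulr1 AC.
have mind : cmeasurable (fun t : measurableTypeR R => Complex (\1_(`[0, 1]) t : R) 0).
  by split; [exact: measurable_indic01|exact: measurable_cst].
have mKn d' (S : measurableType d') (a : S -> measurableTypeR R) (b : S -> 'rV[R]_d)
    (c : S -> 'rV[R]_(d + d)) : measurable_fun setT a -> measurable_fun setT b ->
    measurable_fun setT c -> cmeasurable (fun x => Kn (a x) (b x) (c x)).
  move=> ma mb mc; apply: cmeasurableM; first exact: (cmeasurable_comp mind ma).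
  have ms : measurable_fun setT (fun x => (a x, row_mx (b x) (c x))).
    by apply: measurable_fun_pair => //; exact: measurable_row_mx.
  exact: (cmeasurable_comp (cmeasurable_osc p aA) ms).
have iKny t zeta : cintegrable (lebesgue_rV d) (fun y => osc A t p (row_mx y zeta)) \/
    \1_(`[0, 1]) t = 0 :> R.
  case: (indic01P t) => [[t01 _]|]; last by right.
  left; apply: (@cintegrable_ipw _ _ _ (Cp * ipw zeta)).
    by apply: ccont_osc_left; have [+ _ _] := amplitude0 aA; apply.
  by move=> y; rewrite cmod_osc -mulrA [ipw zeta * _]mulrC AC.
have EKn t zeta : Complex (\1_(`[0, 1]) t) 0 *
    cintegral (lebesgue_rV d) setT (fun y => osc A t p (row_mx y zeta)) =
    cintegral (lebesgue_rV d) setT (fun y => Kn t y zeta).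
  case: (iKny t zeta) => [i|t0]; first by rewrite cintegralZl.
  have z0 : Complex (\1_(`[0, 1]) t) 0 = 0 :> R[i] by rewrite t0.
  by rewrite z0 mul0r cintegral_eq0// => y; rewrite /Kn z0 mul0r.
pose I : R := \int[lebesgue_rV d]_y ipw y.
have I0 : 0 <= I by apply: Rintegral_ge0 => y _; exact: ipw_ge0.
pose h2 (t : R) := 2 * (Cp * I) * \1_(`[0, 1]) t.
have ih2 : lam.-integrable setT (EFin \o h2) by exact: integrable_indic01.
rewrite (@eq_cintegral _ _ _ _ setT _ (fun zeta => cintegral lam setT
    (fun t => cintegral (lebesgue_rV d) setT (fun y => Kn t y zeta)))); last first.
  by move=> zeta _; apply: eq_cintegral => t _; exact: EKn.
have mf : forall d1 d2 (T1 : measurableType d1) (T2 : measurableType d2),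
    measurable_fun setT (@fst T1 T2) by move=> *; exact: measurable_fst.
have ms : forall d1 d2 (T1 : measurableType d1) (T2 : measurableType d2),
    measurable_fun setT (@snd T1 T2) by move=> *; exact: measurable_snd.
have iy (c : R) : (lebesgue_rV d).-integrable setT (EFin \o (fun y => c * ipw y)).
  by have := @integrable_ipw R d c 0; under eq_fun do rewrite subr0.
rewrite (@cintegral_swap _ _ _ _ _ (lebesgue_rV (d + d)) lam
    (fun zeta t => cintegral (lebesgue_rV d) setT (fun y => Kn t y zeta))
    (@ipw R (d + d)) h2); first last.
- move=> zeta t.
  have := @cmod_cintegral_le _ _ _ (lebesgue_rV d) (fun y => Kn t y zeta)
    (fun y => Cp * \1_(`[0, 1]) t * ipw zeta * ipw y) _ (iy _) _.
  rewrite RintegralZl//; last exact: integrable_ipw1.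
  rewrite -/I => h; apply: le_trans (h _ _) _.
  + by apply: mKn => //; exact: measurable_cst.
  + by move=> y; rewrite -mulrA [ipw zeta * _]mulrC; exact: KnC.
  + by rewrite /h2 le_eqVlt; apply/orP; left; apply/eqP; ring.
- exact: ih2.
- exact: integrable_ipw1.
- apply: (@cmeasurable_cintegral _ _ _ _ _ (lebesgue_rV d)
    (fun (z : 'rV[R]_(d + d) * measurableTypeR R) y => Kn z.2 y z.1)).
  by apply: mKn => //; exact: (measurableT_comp _ (mf _ _ _ _)).
rewrite (@eq_cintegral _ (measurableTypeR R) _ _ setT _
    (fun t : measurableTypeR R => cintegral (lebesgue_rV d) setT
    (fun y => cintegral (lebesgue_rV (d + d)) setT (fun zeta => Kn t y zeta)))); last first.
  move=> t _.
  apply: (@cintegral_swap _ _ _ _ _ (lebesgue_rV (d + d)) (lebesgue_rV d)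
    (fun zeta y => Kn t y zeta) (@ipw R (d + d)) (fun y => Cp * \1_(`[0, 1]) t * ipw y)).
  - by apply: mKn => //; exact: measurable_cst.
  - exact: integrable_ipw1.
  - exact: iy.
  - by move=> zeta y; rewrite mulrCA [ipw zeta * _]mulrC; exact: KnC.
rewrite -[X in _ <= 2 * X]Rintegral_indic01.
apply: cmod_cintegral_le.
- apply: (@cmeasurable_cintegral _ _ _ _ _ (lebesgue_rV d)
    (fun (t : measurableTypeR R) y =>
      cintegral (lebesgue_rV (d + d)) setT (fun zeta => Kn t y zeta))).
  apply: (@cmeasurable_cintegral _ _ _ _ _ (lebesgue_rV (d + d))
    (fun (z : measurableTypeR R * 'rV[R]_d) zeta => Kn z.1 z.2 zeta)).
  by apply: mKn => //; exact: (measurableT_comp _ (mf _ _ _ _)).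
- exact: integrable_indic01.
move=> t; case: (indic01P t) => [[t01 t1]|t0]; last first.
  rewrite t0 mulr0 cintegral_eq0 ?cmod_real ?normr0// => y.
  by rewrite cintegral_eq0// => zeta; rewrite /Kn t0 mul0r.
rewrite t1 mulr1; apply: le_trans (hD t t01).
rewrite (@eq_cintegral _ _ _ _ setT _ (fun y => cintegral (lebesgue_rV (d + d)) setT
  (fun zeta => osc A t p (row_mx y zeta))))// => y _.
by apply: eq_cintegral => zeta _; rewrite /Kn t1 mul1r.
Qed.

End decay.

(** * Decay of the matrix element *)

Section decay_estimate.
Context {R : realType} {d : nat}.
Local Notation par := ('rV[R]_(d + d) * 'rV[R]_(d + d))%type.
Local Notation rVN := 'rV[R]_(d + (d + d)).
Local Notation lam := (@lebesgue_measure R).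

Lemma ipw_triangle n (v w : 'rV[R]_n) : ipw w * ipw (w - v) <= 2 ^+ n * ipw v.
Proof.
have := pwD w (v - w); rewrite addrC subrK -opprB pwN => h.
rewrite /ipw -invfM -[leLHS]div1r ler_pdivrMr ?mulr_gt0 ?pw_gt0// mulrAC.
by rewrite ler_pdivlMr ?pw_gt0// mul1r.
Qed.

(** [sigma zeta] is constant in tau, so it passes under the tau-integral; there its product with the
    y-integral is replaced by the form obtained after integrating by parts. No order of integration
    is changed here. *)
Lemma Op_BJ_as_iterated (g : 'rV[R]_d -> R[i]) (sigma : 'rV[R]_(d + d) -> R[i])
    k B (A : R -> par -> rVN -> R[i]) (u z : 'rV[R]_(d + d)) (CF : R) :
  schwartz g ->
  (forall t y zeta, 0 <= t <= 1 ->
    cmod (ambiguity g t (u, z) (row_mx y zeta)) <= CF * ipw y) ->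
  (forall t zeta, 0 <= t <= 1 ->
    sigma zeta * cintegral (lebesgue_rV d) setT (fun y =>
      osc (ambiguity g) t (u, z) (row_mx y zeta)) =
    cintegral (lebesgue_rV d) setT (fun y => osc A t (u, z) (row_mx y zeta))) ->
  amplitude k B (ambiguity g) ->
  Op_BJ (regular_distribution sigma) (tf_shift z g) (tf_shift u g) =
  cintegral (lebesgue_rV (d + d)) setT (fun zeta =>
    cintegral lam setT (fun t => Complex (\1_(`[0, 1]) t) 0 *
      cintegral (lebesgue_rV d) setT (fun y => osc A t (u, z) (row_mx y zeta)))).
Proof.
move=> sg FC sA aF; rewrite /Op_BJ /regular_distribution.
apply: eq_cintegral => zeta _; rewrite /wigner_BJ conj_cintegral cintegral_mkcond.
rewrite (@eq_cintegral _ (measurableTypeR R) _ _ setT _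
  (fun t : R => Complex (\1_(`[0, 1]) t) 0 * cintegral (lebesgue_rV d) setT (fun y =>
      osc (ambiguity g) t (u, z) (row_mx y zeta)))); last first.
  by move=> t _; rewrite conj_wigner.
rewrite -cintegralZl.
  apply: eq_cintegral => t _; rewrite mulrCA.
  case: (indic01P t) => [[t01 _]|t0]; first by rewrite sA.
  have z0 : Complex (\1_(`[0, 1]) t) 0 = 0 :> R[i] by rewrite t0.
  by rewrite z0 !mul0r.
have mF : cmeasurable (fun t : measurableTypeR R =>
    cintegral (lebesgue_rV d) setT (fun y =>
      osc (ambiguity g) t (u, z) (row_mx y zeta))).
  apply: (@cmeasurable_cintegral _ _ _ _ _ (lebesgue_rV d)
    (fun (t : measurableTypeR R) y => osc (ambiguity g) t (u, z) (row_mx y zeta))).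
  have ms : measurable_fun setT (fun x : measurableTypeR R * 'rV[R]_d =>
      (x.1, row_mx x.2 zeta)).
    apply: measurable_fun_pair; first exact: measurable_fst.
    by apply: measurable_row_mx; [exact: measurable_snd|exact: measurable_cst].
  exact: (cmeasurable_comp (cmeasurable_osc (u, z) aF) ms).
pose I : R := \int[lebesgue_rV d]_y ipw y.
apply: (@cintegrable_dominated _ (measurableTypeR R) _ _ _
  (fun t : R => 2 * (CF * I) * \1_(`[0, 1]) t)).
- apply: cmeasurableM => //.
  by split; [exact: measurable_indic01|exact: measurable_cst].
- exact: integrable_indic01.
move=> t; rewrite cmodM cmod_real.
case: (indic01P t) => [[t01 ->]|->]; last by rewrite normr0 mul0r mulr0.
rewrite normr1 mul1r mulr1 /I -RintegralZl//; last exact: integrable_ipw1.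
apply: cmod_cintegral_le.
- apply: cmeasurable_cont; apply: ccont_osc_left.
  by have [+ _ _] := amplitude0 aF; apply.
- by have := @integrable_ipw R d CF 0; under eq_fun do rewrite subr0.
- by move=> y; rewrite cmod_osc FC.
Qed.

Lemma Op_BJ_decay (g : 'rV[R]_d -> R[i]) (m : R) (sigma : 'rV[R]_(d + d) -> R[i])
    (N0 : nat) : schwartz g -> symbol_class m sigma ->
  exists2 C : R, 0 <= C & forall u z,
    cmod (Op_BJ (regular_distribution sigma) (tf_shift z g) (tf_shift u g)) <=
    C * (japanese z `^ m * ipw (u - z) ^+ N0).
Proof.
move=> sg hs; have [k wb] := @weight_bound R d m.
(* [k] powers compensate [pw (u - z) ^+ k] from Peetre and [N0] remain; the additional power in
   [N.+1] makes the y-integral converge. *)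
pose N := (k + N0)%N; have [C1 C10 hw] := wb N.+1.
pose s1 := multi_dirs (fun _ : 'I_d => (2 * k.+1)%N).
pose s2 := multi_dirs (fun _ : 'I_(d + d) => (2 * N)%N).
(* The regularity is spent in two stages, [size s1] orders in y and then [size s2] in (x, omega);
   the exponent is the one that [weight_bound] consumes. *)
have aF := @amplitude_ambiguity R d g (size s1 + (size s2 + 0)) (k.+1 + N.+1) sg.
pose D1 (p : par) : R := 2 ^+ d * (2 ^+ d * pw (lsubmx (p.1 - p.2))).
have [F' aF' EF] := @osc_parts_left R d s1 (size s2 + 0) _ _ D1 aF
  (fun t p y zeta _ => ambiguity_weight_le t p y zeta (k + N.+1)).
pose A t (p : par) V :=
  sigma (rsubmx V) * \prod_(j <- s1) rinv (freq j t p V) * F' t p V.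
have aA := amplitudeM (amplitudeM (amplitude_symbol (size s2 + 0) hs)
  (amplitude_freq (size s2 + 0) s1)) aF'.
rewrite -/A in aA; set BA := (X in amplitude _ X A) in aA.
pose D2 (t : R) (p : par) (y : 'rV[R]_d) : R := C1 * (japanese p.2 `^ m *
  pw (p.1 - p.2) ^+ k * ipw (y - lsubmx (p.1 - p.2)) ^+ N.+1).
have D20 t p y : 0 <= D2 t p y.
  by rewrite /D2 !mulr_ge0 ?powR_ge0 ?exprn_ge0 ?pw_ge0 ?ipw_ge0.
have BAD t p y zeta : 0 <= t <= 1 ->
    BA t p (row_mx y zeta) <= D2 t p y * ipw (zeta - centre t p).
  move=> t01; apply: le_trans (hw t p (row_mx y zeta) t01) _.
  by rewrite row_mxKl row_mxKr mulrA.
have [C2 C20 hright] := osc_parts_right aA D20 BAD.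
pose C3 := C2 * (C1 * (2 ^+ d) ^+ N).
(* One factor 2 for each of the tau- and y-integrals, and [pi ^+ d] for the integral of [ipw] over
   y. *)
exists (2 * (2 * (C3 * pi ^+ d))).
  by rewrite !mulr_ge0 ?exprn_ge0 ?pi_ge0.
move=> u z; pose p : par := (u, z).
pose G : R := japanese z `^ m * ipw (u - z) ^+ N0.
have inner t y : 0 <= t <= 1 ->
    cmod (cintegral (lebesgue_rV (d + d)) setT
      (fun zeta => osc A t p (row_mx y zeta))) <=
    C3 * G * ipw (y - lsubmx (u - z)).
  move=> t01; apply: le_trans (hright t p y t01) _.
  rewrite /C3 -!mulrA ler_wpM2l// /D2 /=.
  set w := u - z; set w1 := lsubmx w; set w2 := rsubmx w.
  (* Decay in y, from the omega-integrations, and decay in y - w1, from g, together give decay in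
     w1; one factor [ipw (y - w1)] is kept aside. *)
  have tri : ipw y ^+ N * ipw (y - w1) ^+ N <= (2 ^+ d * ipw w1) ^+ N.
    rewrite -exprMn lerXn2r ?nnegrE ?mulr_ge0 ?exprn_ge0 ?ipw_ge0//.
    exact: ipw_triangle.
  have wE : ipw w = ipw w1 * ipw w2 by rewrite -ipw_row_mx hsubmxK.
  have pG : pw w ^+ k * ipw w ^+ N = ipw w ^+ N0.
    by rewrite /N exprD mulrA -exprMn /ipw divff ?expr1n ?mul1r ?gt_eqF ?pw_gt0.
  rewrite exprSr.
  rewrite (_ : ipw w2 ^+ N * _ = C1 * (japanese z `^ m * (pw w ^+ k *
    (ipw w2 ^+ N * (ipw y ^+ N * ipw (y - w1) ^+ N) * ipw (y - w1))))); last by ring.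
  rewrite ler_wpM2l//.
  rewrite [leRHS](_ : _ = japanese z `^ m * (pw w ^+ k *
    (ipw w2 ^+ N * (2 ^+ d * ipw w1) ^+ N * ipw (y - w1)))); last first.
    by rewrite -pG wE !exprMn; ring.
  rewrite ler_wpM2l ?powR_ge0// ler_wpM2l ?exprn_ge0 ?pw_ge0//.
  by rewrite ler_wpM2r ?ipw_ge0// ler_wpM2l ?exprn_ge0 ?ipw_ge0.
have G0 : 0 <= G by rewrite mulr_ge0 ?powR_ge0 ?exprn_ge0 ?ipw_ge0.
have [cA _ [CA CA0 hCA]] := amplitude0 aA.
have [_ _ [CF CF0 hCF]] := amplitude0 aF.
have [_ _ [CF' CF'0 hCF']] := amplitude0 aF'.
(* This constant may depend on u and z in any way, as it only serves to justify Fubini. *)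
pose Kp : R := C1 * (japanese z `^ m * pw (u - z) ^+ k) *
  (2 ^+ d * pw (lsubmx (u - z))) *
  (2 ^+ (d + d) * (2 ^+ (d + d) * (pw z * pw (u - z)))).
have hA t y zeta : 0 <= t <= 1 ->
    cmod (A t p (row_mx y zeta)) <= CA * Kp * (ipw y * ipw zeta).
  move=> t01; apply: le_trans (hCA t p _ t01) _.
  rewrite -mulrA ler_wpM2l//; apply: le_trans (BAD t p y zeta t01) _.
  have e1 : ipw (y - lsubmx (u - z)) ^+ N.+1 <= 2 ^+ d * pw (lsubmx (u - z)) * ipw y.
    rewrite exprS; apply: le_trans (ipw_shift _ _).
    by rewrite ler_piMr ?ipw_ge0// exprn_ile1 ?ipw_ge0 ?ipw_le1.
  have e2 : ipw (zeta - centre t p) <=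
      2 ^+ (d + d) * (2 ^+ (d + d) * (pw z * pw (u - z))) * ipw zeta.
    apply: le_trans (ipw_shift _ _) _; rewrite ler_wpM2r ?ipw_ge0//.
    by rewrite ler_wpM2l ?exprn_ge0// (pw_centre_le p t01).
  have X0 : 0 <= C1 * (japanese z `^ m * pw (u - z) ^+ k).
    by rewrite !mulr_ge0 ?powR_ge0 ?exprn_ge0 ?pw_ge0.
  have := ler_wpM2l X0 (ler_pM (exprn_ge0 _ (ipw_ge0 _)) (ipw_ge0 _) e1 e2).
  by congr (_ <= _); rewrite /D2 /Kp /=; ring.
have AE t zeta : 0 <= t <= 1 ->
    sigma zeta * cintegral (lebesgue_rV d) setT (fun y =>
      osc (ambiguity g) t p (row_mx y zeta)) =
    cintegral (lebesgue_rV d) setT (fun y => osc A t p (row_mx y zeta)).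
  move=> t01; rewrite (EF t p zeta t01).
  (* [A1] is [A] without the symbol: for fixed (x, omega) the symbol is constant in y and can be
     moved inside. *)
  pose A1 t (p : par) V := \prod_(j <- s1) rinv (freq j t p V) * F' t p V.
  have [cA1 _ _] := amplitude0 (amplitudeM (amplitude_freq (size s2 + 0) s1) aF').
  rewrite (@eq_cintegral _ _ _ _ setT _ (fun y => osc A1 t p (row_mx y zeta))); last first.
    by move=> y _; rewrite /osc /A1 mulrCA.
  rewrite -cintegralZl; last first.
    apply: (@cintegrable_ipw _ _ _ (CF' * D1 p)); first exact: (ccont_osc_left zeta (cA1 t p)).
    move=> y; rewrite cmod_osc cmodM cmod_prod.
    apply: le_trans (ler_piMl (cmod_ge0 _) _) _.
      by apply: prodr_ile1 => j _; rewrite cmod_ge0 cmod_rinv_le1.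
    apply: le_trans (hCF' t p _ t01) _; rewrite -mulrA ler_wpM2l//.
    exact: (ambiguity_weight_le t p y zeta (k + N.+1)).
  apply: eq_cintegral => y _; rewrite /osc /A /A1 row_mxKr.
  by rewrite mulrCA; congr (_ * _); rewrite mulrA.
have FC t y zeta : 0 <= t <= 1 ->
    cmod (ambiguity g t p (row_mx y zeta)) <= CF * D1 p * ipw y.
  move=> t01; apply: le_trans (hCF t p _ t01) _; rewrite -mulrA ler_wpM2l//.
  exact: (ambiguity_weight_le t p y zeta (k + N.+1)).
rewrite (Op_BJ_as_iterated sg FC AE aF) -[leRHS]mulrA -/G.
apply: (cmod_iterated_osc_le aA _ hA) => [|t t01].
  by rewrite /Kp !mulr_ge0 ?powR_ge0 ?exprn_ge0 ?pw_ge0.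
have ih : (lebesgue_rV d).-integrable setT
    (EFin \o (fun y => C3 * G * ipw (y - lsubmx (u - z)))) by exact: integrable_ipw.
apply: le_trans (cmod_cintegral_le _ ih (fun y => inner t y t01)) _.
  apply: (@cmeasurable_cintegral _ _ _ _ _ (lebesgue_rV (d + d))
    (fun y zeta => osc A t p (row_mx y zeta))).
  apply: (cmeasurable_comp (cmeasurable_cont (ccont_osc (cA t p)))).
  by apply: measurable_row_mx; [exact: measurable_fst|exact: measurable_snd].
rewrite RintegralZl//; last first.
  by have := @integrable_ipw R d 1 (lsubmx (u - z)); under eq_fun do rewrite mul1r.
rewrite -[leRHS]mulrA ler_wpM2l// mulrAC ler_wpM2r// ler_wpM2l//.
  by rewrite /C3 !mulr_ge0 ?exprn_ge0.
exact: Rintegral_ipw_le.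
Qed.

End decay_estimate.

Unset Implicit Arguments.

Theorem theorem3p8 (R : realType) (d : nat) (g : 'rV[R]_d -> R[i]) (m : R)
    (sigma : 'rV[R]_(d + d) -> R[i])
    (hg : schwartz g) (hg0 : g <> (fun=> 0))
    (hsigma : symbol_class m sigma)
    (s : R) (hs : 0 <= s) (q : \bar R) (hq : (0 < q)%E) :
  exists (H : R -> 'rV[R]_(d + d) -> R) (C : R),
    [/\ 0 < C,
        forall tau, 0 <= tau <= 1 ->
          weighted_Lspace q s (H tau) /\
          (weighted_Lnorm q s (H tau) <= C%:E)%E,
        forall w : 'rV[R]_(d + d),
          lebesgue_measure.-integrable `[0, 1] (fun tau : R => (H tau w)%:E) &
        forall u z : 'rV[R]_(d + d),
          cmod (Op_BJ (regular_distribution sigma) (tf_shift z g) (tf_shift u g))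
          <= japanese z `^ m *
             \int[lebesgue_measure]_(tau in `[0, 1]) H tau (u - z)].
Proof.
(* [q] and [s] fix the exponent, the decay estimate at this exponent gives [C0], and only then is
   the norm bounded. *)
have [k hk] := @weighted_Lnorm_ipw R (d + d) q s hq hs.
have [C0 C00 hC0] := @Op_BJ_decay R d g m sigma k hg hsigma.
have [C C_gt0 [HL HC]] := hk C0 C00.
exists (fun _ w => C0 * ipw w ^+ k), C; split=> //.
- move=> w; apply: continuous_compact_integrable; first exact: segment_compact.
  by apply: continuous_in_subspaceT => x _; exact: cvg_cst.
move=> u z; rewrite Rintegral_cst//= lebesgue_measure_itv/= lte01 -EFinB/= subr0 mulr1.
by rewrite mulrCA; exact: hC0.
Qed.
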